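(* The following decision problem is $\forall\mathbb{R}$-complete (under polynomial-time many-one reductions): given a semialgebraic set $S\subseteq\mathbb{R}^d$ and a number $r$, decide whether $S$ has radius at most $r$, i.e., whether there is $x\in\mathbb{R}^d$ such that $\lVert x-y\rVert\leq r$ for all $y\in S$.
   Context: A semialgebraic set $S\subseteq\mathbb{R}^d$ is given as $S=\{x:\varphi(x)\}$ by a quantifier-free formula $\varphi$ that is a Boolean combination of polynomial conditions $g(x)\bowtie 0$, $\bowtie\in\{<,\leq,=,\geq,>\}$, with integer coefficients encoded in binary; $r$ is a given rational number; $\lVert\cdot\rVert$ is the Euclidean norm. $\forall\mathbb{R}$ (also written $\mathrm{co}\exists\mathbb{R}$) is the class of decision problems polynomial-time many-one reducible to the set of true sentences of the form $(\forall x_1,\dots,x_n)\ \psi(x_1,\dots,x_n)$ with variables over $\mathbb{R}$ and $\psi$ a quantifier-free formula built with $\wedge,\vee$ from atomic predicates $t\bowtie 0$ ($t$ a term over the variables, $0,1,+,\cdot$). *)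

(* Defs.v *)
From HB Require Import structures.
From mathcomp Require Import all_boot all_order all_algebra.
From mathcomp Require Import classical_sets reals.

Set Implicit Arguments.
Unset Strict Implicit.
Unset Printing Implicit Defensive.

Import Order.TTheory GRing.Theory Num.Theory.

Local Open Scope ring_scope.

Inductive move := MLeft | MStay | MRight.

(* A two-way infinite tape: [tleft] lists the cells to the left of the head
   (nearest first), [tright] those to its right (nearest first).  [None] is the
   blank, and all cells beyond the two lists are blank. *)
Record tape (G : Type) := Tape {
  tleft : seq (option G);
  thead : option G;
  tright : seq (option G) }.

Definition tape_write (G : Type) (a : option G) (t : tape G) : tape G :=
  Tape (tleft t) a (tright t).

Definition tape_move (G : Type) (m : move) (t : tape G) : tape G :=
  match m with
  | MStay => t
  | MLeft => Tape (behead (tleft t)) (head None (tleft t))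
                  (thead t :: tright t)
  | MRight => Tape (thead t :: tleft t) (head None (tright t))
                   (behead (tright t))
  end.

Definition tape_of_word (G : Type) (w : seq G) : tape G :=
  Tape [::] (ohead w) (map Some (behead w)).

Fixpoint until_blank (G : Type) (s : seq (option G)) : seq G :=
  if s is Some a :: s' then a :: until_blank s' else [::].

Definition word_of_tape (G : Type) (t : tape G) : seq G :=
  until_blank (thead t :: tright t).

(* [S] is the input alphabet, [D] the output alphabet; the machine has
   [tm_tapes.+1] tapes, and tape [ord0] carries both the input and the output. *)
Record turing_machine (S D : finType) := TuringMachine {
  tm_sym : finType;
  tm_in : S -> tm_sym;
  tm_out : D -> tm_sym;
  tm_in_inj : injective tm_in;
  tm_out_inj : injective tm_out;
  tm_tapes : nat;
  tm_state : finType;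
  tm_start : tm_state;
  tm_halt : pred tm_state;
  tm_trans : tm_state -> ('I_tm_tapes.+1 -> option tm_sym) ->
             tm_state * ('I_tm_tapes.+1 -> option tm_sym * move) }.

Definition tm_config (S D : finType) (M : turing_machine S D) : Type :=
  (tm_state M * ('I_(tm_tapes M).+1 -> tape (tm_sym M)))%type.

Definition tm_init (S D : finType) (M : turing_machine S D) (w : seq S) :
    tm_config M :=
  (tm_start M,
   fun i => tape_of_word (if i == ord0 then map (@tm_in _ _ M) w else [::])).

Definition tm_step (S D : finType) (M : turing_machine S D)
    (c : tm_config M) : tm_config M :=
  if tm_halt c.1 then c else
  let: (q, act) := tm_trans c.1 (fun i => thead (c.2 i)) in
  (q, fun i => tape_move (act i).2 (tape_write (act i).1 (c.2 i))).

(* The output is the word read from the head to the right, up to the first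
   blank. *)
Definition tm_outputs_in (S D : finType) (M : turing_machine S D)
    (w : seq S) (u : seq D) (t : nat) : Prop :=
  let c := iter t (@tm_step S D M) (tm_init M w) in
  tm_halt c.1 /\ word_of_tape (c.2 ord0) = map (@tm_out _ _ M) u.

Definition polytime (S D : finType) (f : seq S -> seq D) : Prop :=
  exists (M : turing_machine S D) (c k : nat), forall w : seq S,
    exists2 t : nat, (t <= c * size w ^ k + c)%N & tm_outputs_in M w (f w) t.

Record problem := Problem {
  alphabet : finType;
  accepts : seq alphabet -> Prop }.

Definition poly_reduces (P Q : problem) : Prop :=
  exists f : seq (alphabet P) -> seq (alphabet Q),
    polytime f /\ forall w, accepts w <-> accepts (f w).

Definition complete_for (C : problem -> Prop) (P : problem) : Prop :=
  C P /\ forall Q : problem, C Q -> poly_reduces Q P.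

Inductive token :=
  | Kall | Kvar | Ktick | Kzero | Kone | Kplus | Ktimes | Kminus | Kslash
  | Kand | Kor | Knot | Klt | Kle | Keq | Kge | Kgt.

Definition token_enum : seq token :=
  [:: Kall; Kvar; Ktick; Kzero; Kone; Kplus; Ktimes; Kminus; Kslash;
      Kand; Kor; Knot; Klt; Kle; Keq; Kge; Kgt].

Definition nat_of_token (k : token) : nat :=
  match k with
  | Kall => 0 | Kvar => 1 | Ktick => 2 | Kzero => 3 | Kone => 4 | Kplus => 5
  | Ktimes => 6 | Kminus => 7 | Kslash => 8 | Kand => 9 | Kor => 10
  | Knot => 11 | Klt => 12 | Kle => 13 | Keq => 14 | Kge => 15 | Kgt => 16
  end.

Lemma nat_of_tokenK : cancel nat_of_token (nth Kall token_enum).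
Proof. by case. Qed.

HB.instance Definition _ := Countable.copy token (can_type nat_of_tokenK).

Lemma token_enumP : Finite.axiom token_enum.
Proof. by case. Qed.

HB.instance Definition _ := isFinite.Build token token_enumP.

Inductive cmp := Clt | Cle | Ceq | Cge | Cgt.

Definition cmp0 (R : realType) (c : cmp) (a : R) : bool :=
  match c with
  | Clt => a < 0
  | Cle => a <= 0
  | Ceq => a == 0
  | Cge => a >= 0
  | Cgt => a > 0
  end.

Definition enc_cmp (c : cmp) : token :=
  match c with
  | Clt => Klt | Cle => Kle | Ceq => Keq | Cge => Kge | Cgt => Kgt
  end.

Definition enc_var (n : nat) (i : 'I_n) : seq token := Kvar :: nseq i Ktick.

(* Binary digits, most significant first, without leading zeros. *)
Definition enc_nat (m : nat) : seq token :=
  rev (mkseq (fun i => if odd (m %/ 2 ^ i) then Kone else Kzero)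
             (trunc_log 2 m).+1).

Definition enc_int (z : int) : seq token :=
  if z < 0 then Kminus :: enc_nat `|z|%N else enc_nat `|z|%N.

Inductive term (n : nat) :=
  | TVar of 'I_n
  | TZero
  | TOne
  | TAdd of term n & term n
  | TMul of term n & term n.
Arguments TZero {n}.
Arguments TOne {n}.

Inductive qf_formula (n : nat) :=
  | QAtom of cmp & term n
  | QAnd of qf_formula n & qf_formula n
  | QOr of qf_formula n & qf_formula n.

Fixpoint term_eval (R : realType) (n : nat) (x : 'rV[R]_n) (t : term n) : R :=
  match t with
  | TVar i => x 0 i
  | TZero => 0
  | TOne => 1
  | TAdd t1 t2 => term_eval x t1 + term_eval x t2
  | TMul t1 t2 => term_eval x t1 * term_eval x t2
  end.

Fixpoint qf_sat (R : realType) (n : nat) (x : 'rV[R]_n)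
    (f : qf_formula n) : bool :=
  match f with
  | QAtom c t => cmp0 c (term_eval x t)
  | QAnd f1 f2 => qf_sat x f1 && qf_sat x f2
  | QOr f1 f2 => qf_sat x f1 || qf_sat x f2
  end.

Fixpoint enc_term (n : nat) (t : term n) : seq token :=
  match t with
  | TVar i => enc_var i
  | TZero => [:: Kzero]
  | TOne => [:: Kone]
  | TAdd t1 t2 => Kplus :: enc_term t1 ++ enc_term t2
  | TMul t1 t2 => Ktimes :: enc_term t1 ++ enc_term t2
  end.

Fixpoint enc_qf (n : nat) (f : qf_formula n) : seq token :=
  match f with
  | QAtom c t => enc_cmp c :: enc_term t
  | QAnd f1 f2 => Kand :: enc_qf f1 ++ enc_qf f2
  | QOr f1 f2 => Kor :: enc_qf f1 ++ enc_qf f2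
  end.

Definition enc_sentence (n : nat) (f : qf_formula n) : seq token :=
  nseq n Kall ++ enc_qf f.

Definition true_universal_sentences (R : realType) : problem :=
  @Problem token (fun w =>
    exists (n : nat) (f : qf_formula n),
      w = enc_sentence f /\ forall x : 'rV[R]_n, qf_sat x f).

Definition forallR (R : realType) (P : problem) : Prop :=
  poly_reduces P (true_universal_sentences R).

(* A list of monomials; [(a, [:: i; j; ...])] stands for [a * x_i * x_j * ...],
   so that a power [x_i ^+ e] is written as [e] factors. *)
Definition polynomial_expr (d : nat) : Type := seq (int * seq 'I_d).

Inductive sa_formula (d : nat) :=
  | SAtom of cmp & polynomial_expr d
  | SNot of sa_formula d
  | SAnd of sa_formula d & sa_formula d
  | SOr of sa_formula d & sa_formula d.

Definition poly_eval (R : realType) (d : nat) (x : 'rV[R]_d)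
    (g : polynomial_expr d) : R :=
  \sum_(m <- g) m.1%:~R * \prod_(i <- m.2) x 0 i.

Fixpoint sa_sat (R : realType) (d : nat) (x : 'rV[R]_d)
    (phi : sa_formula d) : bool :=
  match phi with
  | SAtom c g => cmp0 c (poly_eval x g)
  | SNot phi1 => ~~ sa_sat x phi1
  | SAnd phi1 phi2 => sa_sat x phi1 && sa_sat x phi2
  | SOr phi1 phi2 => sa_sat x phi1 || sa_sat x phi2
  end.

Definition sa_set (R : realType) (d : nat) (phi : sa_formula d) :
    set 'rV[R]_d :=
  [set x | sa_sat x phi]%classic.
Arguments sa_set R {d} phi.

Definition enc_poly (d : nat) (g : polynomial_expr d) : seq token :=
  flatten [seq Kplus :: enc_int m.1 ++ flatten [seq enc_var i | i <- m.2]
          | m <- g].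

Fixpoint enc_sa (d : nat) (phi : sa_formula d) : seq token :=
  match phi with
  | SAtom c g => enc_cmp c :: enc_poly g
  | SNot phi1 => Knot :: enc_sa phi1
  | SAnd phi1 phi2 => Kand :: enc_sa phi1 ++ enc_sa phi2
  | SOr phi1 phi2 => Kor :: enc_sa phi1 ++ enc_sa phi2
  end.

(* The library's norm on ['rV[R]_d] is the maximum norm. *)
Definition enorm (R : realType) (d : nat) (x : 'rV[R]_d) : R :=
  Num.sqrt (\sum_(i < d) x 0 i ^+ 2).

Definition radius_at_most (R : realType) (d : nat) (S : set 'rV[R]_d) (r : R) :
    Prop :=
  exists x : 'rV[R]_d, forall y : 'rV[R]_d, S y -> enorm (x - y) <= r.

(* The dimension [d] is written in unary and the rational [r] as a binary
   fraction [p / q], not necessarily in lowest terms. *)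
Definition enc_radius_instance (d : nat) (phi : sa_formula d) (p : int)
    (q : nat) : seq token :=
  nseq d Ktick ++ enc_int p ++ Kslash :: enc_nat q ++ enc_sa phi.

Definition radius_problem (R : realType) : problem :=
  @Problem token (fun w =>
    exists (d : nat) (phi : sa_formula d) (p : int) (q : nat),
      [/\ (0 < q)%N, w = enc_radius_instance phi p q
        & radius_at_most (sa_set R phi) (ratr (p%:Q / q%:Q))]).

(* Main.v *)
From mathcomp Require Import all_boot all_order all_algebra.
From mathcomp Require Import classical_sets reals.
From mathcomp Require Import boolp zify ring lra.
Require Import Defs.

(* Hardness: a set has radius at most [-1] iff it is empty.  The negation of a
   universal sentence becomes a semialgebraic set, with one variable and one
   polynomial equation per subterm because terms are not in expanded form.

   Membership: let [V] be the supremum of the variances of finitely supported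
   probability measures on [S].  The means of measures of variance close to [V]
   converge to a point [x], and mixing such a measure with a small mass at
   [y] shows [|x - y|^2 <= V] for all [y] in [S]; conversely a ball of radius [r]
   around [S] bounds all variances by [r^2].  As mass, mean and second moment are
   [d + 2] linear functionals, [d + 2] points suffice (Caratheodory), so that
   "radius at most [r]" is a universal statement about [d + 2] points of [S] and
   [d + 2] weights.

   Running times: a function is computed by a program on finitely many stacks,
   one tape per stack; word functions with polynomially bounded programs
   are closed under composition, case distinction, and folds whose
   accumulator grows by a polynomially bounded amount per step. *)

Set Implicit Arguments.
Unset Strict Implicit.
Unset Printing Implicit Defensive.

(** Read literally, the bound on the radius has the form exists-forall, and Helly's theorem would
    still leave an existential centre for each choice of points. Variances remove the centre: a
    variance can be written through the mutual distances of the points alone, so that only universal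
    quantifiers remain. The set [S] is neither closed nor known to be bounded, so the supremum of
    the variances need not be attained. The centre is therefore obtained from nearly optimal
    families, with a deficit of order [h ^ 2] against a perturbing mass [h]. Terms have neither
    subtraction nor numerals. A universally quantified variable is therefore restricted by a premise
    to the value [-1], and binary coefficients are rebuilt by Horner's scheme, which keeps the terms
    of linear size. Both problems are sets of words, so each reduction also has to recognise
    malformed input. Such input is sent to the empty word, which encodes neither a sentence nor an
    instance. *)

(** * Stack programs and their compilation to Turing machines *)

Notation word := (seq token).
Notation store := (nat -> word).
Notation tapes := (nat -> tape token).

Definition upd (st : store) (r : nat) (x : word) : store :=
  fun i => if i == r then x else st i.

(* [CBranch r k] pops register [r] and continues with [k] applied to the popped
   symbol; [CLoop r k] pops [r] and runs [k] on the popped symbol until [r] is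
   empty. *)
Inductive cmd :=
  | CSkip
  | CPush of nat & token
  | CSeq of cmd & cmd
  | CBranch of nat & (option token -> cmd)
  | CLoop of nat & (token -> cmd).

Inductive exec : cmd -> store -> store -> nat -> Prop :=
  | ExecSkip st : exec CSkip st st 1
  | ExecPush st r a : exec (CPush r a) st (upd st r (a :: st r)) 2
  | ExecSeq c1 c2 st1 st2 st3 t1 t2 :
      exec c1 st1 st2 t1 -> exec c2 st2 st3 t2 ->
      exec (CSeq c1 c2) st1 st3 (t1 + t2)
  | ExecBranch r k st st' t :
      exec (k (ohead (st r))) (upd st r (behead (st r))) st' t ->
      exec (CBranch r k) st st' t.+1
  | ExecLoop0 r k st : st r = [::] -> exec (CLoop r k) st st 1
  | ExecLoopS r k st st' st'' a s t1 t2 :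
      st r = a :: s -> exec (k a) (upd st r s) st' t1 ->
      exec (CLoop r k) st' st'' t2 -> exec (CLoop r k) st st'' (t1 + t2).+1.

(** The extra [None] of a branch or a loop is the moment at which its register is about to be
    popped. While the body runs, the state keeps the popped symbol, since the body depends on it. *)
Fixpoint cst (c : cmd) : finType :=
  match c with
  | CSkip => unit
  | CPush _ _ => bool
  | CSeq c1 c2 => (cst c1 + cst c2)%type
  | CBranch _ k => option {o : option token & cst (k o)}
  | CLoop _ k => option {a : token & cst (k a)}
  end.

Fixpoint cstart (c : cmd) : cst c :=
  match c return cst c with
  | CSkip => tt
  | CPush _ _ => false
  | CSeq c1 c2 => inl (cstart c1)
  | CBranch _ k => None
  | CLoop _ k => None
  end.

Fixpoint creg (c : cmd) : cst c -> nat :=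
  match c return cst c -> nat with
  | CSkip => fun=> 0
  | CPush r _ => fun=> r
  | CSeq c1 c2 => fun q => match q with inl q1 => creg q1 | inr q2 => creg q2 end
  | CBranch r k => fun q => if q is Some (existT o q1) then creg q1 else r
  | CLoop r k => fun q => if q is Some (existT o q1) then creg q1 else r
  end.

(** A resulting state [None] means that the command has finished. A push takes two steps, a move
    onto the free cell on the left and a write; a pop erases the top and moves right. *)
Fixpoint cact (c : cmd) :
    cst c -> option token -> option (cst c) * (option token * move) :=
  match c return cst c -> option token ->
                 option (cst c) * (option token * move) with
  | CSkip => fun _ o => (None, (o, MStay))
  | CPush r a => fun b o =>
      if b then (None, (Some a, MStay)) else (Some true, (o, MLeft))
  | CSeq c1 c2 => fun q o =>
      match q with
      | inl q1 => let: (q', x) := cact q1 o in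
          (Some (if q' is Some q'' then inl q'' else inr (cstart c2)), x)
      | inr q2 => let: (q', x) := cact q2 o in
          (if q' is Some q'' then Some (inr q'') else None, x)
      end
  | CBranch r k => fun q o =>
      match q with
      | Some (existT p q1) => let: (q', x) := cact q1 o in
          (if q' is Some q'' then
             Some (Some (existT (fun p => cst (k p) : Type) p q'')) else None, x)
      | None => (Some (Some (existT (fun p => cst (k p) : Type) o (cstart (k o)))),
                 (None, MRight))
      end
  | CLoop r k => fun q o =>
      match q with
      | Some (existT p q1) => let: (q', x) := cact q1 o in
          (Some (if q' is Some q'' then
             Some (existT (fun p => cst (k p) : Type) p q'') else None), x)
      | None =>
          if o is Some a then
            (Some (Some (existT (fun p => cst (k p) : Type) a (cstart (k a)))),
             (None, MRight))
          else (None, (None, MStay))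
      end
  end.

Definition tape_act (G : Type) (x : option G * move) (t : tape G) : tape G :=
  tape_move x.2 (tape_write x.1 t).

Definition updT (T : tapes) (r : nat) (t : tape token) : tapes :=
  fun i => if i == r then t else T i.

Inductive csteps (c : cmd) :
    nat -> option (cst c) -> tapes -> option (cst c) -> tapes -> Prop :=
  | CSteps0 q T : csteps 0 q T q T
  | CStepsS n q T q' T' :
      csteps n (cact q (thead (T (creg q)))).1
        (updT T (creg q) (tape_act (cact q (thead (T (creg q)))).2 (T (creg q))))
        q' T' ->
      csteps n.+1 (Some q) T q' T'.

Lemma csteps_trans c n1 n2 (q1 q2 q3 : option (cst c)) T1 T2 T3 :
  csteps n1 q1 T1 q2 T2 -> csteps n2 q2 T2 q3 T3 ->
  csteps (n1 + n2) q1 T1 q3 T3.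
Proof.
elim=> [//|n q T q' T' _ IH /IH h]; rewrite addSn; exact: CStepsS.
Qed.

Lemma csteps_seql c1 c2 n (q q' : option (cst c1)) T T' :
  csteps n q T q' T' ->
  let f (q : option (cst c1)) : option (cst (CSeq c1 c2)) :=
    Some (if q is Some q1 then inl q1 else inr (cstart c2)) in
  csteps n (f q) T (f q') T'.
Proof.
elim=> {n q T q' T'} [q T|n q T q' T' _ IH] f; first exact: CSteps0.
rewrite {1}/f; apply: CStepsS; rewrite /=.
by move: IH; rewrite -/f /f /=; case: (cact q _).
Qed.

Lemma csteps_seqr c1 c2 n (q q' : option (cst c2)) T T' :
  csteps n q T q' T' ->
  let f (q : option (cst c2)) : option (cst (CSeq c1 c2)) :=
    if q is Some q1 then Some (inr q1) else None in
  csteps n (f q) T (f q') T'.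
Proof.
elim=> {n q T q' T'} [q T|n q T q' T' _ IH] f; first exact: CSteps0.
rewrite {1}/f; apply: CStepsS; rewrite /=.
by move: IH; rewrite -/f /f /=; case: (cact q _).
Qed.

Lemma csteps_branch r k o n (q q' : option (cst (k o))) T T' :
  csteps n q T q' T' ->
  let f (q : option (cst (k o))) : option (cst (CBranch r k)) :=
    if q is Some q1 then Some (Some (existT (fun p => cst (k p) : Type) o q1))
    else None in
  csteps n (f q) T (f q') T'.
Proof.
elim=> {n q T q' T'} [q T|n q T q' T' _ IH] f; first exact: CSteps0.
rewrite {1}/f; apply: CStepsS; rewrite /=.
by move: IH; rewrite -/f /f /=; case: (cact q _).
Qed.

Lemma csteps_loop r k o n (q q' : option (cst (k o))) T T' :
  csteps n q T q' T' ->
  let f (q : option (cst (k o))) : option (cst (CLoop r k)) :=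
    Some (if q is Some q1 then Some (existT (fun p => cst (k p) : Type) o q1)
          else None) in
  csteps n (f q) T (f q') T'.
Proof.
elim=> {n q T q' T'} [q T|n q T q' T' _ IH] f; first exact: CSteps0.
rewrite {1}/f; apply: CStepsS; rewrite /=.
by move: IH; rewrite -/f /f /=; case: (cact q _).
Qed.

(** The top of the stack lies under the head. Erased or abandoned cells stay in the lists of the
    tape as explicit blanks, hence the padding on both sides. *)
Definition tape_rep (t : tape token) (w : word) : Prop :=
  exists k l : nat,
    t = Tape (nseq k None) (ohead w) (map Some (behead w) ++ nseq l None).

Definition reps (T : tapes) (st : store) : Prop :=
  forall r, tape_rep (T r) (st r).

Lemma tape_rep_head t w : tape_rep t w -> thead t = ohead w.
Proof. by case=> k [l ->]. Qed.

Lemma tape_rep_push t w a : tape_rep t w ->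
  tape_rep (tape_act (Some a, MStay) (tape_act (thead t, MLeft) t)) (a :: w).
Proof.
case=> k [l ->]; rewrite /tape_act /tape_write /=.
case: w => [|b w] /=.
  by exists k.-1, l.+1; case: k.
by exists k.-1, l; case: k.
Qed.

Lemma tape_rep_pop t w : tape_rep t w ->
  tape_rep (tape_act (None, MRight) t) (behead w).
Proof.
case=> k [l ->]; rewrite /tape_act /tape_write /=.
by case: w => [|b [|b' w]] /=; exists k.+1; [exists l.-1|exists l.-1|exists l];
  case: l.
Qed.

Lemma reps_upd T st r t w : reps T st -> tape_rep t w ->
  reps (updT T r t) (upd st r w).
Proof. by move=> H h i; rewrite /updT /upd; case: eqP. Qed.

Lemma updTK T r : updT T r (T r) = T.
Proof. by apply: funext => i; rewrite /updT; case: eqP => // ->. Qed.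

Lemma updTT T r t t' : updT (updT T r t) r t' = updT T r t'.
Proof. by apply: funext => i; rewrite /updT; case: eqP. Qed.

Lemma tape_act_stay (G : Type) (t : tape G) : tape_act (thead t, MStay) t = t.
Proof. by case: t. Qed.

(** The costs in [exec] are calibrated to be the exact number of machine steps, so the induction
    needs no estimates. *)
Lemma exec_csteps c st st' t : exec c st st' t -> forall T, reps T st ->
  exists2 T', reps T' st' & csteps t (Some (cstart c)) T None T'.
Proof.
elim=> {c st st' t}.
- move=> st T hT; exists T => //; apply: CStepsS => /=.
  by rewrite tape_act_stay updTK; exact: CSteps0.
- move=> st r a T hT.
  exists (updT T r (tape_act (Some a, MStay) (tape_act (thead (T r), MLeft) (T r)))).
    by apply: reps_upd => //; apply: tape_rep_push.
  apply: CStepsS => /=; apply: CStepsS => /=.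
  by rewrite updTT {2}/updT eqxx; exact: CSteps0.
- move=> c1 c2 st1 st2 st3 t1 t2 _ IH1 _ IH2 T /IH1[T1 h1 s1].
  have [T2 h2 s2] := IH2 _ h1; exists T2 => //.
  apply: csteps_trans (csteps_seql c2 s1) _.
  exact: (csteps_seqr c1 s2).
- move=> r k st st' t _ IH T hT.
  have [|T' h s] := IH (updT T r (tape_act (None, MRight) (T r))).
    by apply: reps_upd => //; apply: tape_rep_pop.
  exists T' => //; apply: CStepsS => /=.
  have := csteps_branch r s; rewrite /= -(tape_rep_head (hT r)).
  by [].
- move=> r k st h T hT; exists T => //; apply: CStepsS => /=.
  rewrite (tape_rep_head (hT r)) h /=.
  have -> : None = thead (T r) by rewrite (tape_rep_head (hT r)) h.
  by rewrite tape_act_stay updTK; exact: CSteps0.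
- move=> r k st st' st'' a s t1 t2 h _ IH1 _ IH2 T hT.
  have [|T1 h1 s1] := IH1 (updT T r (tape_act (None, MRight) (T r))).
    by apply: reps_upd => //; have := tape_rep_pop (hT r); rewrite h.
  have [T2 h2 s2] := IH2 _ h1; exists T2 => //.
  apply: CStepsS => /=; rewrite (tape_rep_head (hT r)) h /=.
  apply: csteps_trans (csteps_loop r s1) _.
  exact: s2.
Qed.

Definition tape_map (G G' : Type) (f : G -> G') (t : tape G) : tape G' :=
  Tape (map (omap f) (tleft t)) (omap f (thead t)) (map (omap f) (tright t)).

Lemma tape_map_act (G G' : Type) (f : G -> G') x t :
  tape_map f (tape_act x t) = tape_act (omap f x.1, x.2) (tape_map f t).
Proof.
by case: x => o [] //; case: t => [[|a l] h [|b r]].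
Qed.

Lemma tape_map_word (G G' : Type) (f : G -> G') t :
  word_of_tape (tape_map f t) = map f (word_of_tape t).
Proof.
case: t => l h r; rewrite /word_of_tape /=; case: h => //= a; congr cons.
by elim: r => [//|[b|] r IH] //=; rewrite IH.
Qed.

Lemma tape_map_of_word (G G' : Type) (f : G -> G') w :
  tape_map f (tape_of_word w) = tape_of_word (map f w).
Proof.
by case: w => [//|a w]; rewrite /tape_map /tape_of_word /=; congr Tape; elim: w => //= b w ->.
Qed.

Lemma word_push (G : Type) (a : G) t :
  word_of_tape (tape_act (Some a, MStay) (tape_act (thead t, MLeft) t))
  = a :: word_of_tape t.
Proof. by []. Qed.

(** * Sequential composition of a Turing machine with a stack program *)

Section Compose.
Variables (S : finType) (M : turing_machine S token) (c : cmd).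

Let K := (\max_(q : cst c) creg q).+1.
Let k1 := tm_tapes M.
Let nt := (k1 + K)%N.
Let sym : finType := (tm_sym M + token)%type.
Let state : finType := (tm_state M + (cst c + option (bool + bool)))%type.
Let Sinl : tm_sym M -> sym := inl.
Let Sinr : token -> sym := inr.

Let reg (r : nat) : 'I_nt.+1 := inord (k1.+1 + r).

Let qsim (q : tm_state M) : state := inl q.
Let qprog (q : cst c) : state := inr (inl q).
Let qin (b : bool) : state := inr (inr (Some (inl b))).
Let qout (b : bool) : state := inr (inr (Some (inr b))).
Let qhalt : state := inr (inr None).

Let read_out (o : option sym) : option token :=
  if o is Some (inl s) then [pick d | tm_out M d == s] else None.
Let unl (o : option sym) : option (tm_sym M) :=
  if o is Some (inl s) then Some s else None.
Let unr (o : option sym) : option token :=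
  if o is Some (inr s) then Some s else None.

(** Phases: simulation of [M]; [qin] pushes the output of [M] onto register 0; the program runs;
    [qout] pops register 0 and writes on tape 0 towards the left. Both transfers reverse the word,
    and each has two states because a push moves before it writes. *)
Definition comp_trans (q : state) (rd : 'I_nt.+1 -> option sym) :
    state * ('I_nt.+1 -> option sym * move) :=
  match q with
  | inl q1 =>
      if tm_halt q1 then (qin false, fun i => (rd i, MStay)) else
      let: (q2, act) := tm_trans q1 (fun i : 'I_k1.+1 => unl (rd (inord i))) in
      (qsim q2, fun i : 'I_nt.+1 => if i < k1.+1 then
         (omap Sinl (act (inord i)).1, (act (inord i)).2) else (rd i, MStay))
  | inr (inl q1) =>
      let: (q2, x) := cact q1 (unr (rd (reg (creg q1)))) in
      (if q2 is Some q3 then qprog q3 else qout false,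
       fun i => if i == reg (creg q1) then (omap Sinr x.1, x.2)
                else (rd i, MStay))
  | inr (inr (Some (inl false))) =>
      if read_out (rd ord0) is Some _ then
        (qin true, fun i => (rd i, if i == reg 0 then MLeft else MStay))
      else (qprog (cstart c), fun i => (rd i, MStay))
  | inr (inr (Some (inl true))) =>
      (qin false, fun i => if i == reg 0 then
                             (omap Sinr (read_out (rd ord0)), MStay)
                           else (rd i, if i == ord0 then MRight else MStay))
  | inr (inr (Some (inr false))) =>
      if rd (reg 0) is Some _ then
        (qout true, fun i => (rd i, if i == ord0 then MLeft else MStay))
      else (qhalt, fun i => (rd i, MStay))
  | inr (inr (Some (inr true))) =>
      (qout false, fun i => if i == ord0 then (rd (reg 0), MStay)
                            else if i == reg 0 then (None, MRight)
                            else (rd i, MStay))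
  | inr (inr None) => (qhalt, fun i => (rd i, MStay))
  end.

Lemma comp_in_inj : injective (fun s => Sinl (tm_in M s)).
Proof. by move=> x y [] /tm_in_inj. Qed.

Lemma comp_out_inj : injective Sinr.
Proof. by move=> x y []. Qed.

Definition comp_machine : turing_machine S token :=
  @TuringMachine S token sym (fun s => Sinl (tm_in M s)) Sinr
    comp_in_inj comp_out_inj nt state (qsim (tm_start M))
    (fun q => q == qhalt) comp_trans.

Let step := @tm_step S token comp_machine.
Let goes n (C C' : tm_config comp_machine) := iter n step C = C'.

Let goesS n q T C' q1 act :
  q != qhalt -> comp_trans q (fun i => thead (T i)) = (q1, act) ->
  goes n (q1, fun i => tape_act (act i) (T i)) C' -> goes n.+1 (q, T) C'.
Proof.
move=> hq h; rewrite /goes iterSr.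
have hh : tm_halt (q : tm_state comp_machine) = false := negbTE hq.
suff -> : step (q, T) = (q1, fun i => tape_act (act i) (T i)) by [].
rewrite /step /tm_step hh.
by have -> : tm_trans (q : tm_state comp_machine) (fun i => thead (T i)) = (q1, act).
Qed.

Let goes_trans n m C C' C'' : goes n C C' -> goes m C' C'' -> goes (n + m) C C''.
Proof. by rewrite /goes => <- <-; rewrite addnC iterD. Qed.

Let val_reg r : r < K -> reg r = (k1.+1 + r)%N :> nat.
Proof. by move=> h; rewrite inordK // /nt; lia. Qed.

Let reg_inj r r' : r < K -> r' < K -> (reg r == reg r') = (r == r').
Proof.
move=> h h'; apply/eqP/eqP => [/(congr1 (@nat_of_ord _))|-> //].
by rewrite !val_reg //; lia.
Qed.

Let reg0_lt : 0 < K. Proof. by []. Qed.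

Let ord0_reg r : r < K -> ((ord0 : 'I_nt.+1) == reg r) = false.
Proof. by move=> h; apply/eqP => /(congr1 (@nat_of_ord _)); rewrite val_reg. Qed.

Let reg_ord0 r : r < K -> (reg r == (ord0 : 'I_nt.+1)) = false.
Proof. by move=> h; rewrite eq_sym ord0_reg. Qed.

Let regs_ok (T : 'I_nt.+1 -> tape sym) (TT : tapes) :=
  forall r, r < K -> T (reg r) = tape_map Sinr (TT r).

Let creg_lt (q : cst c) : creg q < K.
Proof. by rewrite /K ltnS; apply: (leq_bigmax (F := fun q => creg q)). Qed.

Lemma comp_simulates (w : seq S) t :
  (forall s, s < t -> ~~ tm_halt (iter s (@tm_step _ _ M) (tm_init M w)).1) ->
  exists2 T, goes t (tm_init comp_machine w)
               (qsim (iter t (@tm_step _ _ M) (tm_init M w)).1, T)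
    & (forall i : 'I_k1.+1,
         T (inord i) = tape_map Sinl ((iter t (@tm_step _ _ M) (tm_init M w)).2 i))
      /\ regs_ok T (fun=> tape_of_word [::]).
Proof.
elim: t => [|t IH] ht.
  eexists; first by []; split=> [i|r hr] /=.
    have -> : (inord i == ord0 :> 'I_nt.+1) = (i == ord0).
      by rewrite -!val_eqE /= inordK // /nt; have := ltn_ord i; lia.
    by rewrite tape_map_of_word; case: eqP => //; rewrite -map_comp.
  by rewrite reg_ord0.
have [s hs|T gT [hT rT]] := IH; first by apply: ht; lia.
have := ht t (ltnSn t); set C := iter t _ _ in gT hT *.
move=> hh; rewrite iterS -/C.
have hrd : (fun i : 'I_k1.+1 => unl (thead (T (inord i)))) = fun i => thead (C.2 i).
  by apply: funext => i; rewrite hT /=; case: (thead _).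
case E: (tm_trans C.1 (fun i => thead (C.2 i))) => [q act].
have -> : tm_step C = (q, fun i => tape_act (act i) (C.2 i)).
  by rewrite /tm_step (negbTE hh) E.
eexists.
  rewrite -addn1; apply: goes_trans gT _.
  by apply: goesS; [|rewrite /= (negbTE hh) hrd E|].
rewrite /=; split=> [i|r hr].
  have ltin : i < nt.+1 by rewrite /nt; have := ltn_ord i; lia.
  rewrite /= (inordK ltin) ltn_ord hT.
  have -> : inord i = i :> 'I_k1.+1 by rewrite inord_val.
  by rewrite -/(tape_act _ _) tape_map_act.
rewrite val_reg //= ifF; last by lia.
by rewrite rT // tape_act_stay.
Qed.

Let read_outE a : read_out (Some (Sinl (tm_out M a))) = Some a.
Proof.
rewrite /=; case: pickP => [d /eqP /tm_out_inj -> //|/(_ a)].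
by rewrite eqxx.
Qed.

(** The head of tape 0 ends on the blank behind the output of [M]. The final output is later written
    to the left of this blank, which then delimits it. *)
Lemma comp_transfers u T st TT :
  word_of_tape (T ord0) = map (fun d => Sinl (tm_out M d)) u ->
  regs_ok T TT -> reps TT st ->
  exists T' TT', [/\ goes (size u).*2.+1 (qin false, T) (qprog (cstart c), T'),
    word_of_tape (T' ord0) = [::], regs_ok T' TT'
    & reps TT' (upd st 0 (rev u ++ st 0))].
Proof.
elim: u T st TT => [|a u IH] T st TT hw hr hT.
  exists (fun i => tape_act (thead (T i), MStay) (T i)), TT; split.
  - apply: goesS => //; rewrite /= /comp_trans /=.
    by move: hw; rewrite /word_of_tape /=; case: (thead _).
  - by rewrite tape_act_stay.
  - by move=> r hr'; rewrite tape_act_stay hr.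
  - by move=> r; rewrite /upd; case: eqP => [->|_]; exact: hT.
have [ha hu] : thead (T ord0) = Some (Sinl (tm_out M a)) /\
    until_blank (tright (T ord0)) = map (fun d => Sinl (tm_out M d)) u.
  by move: hw; rewrite /word_of_tape /=; case: (thead _) => //= b [-> ->].
pose T1 i := tape_act (thead (T i), if i == reg 0 then MLeft else MStay) (T i).
have ha1 : thead (T1 ord0) = Some (Sinl (tm_out M a)).
  by rewrite /T1 ord0_reg // tape_act_stay.
pose T2 i := tape_act (if i == reg 0 then (omap Sinr (read_out (thead (T1 ord0))), MStay)
    else (thead (T1 i), if i == ord0 then MRight else MStay)) (T1 i).
pose TT2 := updT TT 0 (tape_act (Some a, MStay) (tape_act (thead (TT 0), MLeft) (TT 0))).
have [|||T3 [TT3 [g3 w3 r3 h3]]] := IH T2 (upd st 0 (a :: st 0)) TT2.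
- rewrite /T2 ord0_reg // eqxx /T1 ord0_reg // tape_act_stay.
  by rewrite -hu /word_of_tape /tape_act /=; case: (T ord0) => l h [].
- move=> r hr'; rewrite /T2 reg_inj // reg_ord0 // /TT2 /updT.
  case: eqP => [->|/eqP hr0].
    rewrite ha1 read_outE /T1 eqxx hr // !tape_map_act /=.
    by case: (thead (TT 0)).
  by rewrite /T1 reg_inj // (negbTE hr0) !tape_act_stay hr.
- by apply: reps_upd => //; apply: tape_rep_push.
exists T3, TT3; split=> //.
  rewrite doubleS; apply: goesS => //.
    by rewrite /= /comp_trans ha read_outE.
  by apply: goesS g3.
move: h3; congr reps; apply: funext => r; rewrite /upd /=.
by case: eqP => // _; rewrite rev_cons cat_rcons.
Qed.

Lemma comp_runs n q q' T TT TT' :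
  csteps n q TT q' TT' -> regs_ok T TT ->
  let f (q : option (cst c)) := if q is Some q1 then qprog q1 else qout false in
  exists T', [/\ goes n (f q, T) (f q', T'), T' ord0 = T ord0 & regs_ok T' TT'].
Proof.
move=> h; elim: h T => {n q TT q' TT'} [q TT|n q TT q' TT' _ IH] T hr f.
  by exists T.
have hrd : unr (thead (T (reg (creg q)))) = thead (TT (creg q)).
  by rewrite hr //=; case: (thead _).
pose x := cact q (thead (TT (creg q))).
pose T1 (i : 'I_nt.+1) := tape_act (if i == reg (creg q) then (omap Sinr x.2.1, x.2.2)
                else (thead (T i), MStay)) (T i).
have [|T2 [g2 w2 r2]] := IH T1.
  move=> r hr'; rewrite /T1 /updT reg_inj //; case: eqP => [->|_].
    by rewrite hr // tape_map_act.
  by rewrite tape_act_stay hr.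
exists T2; split=> //; last first.
  by rewrite w2 /T1 ord0_reg // tape_act_stay.
apply: goesS g2 => //=.
by rewrite hrd /x; case: (cact q _).
Qed.

Lemma comp_outputs u v T TT :
  word_of_tape (T ord0) = map Sinr v -> regs_ok T TT -> tape_rep (TT 0) u ->
  exists2 T', goes (size u).*2.+1 (qout false, T) (qhalt, T')
    & word_of_tape (T' ord0) = map Sinr (rev u ++ v).
Proof.
elim: u v T TT => [|a u IH] v T TT hw hr hT.
  exists (fun i => tape_act (thead (T i), MStay) (T i)).
    apply: goesS => //; rewrite /= /comp_trans.
    by rewrite hr //= (tape_rep_head hT).
  by rewrite tape_act_stay.
have ha : thead (T (reg 0)) = Some (Sinr a) by rewrite hr //= (tape_rep_head hT).
pose T1 (i : 'I_nt.+1) := tape_act (thead (T i), if i == ord0 then MLeft else MStay) (T i).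
have ha1 : thead (T1 (reg 0)) = Some (Sinr a).
  by rewrite /T1 reg_ord0 // tape_act_stay.
pose T2 (i : 'I_nt.+1) := tape_act (if i == ord0 then (thead (T1 (reg 0)), MStay)
   else if i == reg 0 then (None, MRight) else (thead (T1 i), MStay)) (T1 i).
pose TT2 := updT TT 0 (tape_act (None, MRight) (TT 0)).
have [|||T3 g3 w3] := IH (a :: v) T2 TT2.
- rewrite /T2 eqxx ha1 /T1 eqxx word_push hw //.
- move=> r hr'; rewrite /T2 reg_inj // reg_ord0 // /TT2 /updT.
  case: eqP => [->|/eqP hr0].
    by rewrite /T1 reg_ord0 // tape_act_stay hr // tape_map_act.
  by rewrite /T1 reg_ord0 // !tape_act_stay hr.
- exact: (tape_rep_pop hT).
exists T3; last by rewrite w3 rev_cons cat_rcons.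
rewrite doubleS; apply: goesS => //.
  by rewrite /= /comp_trans ha.
by apply: goesS g3.
Qed.

End Compose.

Lemma until_blank_size (G : Type) (s : seq (option G)) : size (until_blank s) <= size s.
Proof. by elim: s => [|[a|] s IH]. Qed.

(** Each step lengthens the part to the right of the head by at most one cell, so a time bound also
    bounds the word handed to the next program. *)
Lemma output_size (S D : finType) (M : turing_machine S D) w u t :
  tm_outputs_in M w u t -> size u <= size w + t + 1.
Proof.
case=> _ hw; rewrite -(size_map (@tm_out _ _ M) u) -hw.
apply: leq_trans (until_blank_size _) _ => /=.
suff : size (tright ((iter t (@tm_step _ _ M) (tm_init M w)).2 ord0)) <= size w + t by lia.
elim: t {hw} => [|t IH] /=.
  by case: w => [//|a w] /=; rewrite !size_map; lia.
move: IH; set C := iter t _ _ => IH.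
rewrite /tm_step; case: ifP => _; first by lia.
case: (tm_trans _ _) => q act /=.
have : forall (m : move) o (t : tape (tm_sym M)),
    size (tright (tape_move m (tape_write o t))) <= (size (tright t)).+1.
  by move=> [] o [l h r] //=; rewrite size_behead; lia.
by move=> /(_ (act ord0).2 (act ord0).1 (C.2 ord0)); lia.
Qed.

(** Leads back to the form of bound demanded by [polytime]: [n + 2 <= 3 * n] fails only for [n = 0],
    where the additive constant helps. *)
Lemma pow2_bound k n : (n + 2) ^ k <= 3 ^ k * n ^ k + 3 ^ k.
Proof.
case: n => [|n].
  by apply: leq_trans (leq_addl _ _); case: k => [//|k]; rewrite leq_exp2r.
apply: leq_trans (leq_addr _ _); rewrite -expnMn.
by case: k => [//|k]; rewrite leq_exp2r //; lia.
Qed.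

(** The base is at least 2, so constants and sums are absorbed by a larger exponent and one
    parameter suffices. *)
Definition poly_bounded (F : nat -> nat) : Prop :=
  exists k, forall x, F x <= (x + 2) ^ k.

Lemma poly_bounded_const n : poly_bounded (fun=> n).
Proof.
exists n => x; apply: leq_trans (ltnW (ltn_expl n (isT : 1 < 2))) _.
by case: n => // k'; rewrite leq_exp2r //; lia.
Qed.

Lemma poly_bounded_id : poly_bounded id.
Proof. by exists 1 => x; rewrite expn1; lia. Qed.

Lemma poly_boundedM F G :
  poly_bounded F -> poly_bounded G -> poly_bounded (fun x => F x * G x).
Proof. by case=> k hF [l hG]; exists (k + l)%N => x; rewrite expnD leq_mul. Qed.

Lemma poly_boundedD F G :
  poly_bounded F -> poly_bounded G -> poly_bounded (fun x => F x + G x).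
Proof.
case=> k hF [l hG]; exists (k + l + 1)%N => x; rewrite !expnD expn1.
have := hF x; have := hG x.
have : 0 < (x + 2) ^ k by rewrite expn_gt0; lia.
have : 0 < (x + 2) ^ l by rewrite expn_gt0; lia.
by move: (_ ^ k) (_ ^ l) => a b; nia.
Qed.

Lemma poly_boundedX F k :
  poly_bounded F -> poly_bounded (fun x => F x ^ k).
Proof.
move=> hF; elim: k => [|k IH]; first exact: (poly_bounded_const 1).
have [l h] := poly_boundedM hF IH; exists l => x; rewrite expnS; exact: h.
Qed.

Lemma leq_expl m n k : m <= n -> m ^ k <= n ^ k.
Proof. by case: k => // k; rewrite leq_exp2r. Qed.

Ltac polyb := repeat first
  [ assumption | exact: poly_bounded_id | exact: poly_bounded_const
  | apply: poly_boundedX | apply: poly_boundedD | apply: poly_boundedM ].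

Lemma polytime_id : polytime (id : word -> word).
Proof.
exists (@TuringMachine token token token id id (fun _ _ => id) (fun _ _ => id)
  0 unit tt predT (fun q rd => (q, fun i => (rd i, MStay)))), 0, 0 => w.
exists 0 => //; split=> //=; rewrite /word_of_tape /tape_of_word /=.
rewrite !map_id; case: w => //= a w; congr cons.
by elim: w => //= b w ->.
Qed.

(** Argument and result of the program are reversed because both transfers between tape 0 and
    register 0 reverse. *)
Lemma polytime_comp (S : finType) (f : seq S -> word) (g : word -> word) (c : cmd) k :
  polytime f ->
  (forall x : word, exists t st, [/\ t <= (size x + 2) ^ k,
     exec c (upd (fun=> [::]) 0 (rev x)) st t, st 0 = rev (g x)
     & size (g x) <= (size x + 2) ^ k]) ->
  polytime (g \o f).
Proof.
case=> M [C0 [k0 hM]] hc.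
pose F0 n := C0 * n ^ k0 + C0; pose F1 n := (n + F0 n + 1 + 2) ^ k.
suff [B hB] : exists B, forall w, exists2 t, t <= (size w + 2) ^ B
    & tm_outputs_in (comp_machine M c) w (g (f w)) t.
  exists (comp_machine M c), (3 ^ B), B => w; have [t ht ho] := hB w.
  by exists t => //; apply: leq_trans ht (pow2_bound _ _).
have [B hB] : poly_bounded (fun n => F0 n + (1 + (2 * (n + F0 n + 1) + 1
    + (F1 n + (2 * F1 n + 1))))) by rewrite /F1 /F0; polyb.
exists B => w.
have [t0 ht0 hout] := hM w; have [t [st [ht hex hst hsz]]] := hc (f w).
have [hh0 hw0] := hout.
pose P n := tm_halt (iter n (@tm_step _ _ M) (tm_init M w)).1.
have exP : exists n, P n by exists t0.
(* The composed machine leaves the simulation at the first halting time [t1]. Halting configurations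
   do not change, so the output at [t0] is already there. *)
have [t1 ht1 hmin] := ex_minnP exP.
have le10 : t1 <= t0 by apply: hmin.
have eq10 : iter t0 (@tm_step _ _ M) (tm_init M w)
          = iter t1 (@tm_step _ _ M) (tm_init M w).
  rewrite -(subnK le10) iterD; elim: (t0 - t1) => //= n ->.
  by rewrite /tm_step -/(P t1) ht1.
have [s hs|T1 g1 [hT1 rT1]] := comp_simulates c (M := M) (w := w) (t := t1).
  by apply/negP => /hmin; lia.
have hw1 : word_of_tape (T1 ord0) = map (fun d => inl (tm_out M d)) (f w).
  have e0 : inord (@ord0 (tm_tapes M)) = ord0 :> 'I_(tm_tapes (comp_machine M c)).+1.
    by apply: val_inj; rewrite /= inordK.
  have := hT1 ord0; rewrite e0 => ->; rewrite tape_map_word -eq10 hw0 -map_comp //.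
have rep0 : reps (fun=> tape_of_word [::]) (fun=> [::]).
  by move=> r; exists 0, 0.
pose T1' i := tape_act (thead (T1 i), MStay) (T1 i).
have eT1 : T1' = T1 by apply: funext => i; rewrite /T1' tape_act_stay.
have [T2 [TT2 [g2 w2 r2 h2]]] := comp_transfers (c := c) hw1 rT1 rep0.
have [TT3 h3 s3] : exists2 TT3, reps TT3 st & csteps t (Some (cstart c)) TT2 None TT3.
  apply: exec_csteps h2; move: hex; congr (exec c _ st t).
  by apply: funext => r; rewrite /upd; case: eqP; rewrite ?cats0.
have [T3 [g3 w3 r3]] := comp_runs s3 r2.
have [|T4 g4 w4] := @comp_outputs _ M c (st 0) [::] T3 TT3 _ r3 (h3 0).
  by rewrite w3 w2.
pose stp := @tm_step _ _ (comp_machine M c).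
have {}g1 : iter t1 stp (tm_init (comp_machine M c) w)
  = (inl (iter t1 (@tm_step _ _ M) (tm_init M w)).1, T1) := g1.
have {}g2 : iter (size (f w)).*2.+1 stp (inr (inr (Some (inl false))), T1)
  = (inr (inl (cstart c)), T2) := g2.
have {}g3 : iter t stp (inr (inl (cstart c)), T2)
  = (inr (inr (Some (inr false))), T3) := g3.
have {}g4 : iter (size (st 0)).*2.+1 stp (inr (inr (Some (inr false))), T3)
  = (inr (inr None), T4) := g4.
exists (t1 + (1 + ((size (f w)).*2.+1 + (t + (size (st 0)).*2.+1)))); last first.
  rewrite /tm_outputs_in.
  suff -> : iter (t1 + (1 + ((size (f w)).*2.+1 + (t + (size (st 0)).*2.+1))))
      stp (tm_init (comp_machine M c) w) = (inr (inr None), T4).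
    by rewrite /= w4 cats0 hst revK.
  rewrite addnC iterD g1 addnC iterD.
  have -> : iter 1 stp
     (inl (iter t1 (@tm_step _ _ M) (tm_init M w)).1, T1)
     = (inr (inr (Some (inl false))), T1).
    rewrite -[in RHS]eT1 /= /stp /tm_step /=.
    by move: ht1; rewrite /P => ->.
  by rewrite addnC iterD g2 addnC iterD g3 g4.
have hsu : size (f w) <= size w + t0 + 1 := output_size hout.
rewrite hst size_rev; apply: leq_trans (hB (size w)).
have h1 : (size (f w) + 2) ^ k <= F1 (size w) by apply: leq_expl; rewrite /F0; lia.
by rewrite -!muln2 /F0 in h1 *; lia.
Qed.

(** * A class of polynomial-time word functions *)

Fixpoint ren (p : nat -> nat) (c : cmd) : cmd :=
  match c with
  | CSkip => CSkip
  | CPush r a => CPush (p r) a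
  | CSeq c1 c2 => CSeq (ren p c1) (ren p c2)
  | CBranch r k => CBranch (p r) (fun o => ren p (k o))
  | CLoop r k => CLoop (p r) (fun a => ren p (k a))
  end.

(** A program touches only the registers it names, so an injective renaming relocates it into a
    larger store whose other registers stay intact. *)
Lemma exec_ren p c st st' t : injective p -> exec c st st' t ->
  forall S : store, (forall i, S (p i) = st i) ->
  exists2 S', (forall i, S' (p i) = st' i) /\
              (forall j, (forall i, j <> p i) -> S' j = S j)
            & exec (ren p c) S S' t.
Proof.
move=> pI; have updp S st0 r x : (forall i, S (p i) = st0 i) ->
    forall i, upd S (p r) x (p i) = upd st0 r x i.
  by move=> h i; rewrite /upd (inj_eq pI) h.
have updn S r x j : (forall i, j <> p i) -> upd S (p r) x j = S j.
  by move=> h; rewrite /upd; case: eqP => // /h.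
elim=> {c st st' t} /=.
- by move=> st S h; exists S; [split|exact: ExecSkip].
- move=> st r a S h; exists (upd S (p r) (a :: S (p r))); last exact: ExecPush.
  by rewrite h; split=> [|j hj]; [exact: updp|exact: updn].
- move=> c1 c2 st1 st2 st3 t1 t2 _ IH1 _ IH2 S /IH1[S1 [h1 n1] e1].
  have [S2 [h2 n2] e2] := IH2 _ h1; exists S2; last exact: ExecSeq e1 e2.
  by split=> // j hj; rewrite n2 // n1.
- move=> r k st st' t _ IH S h.
  have [S1 [h1 n1] e1] := IH _ (updp _ _ r (behead (st r)) h).
  exists S1; last by apply: ExecBranch; rewrite h.
  by split=> // j hj; rewrite n1 // updn.
- by move=> r k st h S hS; exists S; [split|apply: ExecLoop0; rewrite hS].
- move=> r k st st' st'' a s t1 t2 h _ IH1 _ IH2 S hS.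
  have [S1 [h1 n1] e1] := IH1 _ (updp _ _ r s hS).
  have [S2 [h2 n2] e2] := IH2 _ h1.
  exists S2; last by apply: ExecLoopS e1 e2; rewrite hS.
  by split=> // j hj; rewrite n2 // n1 // updn.
Qed.

Definition runs (c : cmd) (st st' : store) (n : nat) : Prop :=
  exists2 t, t <= n & exec c st st' t.

Lemma runs_seq c1 c2 st1 st2 st3 n1 n2 n : runs c1 st1 st2 n1 ->
  runs c2 st2 st3 n2 -> n1 + n2 <= n -> runs (CSeq c1 c2) st1 st3 n.
Proof.
case=> t1 h1 e1 [t2 h2 e2] h; exists (t1 + t2); first by lia.
exact: ExecSeq e1 e2.
Qed.

Lemma runs_leq c st st' n n' : runs c st st' n -> n <= n' -> runs c st st' n'.
Proof. by case=> t h e h'; exists t => //; lia. Qed.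

Lemma updK (st : store) r : upd st r (st r) = st.
Proof. by apply: funext => i; rewrite /upd; case: eqP => // ->. Qed.

Lemma upd_at (st : store) r x : upd st r x r = x.
Proof. by rewrite /upd eqxx. Qed.

Lemma upd_ne (st : store) r r' x : r' <> r -> upd st r x r' = st r'.
Proof. by rewrite /upd; case: eqP. Qed.

Definition cclear (r : nat) : cmd := CLoop r (fun=> CSkip).
Definition cmove (r r' : nat) : cmd := CLoop r (fun a => CPush r' a).
Definition cshift (r r' s : nat) : cmd := CSeq (cmove r s) (cmove s r').

Lemma runs_clear r st : runs (cclear r) st (upd st r [::]) (2 * size (st r) + 1).
Proof.
move E : (st r) => s; elim: s st E => [|a s IH] st E.
  have -> : upd st r [::] = st by rewrite -E updK.
  by exists 1 => //; apply: ExecLoop0.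
have [t ht et] := IH (upd st r s) (upd_at _ _ _).
exists (1 + t).+1; first by rewrite /=; lia.
apply: ExecLoopS E (ExecSkip _) _.
have -> // : upd st r [::] = upd (upd st r s) r [::].
by apply: funext => i; rewrite /upd; case: eqP.
Qed.

Lemma runs_move r r' st : r <> r' ->
  runs (cmove r r') st (upd (upd st r [::]) r' (rev (st r) ++ st r'))
    (3 * size (st r) + 1).
Proof.
move=> rr'; move E : (st r) => s; elim: s st E => [|a s IH] st E.
  have H : upd st r [::] = st by rewrite -E updK.
  rewrite /= H updK.
  by exists 1 => //; apply: ExecLoop0.
have [|t ht et] := IH (upd (upd st r s) r' (a :: st r')).
  by rewrite upd_ne // upd_at.
exists (2 + t).+1; first by rewrite /=; lia.
have := ExecPush (upd st r s) r' a; rewrite upd_ne; last by move=> /esym.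
move=> e1; apply: ExecLoopS E e1 _.
move: et; rewrite upd_at rev_cons cat_rcons.
by congr exec; apply: funext => i; rewrite /upd; do 2?case: eqP => // _.
Qed.

Lemma runs_shift r r' s st : r <> r' -> r <> s -> s <> r' -> st s = [::] ->
  runs (cshift r r' s) st (upd (upd st r [::]) r' (st r ++ st r'))
    (6 * size (st r) + 2).
Proof.
move=> rr' rs sr' hs; apply: runs_seq (runs_move st rs) _ _.
  have := runs_move (upd (upd st r [::]) s (rev (st r) ++ st s)) sr'.
  rewrite upd_at (@upd_ne _ s); last by apply: nesym.
  rewrite upd_ne; last by apply: nesym.
  rewrite hs cats0 revK.
  move=> h; have -> : upd (upd st r [::]) r' (st r ++ st r')
      = upd (upd (upd (upd st r [::]) s (rev (st r))) s [::]) r' (st r ++ st r').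
    apply: funext => i; rewrite /upd; do 2!case: eqP => // _; case: eqP => // ->.
    exact: hs.
  exact: h.
by rewrite size_rev; lia.
Qed.

(* The environment is written with the most recent variable first, whereas it
   occupies the registers in order of introduction. *)
Definition sto (e : seq word) : store := fun i => nth [::] (rev e) i.

Definition tot (e : seq word) : nat := sumn (map size e).

(** The result becomes a new variable on top of the environment. Equality of whole stores forces the
    program to preserve its arguments and to leave all scratch registers empty, which makes programs
    composable. Several arguments are needed because bodies of folds refer to outer variables. *)
Definition fp (m : nat) (f : seq word -> word) : Prop :=
  exists c k, forall e, size e = m ->
    runs c (sto e) (sto (f e :: e)) ((tot e + 2) ^ k) /\
    size (f e) <= (tot e + 2) ^ k.

Lemma fp_intro m f c T : poly_bounded T ->
  (forall e, size e = m -> runs c (sto e) (sto (f e :: e)) (T (tot e)) /\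
     size (f e) <= T (tot e)) -> fp m f.
Proof.
case=> k hT h; exists c, k => e /h[h1 h2]; split.
  by apply: runs_leq h1 (hT _).
exact: leq_trans h2 (hT _).
Qed.

Lemma fp_ext m f g : (forall e, size e = m -> f e = g e) -> fp m g -> fp m f.
Proof. by move=> h [c [k H]]; exists c, k => e he; rewrite h //; apply: H. Qed.

Lemma sto_cons m e x : size e = m -> sto (x :: e) = upd (sto e) m x.
Proof.
move=> <-; apply: funext => i; rewrite /sto /upd rev_cons nth_rcons size_rev.
case: ltngtP => // h; first by rewrite nth_default // size_rev ltnW.
Qed.

Lemma sto_ge m e i : size e = m -> m <= i -> sto e i = [::].
Proof. by move=> <- h; rewrite /sto nth_default // size_rev. Qed.

Lemma fp_at m f : fp m f -> exists c k, forall p, injective p ->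
  forall e (S : store), size e = m -> (forall i, S (p i) = sto e i) ->
  runs (ren p c) S (upd S (p m) (f e)) ((tot e + 2) ^ k) /\
  size (f e) <= (tot e + 2) ^ k.
Proof.
case=> c [k H]; exists c, k => p pI e S he hS.
have [[t ht et] hs] := H e he; split=> //; exists t => //.
have [S' [h1 h2] et'] := exec_ren pI et hS.
suff -> : upd S (p m) (f e) = S' by [].
apply: funext => j; have [[i ji]|/forallNP hj] := pselect (exists i, j = p i).
  by rewrite ji h1 (sto_cons _ he) /upd (inj_eq pI) hS.
by rewrite h2 // upd_ne // => /hj.
Qed.

(** Finiteness of the alphabet gives one exponent for all tokens. *)
Lemma fp_choice m (h : token -> seq word -> word) : (forall a, fp m (h a)) ->
  exists (c : token -> cmd) k, forall a e, size e = m ->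
    runs (c a) (sto e) (sto (h a e :: e)) ((tot e + 2) ^ k) /\
    size (h a e) <= (tot e + 2) ^ k.
Proof.
move=> H; have [c hc] := choice H; have [k hk] := choice hc.
exists c, (\max_a k a) => a e he; have [h1 h2] := hk a e he.
have le : (tot e + 2) ^ k a <= (tot e + 2) ^ (\max_a k a).
  by rewrite leq_pexp2l ?(leq_bigmax (F := k)) //; lia.
by split; [apply: runs_leq h1 le|apply: leq_trans h2 le].
Qed.

Lemma fp_ren n m h p (sel : seq word -> seq word) : fp n h -> injective p ->
  p n = m ->
  (forall e, size e = m ->
     [/\ size (sel e) = n, forall i, sto e (p i) = sto (sel e) i
       & tot (sel e) <= tot e]) ->
  fp m (fun e => h (sel e)).
Proof.
move=> /fp_at[c [k H]] pI pn hsel; exists (ren p c), k => e he.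
have [h1 h2 h3] := hsel e he; have [r1 r2] := H p pI _ _ h1 h2.
have le : (tot (sel e) + 2) ^ k <= (tot e + 2) ^ k by apply: leq_expl; lia.
rewrite pn -sto_cons // in r1.
by split; [apply: runs_leq r1 le|apply: leq_trans r2 le].
Qed.

(** Makes room for [s] foreign registers at position [m]: arguments stay in place, result and
    scratch space move behind. *)
Definition rshift_from (m s i : nat) : nat := if i < m then i else i + s.

Lemma rshift_from_inj m s : injective (rshift_from m s).
Proof. by rewrite /rshift_from => i j; do 2!case: ifP; lia. Qed.

Lemma tot_cat e e' : tot (e ++ e') = tot e + tot e'.
Proof. by rewrite /tot map_cat sumn_cat. Qed.

(** Weakening by the most recent variables. They sit directly behind the arguments of [f], so only
    its result and scratch registers have to move. *)
Lemma fp_drop p n f : fp n f -> fp (p + n) (fun e => f (drop p e)).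
Proof.
move=> h; apply: (fp_ren h (@rshift_from_inj n p)).
  by rewrite /rshift_from ltnn addnC.
move=> e he; split.
- by rewrite size_drop he; lia.
- move=> i; rewrite /rshift_from /sto.
  rewrite -{1}(cat_take_drop p e) rev_cat nth_cat size_rev size_drop he addKn.
  case: (ltnP i n) => h1; first by rewrite h1.
  have -> : i + p < n = false by lia.
  by rewrite !nth_default // ?size_rev ?size_drop ?size_takel ?he; lia.
- by rewrite -{2}(cat_take_drop p e) tot_cat leq_addl.
Qed.

Lemma fp_take n q h : fp n h -> fp (n + q) (fun e => h (take n e)).
Proof.
move=> H; apply: (fp_ren H (p := addn q)).
- exact: addnI.
- by rewrite addnC.
move=> e he; split.
- by rewrite size_take he; case: ltnP; lia.
- move=> i; rewrite /sto -{1}(cat_take_drop n e) rev_cat nth_cat size_rev size_drop he.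
  by rewrite addKn ifF ?addKn //; lia.
- by rewrite -{2}(cat_take_drop n e) tot_cat leq_addr.
Qed.

Ltac upd_eq := apply: funext => i; rewrite /upd;
  repeat (case: eqP => ?); try lia; subst; try by [].

Ltac upd_val := rewrite /upd; repeat (case: eqP => ?); try lia; try by [].

(** Leaves the scope of a local variable: the value below the top is erased and the top takes its
    place. The temporary register [m.+2] allows two reversals that cancel. *)
Definition cleave (m : nat) : cmd := CSeq (cclear m) (cshift m.+1 m m.+2).

Lemma runs_leave m e x y : size e = m ->
  runs (cleave m) (sto (x :: y :: e)) (sto (x :: e))
    (2 * size y + 6 * size x + 3).
Proof.
move=> he; rewrite (sto_cons _ (m := m.+1)) /= ?he // !(sto_cons _ he).
have h1 := sto_ge (i := m.+1) he (leqnSn _).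
have h2 := sto_ge (i := m.+2) he (leqW (leqnSn _)).
apply: runs_seq (runs_clear m _) _ _.
  have d1 : m.+1 <> m by lia.
  have d2 : m.+1 <> m.+2 by lia.
  have d3 : m.+2 <> m by lia.
  have h3 : upd (upd (upd (sto e) m y) m.+1 x) m [::] m.+2 = [::].
    by rewrite !upd_ne //; lia.
  have := runs_shift d1 d2 d3 h3.
  rewrite upd_ne; last by lia.
  rewrite upd_at upd_at cats0.
  set S := upd (upd _ m.+1 [::]) m x; move=> H.
  have -> : upd (sto e) m x = S; last exact: H.
  by rewrite /S; upd_eq.
rewrite upd_ne; last by lia.
by rewrite upd_at; lia.
Qed.

Lemma fp_let m f g : fp m f -> fp m.+1 g -> fp m (fun e => g (f e :: e)).
Proof.
case=> c1 [k1 h1] [c2 [k2 h2]].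
pose T1 x := (x + 2) ^ k1; pose T2 x := (T1 x + x + 2) ^ k2.
apply: (@fp_intro m _ (CSeq c1 (CSeq c2 (cleave m)))
  (fun x => T1 x + (T2 x + (2 * T1 x + 6 * T2 x + 3)))).
  by rewrite /T2 /T1; polyb.
move=> e he; have [r1 s1] := h1 e he.
have [|r2 s2] := h2 (f e :: e); first by rewrite /= he.
have lt2 : (tot (f e :: e) + 2) ^ k2 <= T2 (tot e).
  by apply: leq_expl; rewrite /tot /= -/(tot e) /T1; lia.
split; last by lia.
apply: runs_seq r1 (runs_seq r2 (runs_leave _ _ he) (leqnn _)) _.
by rewrite /T1; lia.
Qed.

(** Popping register [m] leaves the tail of [f e] in it, which thereby is the new variable of [h a].
    In the other case the register is empty, and [h0] is weakened by it. *)
Lemma fp_case m f h0 h : fp m f -> fp m h0 -> (forall a, fp m.+1 (h a)) ->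
  fp m (fun e => if f e is a :: s then h a (s :: e) else h0 e).
Proof.
case=> c1 [k1 h1] /(fp_drop 1)[c0 [k0 H0]] /fp_choice[c [k hc]].
pose T1 x := (x + 2) ^ k1; pose T2 x := (T1 x + x + 2) ^ (k0 + k).
apply: (@fp_intro m _ (CSeq c1 (CSeq (CBranch m
    (fun o => if o is Some a then c a else c0)) (cleave m)))
  (fun x => T1 x + (T2 x + 1 + (2 * T1 x + 6 * T2 x + 3)))).
  by rewrite /T2 /T1; polyb.
move=> e he; have [r1 s1] := h1 e he.
set y := (X in sto (X :: _)).
have hT2 x i : x <= T1 (tot e) + tot e -> i <= k0 + k -> (x + 2) ^ i <= T2 (tot e).
  move=> hx hi; apply: leq_trans (_ : _ <= (T1 (tot e) + tot e + 2) ^ i) _.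
    by apply: leq_expl; lia.
  by rewrite leq_pexp2l //; lia.
have [r2 s2] : runs (CBranch m (fun o => if o is Some a then c a else c0))
    (sto (f e :: e)) (sto (y :: behead (f e) :: e)) (T2 (tot e) + 1)
    /\ size y <= T2 (tot e).
  have tl : tot (behead (f e) :: e) <= T1 (tot e) + tot e.
    by rewrite /tot /= size_behead -/(tot e) /T1; lia.
  have [[t ht et] hsz] : runs (if ohead (f e) is Some a then c a else c0)
      (sto (behead (f e) :: e)) (sto (y :: behead (f e) :: e)) (T2 (tot e))
      /\ size y <= T2 (tot e).
    rewrite /y; case: (f e) tl => [|a s] /= tl.
      have [|r s0] := H0 ([::] :: e); first by rewrite /= he.
      move: r s0; rewrite /= drop0 => r s0.
      have le := hT2 _ k0 tl (leq_addr _ _).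
      by split; [apply: runs_leq r le|apply: leq_trans s0 le].
    have [|r s0] := hc a (s :: e); first by rewrite /= he.
    have le := hT2 _ k tl (leq_addl _ _).
    by split; [apply: runs_leq r le|apply: leq_trans s0 le].
  split=> //; exists t.+1; first by lia.
  apply: ExecBranch; rewrite (sto_cons _ he) upd_at.
  move: et; rewrite (sto_cons (behead (f e)) he); congr exec.
  by apply: funext => i; rewrite /upd; case: eqP.
split; last by apply: leq_trans s2 _; lia.
apply: runs_seq r1 (runs_seq r2 (runs_leave _ _ he) (leqnn _)) _.
by rewrite size_behead /T1; lia.
Qed.

Lemma fp_nil m : fp m (fun=> [::]).
Proof.
exists CSkip, 0 => e he; split=> //.
rewrite (sto_cons _ he) -(sto_ge he (leqnn m)) updK.
by exists 1 => //; exact: ExecSkip.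
Qed.

Lemma fp_cons m a f : fp m f -> fp m (fun e => a :: f e).
Proof.
case=> c [k h]; apply: (@fp_intro m _ (CSeq c (CPush m a)) (fun x => (x + 2) ^ k + 2)).
  by polyb.
move=> e he; have [r s] := h e he; split; last by rewrite /=; lia.
apply: runs_seq r _ (leqnn _); exists 2 => //.
have := ExecPush (sto (f e :: e)) m a.
rewrite !(sto_cons _ he) upd_at; congr exec.
by apply: funext => i; rewrite /upd; case: eqP.
Qed.

Lemma fp_const m w : fp m (fun=> w).
Proof. by elim: w => [|a w IH]; [exact: fp_nil|exact: fp_cons]. Qed.

Lemma fp_cat m f g : fp m f -> fp m g -> fp m (fun e => f e ++ g e).
Proof.
case=> c1 [k1 h1] /(fp_drop 1)[c2 [k2 h2]].
pose T1 x := (x + 2) ^ k1; pose T2 x := (T1 x + x + 2) ^ k2.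
apply: (@fp_intro m _ (CSeq c1 (CSeq c2 (CSeq (cshift m m.+1 m.+2) (cleave m))))
  (fun x => T1 x + (T2 x + (6 * T1 x + 2 + (6 * (T1 x + T2 x) + 3))))).
  by rewrite /T2 /T1; polyb.
move=> e he; have [r1 s1] := h1 e he.
have [|r2 s2] := h2 (f e :: e); first by rewrite /= he.
rewrite /= drop0 in r2 s2.
have lt2 : (tot (f e :: e) + 2) ^ k2 <= T2 (tot e).
  by apply: leq_expl; rewrite /tot /= -/(tot e) /T1; lia.
split; last by rewrite size_cat /T1; lia.
apply: runs_seq r1 (runs_seq r2 (runs_seq _ (runs_leave _ [::] he) (leqnn _)) (leqnn _)) _.
  have d1 : m <> m.+1 by lia.
  have d2 : m <> m.+2 by lia.
  have d3 : m.+2 <> m.+1 by lia.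
  have he1 x : size (x :: e) = m.+1 by rewrite /= he.
  have h3 : sto (g e :: f e :: e) m.+2 = [::].
    by apply: (@sto_ge m.+2); rewrite /= ?he.
  have := runs_shift d1 d2 d3 h3.
  rewrite !(sto_cons _ (he1 _)) upd_at upd_ne // !(sto_cons _ he) upd_at.
  set A := upd _ m.+1 (_ ++ _) => H.
  have -> : upd (upd (sto e) m [::]) m.+1 (f e ++ g e) = A; last exact: H.
  by rewrite /A; upd_eq.
by rewrite size_cat /T1 /=; lia.
Qed.

Fixpoint foldx (F : token -> word -> word -> word -> word) (acc u v : word) : word :=
  if v is a :: v' then foldx F (F a acc u v') (a :: u) v' else acc.

(* The additive bound on the growth of the accumulator keeps all iterates of
   polynomial size. *)
Lemma fp_foldx m l init (h : token -> seq word -> word) :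
  fp m l -> fp m init -> (forall a, fp m.+3 (h a)) ->
  (exists g, forall a e u v acc, size e = m ->
     size (h a (acc :: u :: v :: e)) <= size acc + (tot e + size u + size v + 2) ^ g) ->
  fp m (fun e => foldx (fun a acc u v => h a (acc :: u :: v :: e)) (init e) [::] (l e)).
Proof.
case=> c1 [k1 h1] /fp_at[c2 [k2 h2]] /fp_choice[c3 [k3 h3]] [g hg].
pose T1 x := (x + 2) ^ k1; pose T2 x := (x + 2) ^ k2.
(* [T1] bounds the number of rounds and [G] the growth per round, hence [A] bounds every
   accumulator; [W] is the cost of one round. *)
pose G x := (x + T1 x + 2) ^ g; pose A x := T2 x + T1 x * G x.
pose W x := (x + T1 x + A x + 2) ^ k3 + (2 * A x + 6 * A x + 3 + 4).
pose body a := CSeq (c3 a) (CSeq (cleave m.+2) (CPush m.+1 a)).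
(* Register [m] holds the unread suffix, [m.+1] the reversed prefix, [m.+2] the accumulator. The
   shift by 2 makes [c2] deliver the initial accumulator directly into [m.+2]. *)
apply: (@fp_intro m _ (CSeq c1 (CSeq (ren (rshift_from m 2) c2)
    (CSeq (CLoop m body) (CSeq (cclear m.+1) (cshift m.+2 m m.+3)))))
  (fun x => T1 x + (T2 x + (T1 x * W x + 1 + (2 * T1 x + 1 + (6 * A x + 2)))))).
  by rewrite /W /A /G /T1 /T2; polyb.
move=> e he; have [r1 s1] := h1 e he.
set F := fun a acc u v => h a (acc :: u :: v :: e).
have stE : [/\ forall v, sto (v :: e) = upd (sto e) m v,
    forall u v, sto (u :: v :: e) = upd (upd (sto e) m v) m.+1 u,
    forall a u v, sto (a :: u :: v :: e) = upd (upd (upd (sto e) m v) m.+1 u) m.+2 a &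
    forall b a u v, sto (b :: a :: u :: v :: e)
      = upd (upd (upd (upd (sto e) m v) m.+1 u) m.+2 a) m.+3 b].
  have E1 v : sto (v :: e) = upd (sto e) m v by rewrite (sto_cons _ he).
  have E2 u v : sto (u :: v :: e) = upd (upd (sto e) m v) m.+1 u.
    by rewrite (@sto_cons m.+1) ?E1 //= he.
  have E3 a u v : sto (a :: u :: v :: e) = upd (upd (upd (sto e) m v) m.+1 u) m.+2 a.
    by rewrite (@sto_cons m.+2) ?E2 //= he.
  by split=> // b a u v; rewrite (@sto_cons m.+3) ?E3 //= he.
case: stE => sE1 sE2 sE3 sE4.
have n0 i : m <= i -> sto e i = [::] by exact: sto_ge.
(* The invariant reserves [G] for every unread symbol, so the bound [A] survives all rounds. *)
have loop v : forall u acc,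
    size u + size v <= T1 (tot e) -> size acc + size v * G (tot e) <= A (tot e) ->
    runs (CLoop m body) (sto (acc :: u :: v :: e))
      (sto (foldx F acc u v :: (rev v ++ u) :: [::] :: e))
      (size v * W (tot e) + 1) /\ size (foldx F acc u v) <= A (tot e).
  elim: v => [|a v IH] u acc hu hacc.
    split; last by rewrite /= in hacc *; lia.
    by exists 1 => //; apply: ExecLoop0; rewrite sE3; upd_val.
  have tE : tot [:: acc, u, v & e] = size acc + (size u + (size v + tot e)) by [].
  rewrite /= in hu hacc.
  have [|r s] := h3 a [:: acc, u, v & e]; first by rewrite /= he.
  have hF : size (F a acc u v) <= size acc + G (tot e).
    apply: leq_trans (hg a e u v acc he) _; rewrite leq_add2l.
    by apply: leq_expl; lia.
  have [||rI sI] := IH (a :: u) (F a acc u v); [by rewrite /=; lia|by nia|].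
  split; last exact: sI.
  have rb : runs (body a) (sto [:: acc, u, v & e])
      (sto [:: F a acc u v, a :: u, v & e]) (W (tot e) - 1).
    have he2 : size [:: u, v & e] = m.+2 by rewrite /= he.
    apply: runs_seq r (runs_seq (runs_leave _ _ he2) _ (leqnn _)) _.
      exists 2 => //; have := ExecPush (sto [:: F a acc u v, u, v & e]) m.+1 a.
      rewrite !sE3 upd_ne; last by lia.
      rewrite upd_at; congr exec; upd_eq.
    have : (tot [:: acc, u, v & e] + 2) ^ k3 <= (tot e + T1 (tot e) + A (tot e) + 2) ^ k3.
      by apply: leq_expl; nia.
    have hA1 : size (h a [:: acc, u, v & e]) <= A (tot e).
      by rewrite -/(F a acc u v); nia.
    have hA2 : size acc <= A (tot e) by nia.
    by move: hA1 hA2; rewrite /W; lia.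
  case: rb => t1 ht1 e1; case: rI => t2 ht2 e2.
  exists (t1 + t2).+1; last first.
    have hv : sto [:: acc, u, a :: v & e] m = a :: v.
      by rewrite sE3; upd_val.
    apply: ExecLoopS hv _ _; last by rewrite rev_cons cat_rcons; exact: e2.
    move: e1; rewrite !sE3; congr exec; upd_eq.
  have : 1 <= W (tot e) by rewrite /W; lia.
  by rewrite /=; nia.
have [||rl sl] := loop (l e) [::] (init e).
- by rewrite /= /T1.
- have [_ s2] := h2 id (fun _ _ => id) e (sto e) he (fun=> erefl).
  by apply: leq_add; [exact: s2|rewrite leq_mul2r; apply/orP; right; exact: s1].
have [r2 s2] : runs (ren (rshift_from m 2) c2) (sto (l e :: e))
   (sto (init e :: [::] :: l e :: e)) (T2 (tot e)) /\ size (init e) <= T2 (tot e).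
  have [i|r s] := h2 _ (@rshift_from_inj m 2) e (sto (l e :: e)) he.
    rewrite /rshift_from sE1; case: ltnP => hi; first by rewrite upd_ne //; lia.
    by rewrite upd_ne ?n0 //; lia.
  split; last exact: s.
  move: r; rewrite /rshift_from ltnn sE1 sE3 addn2; congr runs; upd_eq.
  by rewrite n0 //; lia.
split; last by lia.
rewrite cats0 in rl.
set Y := foldx _ _ _ _ in rl sl *.
apply: runs_seq r1 (runs_seq r2 (runs_seq rl (runs_seq (runs_clear _ _) _ (leqnn _))
  (leqnn _)) (leqnn _)) _.
  have d1 : m.+2 <> m by lia.
  have d2 : m.+2 <> m.+3 by lia.
  have d3 : m.+3 <> m by lia.
  have h4 : upd (sto [:: Y, rev (l e), [::] & e]) m.+1 [::] m.+3 = [::].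
    by rewrite sE3; upd_val; rewrite n0 //; lia.
  have := runs_shift d1 d2 d3 h4.
  rewrite sE3 sE1; set a1 := upd _ m.+1 [::] m.+2; set a2 := upd _ m.+1 [::] m.
  have -> : a1 = Y by rewrite /a1; upd_val.
  have -> : a2 = [::] by rewrite /a2; upd_val.
  rewrite cats0; set B := upd (upd _ m.+2 [::]) m Y => H.
  have -> : upd (sto e) m Y = B; last exact: H.
  by rewrite /B; upd_eq; rewrite n0 //; lia.
rewrite sE3 (@upd_ne _ m.+2) ?upd_at ?size_rev; last by lia.
have hl : size (l e) <= T1 (tot e) by [].
have : size (l e) * W (tot e) <= T1 (tot e) * W (tot e) by rewrite leq_mul2r hl orbT.
by rewrite -/(T1 _); nia.
Qed.

Notation arg e i := (nth [::] e i).

Lemma sto_nil e : sto ([::] :: e) = sto e.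
Proof. by rewrite (sto_cons _ erefl) -(sto_ge erefl (leqnn (size e))) updK. Qed.

(** Reading a stack destroys it. The copy is made by emptying the word into a scratch register and
    pushing each symbol twice on the way back. *)
Lemma fp_arg0 : fp 1 (fun e => arg e 0).
Proof.
pose body a := CSeq (CPush 0 a) (CPush 1 a).
apply: (@fp_intro 1 _ (CSeq (cmove 0 2) (CLoop 2 body)) (fun x => 3 * x + 1 + (5 * x + 1))).
  by polyb.
move=> [|x []] // _; rewrite /= /tot /= addn0; split; last by lia.
apply: runs_seq (leqnn _); first exact: (@runs_move 0 2 (sto [:: x])).
have -> : upd (upd (sto [:: x]) 0 [::]) 2 (rev (sto [:: x] 0) ++ sto [:: x] 2)
    = sto [:: rev x; [::]; [::]].
  by apply: funext => -[|[|[|i]]] //=; rewrite /upd /sto /= ?cats0 // nth_nil.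
rewrite -[in sto [:: x; x]](revK x); move: (rev x) (size_rev x) => z <- {x}.
have -> : sto [:: rev z; rev z] = sto [:: [::]; rev z ++ [::]; rev z ++ [::]].
  by rewrite sto_nil !cats0.
suff : forall y, runs (CLoop 2 body) (sto [:: z; y; y])
    (sto [:: [::]; rev z ++ y; rev z ++ y]) (5 * size z + 1) by apply.
elim: z => [|a z IH] y; first by exists 1 => //; apply: ExecLoop0.
have [t ht et] := IH (a :: y); exists (2 + 2 + t).+1; first by rewrite /=; lia.
have h2 : sto [:: a :: z; y; y] 2 = a :: z by [].
apply: ExecLoopS h2 _ _; last by rewrite rev_cons cat_rcons; exact: et.
set S := upd _ _ _; have <- : upd (upd S 0 (a :: S 0)) 1 (a :: S 1)
    = sto [:: z; a :: y; a :: y].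
  by apply: funext => -[|[|[|i]]] //=; rewrite /S /upd /sto /= !nth_nil.
exact: ExecSeq (ExecPush _ _ _) (ExecPush _ _ _).
Qed.

Lemma fp_arg m i : i < m -> fp m (fun e => arg e i).
Proof.
move=> h; have := fp_drop i (fp_take (m - i).-1 fp_arg0).
have -> : i + (1 + (m - i).-1) = m by lia.
apply: fp_ext => e he; rewrite nth_take // nth_drop addn0 //.
Qed.

Definition fp1 (F : word -> word) := fp 1 (fun e => F (arg e 0)).

Lemma fp_app1 F m f : fp1 F -> fp m f -> fp m (fun e => F (f e)).
Proof.
move=> /(fp_take m) hF hf; apply: fp_ext (fp_let hf hF) => e he.
by rewrite nth_take.
Qed.

Definition fpb (m : nat) (b : seq word -> bool) :=
  fp m (fun e => if b e then [:: Kone] else [::]).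

Lemma fp_if m b f g : fpb m b -> fp m f -> fp m g ->
  fp m (fun e => if b e then f e else g e).
Proof.
move=> hb hf hg; apply: fp_ext (fp_case hb hg (fun=> fp_drop 1 hf)) => e he.
by case: (b e); rewrite //= drop0.
Qed.

Lemma fpb_not m b : fpb m b -> fpb m (fun e => ~~ b e).
Proof.
move=> hb; apply: fp_ext (fp_if hb (fp_nil m) (fp_const m [:: Kone])) => e he.
by case: (b e).
Qed.

Lemma fpb_and m b b' : fpb m b -> fpb m b' -> fpb m (fun e => b e && b' e).
Proof.
move=> hb hb'; apply: fp_ext (fp_if hb hb' (fp_nil m)) => e he.
by case: (b e).
Qed.

Lemma fpb_cst m (b : bool) : fpb m (fun=> b).
Proof. by case: b; apply: fp_const. Qed.

Lemma fpb_nil m f : fp m f -> fpb m (fun e => f e == [::]).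
Proof.
move=> hf; apply: fp_ext (fp_case hf (fp_const m [:: Kone]) (fun=> fp_nil _)) => e he.
by case: (f e).
Qed.

Definition hd_test (P : token -> bool) (b0 : bool) (w : word) : bool :=
  if w is a :: _ then P a else b0.

Lemma fpb_hd m P b0 f : fp m f -> fpb m (fun e => hd_test P b0 (f e)).
Proof.
move=> hf.
apply: fp_ext (fp_case hf (fp_const m (if b0 then [:: Kone] else [::]))
  (fun a => fp_const m.+1 (if P a then [:: Kone] else [::]))) => e he.
by case: (f e).
Qed.

(** The emission at a position may use the reversed prefix, thus the index in unary, and unlimited
    lookahead. Both reductions are built from nested instances of this scheme. *)
Fixpoint flatx (F : token -> word -> word -> word) (u v : word) : word :=
  if v is a :: v' then F a u v' ++ flatx F (a :: u) v' else [::].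

Lemma foldx_flatx F acc u v :
  foldx (fun a acc u v => acc ++ F a u v) acc u v = acc ++ flatx F u v.
Proof.
by elim: v acc u => [|a v IH] acc u /=; rewrite ?cats0 // IH catA.
Qed.

Lemma eq_foldx F G acc u v :
  (forall a acc u v, F a acc u v = G a acc u v) -> foldx F acc u v = foldx G acc u v.
Proof. by move=> h; elim: v acc u => //= a v IH acc u; rewrite h IH. Qed.

Lemma fp_flatx m (F : seq word -> token -> word -> word -> word) l :
  fp m l ->
  (forall a, fp m.+2 (fun e => F (drop 2 e) a (arg e 0) (arg e 1))) ->
  fp m (fun e => flatx (F e) [::] (l e)).
Proof.
move=> hl hF.
pose h a (e : seq word) := arg e 0 ++ F (drop 2 (drop 1 e)) a (arg (drop 1 e) 0) (arg (drop 1 e) 1).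
have H : fp m (fun e => foldx (fun a acc u v => h a (acc :: u :: v :: e)) [::] [::] (l e)).
  apply: (@fp_foldx m l (fun=> [::]) h hl (fp_nil m)).
    by move=> a; apply: fp_cat (fp_arg _) (fp_drop 1 (hF a)).
  have [c [k hk]] := fp_choice hF; exists k => a e u v acc he.
  have [|_] := hk a [:: u, v & e]; first by rewrite /= he.
  rewrite /h /= size_cat leq_add2l => /leq_trans; apply.
  by apply: leq_expl; rewrite /tot /= -/(tot e); lia.
apply: fp_ext H => e he; rewrite -[LHS]cat0s -foldx_flatx; apply: eq_foldx => *.
by rewrite /h /= !drop0.
Qed.

Lemma foldx_foldl (F : token -> word -> word) acc u v :
  foldx (fun a acc u v => F a acc) acc u v = foldl (fun acc a => F a acc) acc v.
Proof. by elim: v acc u => //= a v IH acc u; rewrite IH. Qed.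

(** Additive growth per step prevents an exponential blow-up when the step is iterated along a
    word. *)
Definition slow (F : token -> word -> word) : Prop :=
  (forall a, fp1 (F a)) /\ exists c, forall a x, size (F a x) <= size x + c.

Lemma fp_foldl m (F : token -> word -> word) l init : slow F -> fp m l -> fp m init ->
  fp m (fun e => foldl (fun acc a => F a acc) (init e) (l e)).
Proof.
case=> hF [c hc] hl hi.
have H : fp m (fun e => foldx (fun a acc u v => F a (arg [:: acc, u, v & e] 0)) (init e) [::] (l e)).
  apply: (@fp_foldx m l init (fun a e => F a (arg e 0)) hl hi).
    by move=> a; apply: fp_app1 (hF a) (fp_arg _).
  exists c => a e u v acc he /=; apply: leq_trans (hc _ _) _; rewrite leq_add2l.
  apply: leq_trans (ltnW (ltn_expl c (isT : 1 < 2))) _; apply: leq_expl; lia.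
by apply: fp_ext H => e he; rewrite -(foldx_foldl F _ [::]).
Qed.

(** The steps of a pushdown automaton that inspects at most two stack symbols; the growth constants
    are maxima over the finite alphabet. Both parsers below have this form. *)
Lemma slow_table (P0 : token -> word) (P1 : token -> token -> word)
    (P2 : token -> token -> token -> word) :
  slow (fun a st => match st with
    | [::] => P0 a
    | b :: s => match s with [::] => P1 a b | c :: s' => P2 a b c ++ s' end
    end).
Proof.
split=> [a|].
  apply: (@fp_case 1 (fun e => arg e 0) (fun=> P0 a) (fun b e =>
    match arg e 0 with [::] => P1 a b | c :: s' => P2 a b c ++ s' end)).
  - exact: fp_arg.
  - exact: fp_const.
  move=> b; apply: (@fp_case 2 (fun e => arg e 0) (fun=> P1 a b) (fun c e => P2 a b c ++ arg e 0)).
  - exact: fp_arg.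
  - exact: fp_const.
  by move=> c; apply: fp_cat; [exact: fp_const|exact: fp_arg].
pose c0 := \max_a size (P0 a); pose c1 := \max_a \max_b size (P1 a b).
pose c2 := \max_a \max_b \max_c size (P2 a b c).
exists (c0 + c1 + c2)%N => a [|b [|c s]] /=.
- have : size (P0 a) <= c0 by apply: (leq_bigmax (F := fun a => size (P0 a))).
  by lia.
- have h1 : \max_b size (P1 a b) <= c1 := leq_bigmax (F := fun a => \max_b size (P1 a b)) a.
  have : size (P1 a b) <= \max_b size (P1 a b) by apply: (leq_bigmax (F := fun b => size (P1 a b))).
  by lia.
- have h1 : \max_b \max_c size (P2 a b c) <= c2 :=
    leq_bigmax (F := fun a => \max_b \max_c size (P2 a b c)) a.
  have h2 : \max_c size (P2 a b c) <= \max_b \max_c size (P2 a b c) :=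
    leq_bigmax (F := fun b => \max_c size (P2 a b c)) b.
  have : size (P2 a b c) <= \max_c size (P2 a b c) by apply: (leq_bigmax (F := fun c => size (P2 a b c))).
  by rewrite size_cat; lia.
Qed.

Lemma slow_table1 (P0 : token -> word) (P1 : token -> token -> word) :
  slow (fun a st => if st is b :: s then P1 a b ++ s else P0 a).
Proof.
have [h1 h2] := slow_table P0 P1 (fun a b c => P1 a b ++ [:: c]).
have E a st : (if st is b :: s then P1 a b ++ s else P0 a) = match st with
    | [::] => P0 a
    | b :: s => match s with [::] => P1 a b | c :: s' => (P1 a b ++ [:: c]) ++ s' end
    end.
  by case: st => [|b [|c s]] //; rewrite ?cats0 // -catA.
split=> [a|]; first by apply: fp_ext (h1 a) => e _; rewrite E.
by case: h2 => c hc; exists c => a x; rewrite E.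
Qed.

Lemma foldl_rev_cons (u w : word) : foldl (fun acc a => a :: acc) u w = rev w ++ u.
Proof. by elim: w u => //= a w IH u; rewrite IH rev_cons cat_rcons. Qed.

Lemma fp_rev m f : fp m f -> fp m (fun e => rev (f e)).
Proof.
move=> hf; have hs : slow (fun a st => a :: st).
  split=> [a|]; last by exists 1 => a x; rewrite /= addn1.
  exact: fp_cons (fp_arg _).
apply: fp_ext (fp_foldl hs hf (fp_nil m)) => e he.
by rewrite foldl_rev_cons cats0.
Qed.

(* A transducer with a work stack [st] that sees the reversed prefix and the
   suffix around the current symbol. *)
Fixpoint transd (step : token -> word -> word)
    (emit : token -> word -> word -> word -> word) (st u w : word) : word :=
  if w is a :: v then emit a st u v ++ transd step emit (step a st) (a :: u) v
  else [::].

(** The stack in front of each position is recomputed from the reversed prefix. Emissions then do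
    not depend on one another and form an instance of [flatx], at a polynomial loss of time. *)
Lemma fp_transd m step (emit : seq word -> token -> word -> word -> word -> word) st l :
  slow step -> fp m l ->
  (forall a, fp m.+3 (fun e => emit (drop 3 e) a (arg e 0) (arg e 1) (arg e 2))) ->
  fp m (fun e => transd step (emit e) st [::] (l e)).
Proof.
move=> hs hl he.
pose run u := foldl (fun acc a => step a acc) st (rev u).
have H : fp m (fun e => flatx (fun a u v => emit e a (run u) u v) [::] (l e)).
  apply: (fp_flatx (F := fun e a u v => emit e a (run u) u v)) => // a.
  have hr : fp m.+2 (fun e => run (arg e 0)).
    exact: fp_foldl hs (fp_rev (fp_arg _)) (fp_const _ _).
  apply: fp_ext (fp_let hr (he a)) => e _.
  by rewrite /= ; case: e => [|? []].
apply: fp_ext H => e _.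
have -> : st = run [::] by [].
elim: (l e) [::] => //= a v IH u; rewrite -IH; congr (_ ++ transd _ _ _ _ _).
by rewrite /run rev_cons foldl_rcons.
Qed.

Lemma fpb_all m P f : fp m f -> fpb m (fun e => all P (f e)).
Proof.
(* The accumulator is a flag [[:: Kone]], erased for good by the first symbol that violates [P]. *)
move=> hf; pose F a (st : word) := if st is b :: s then (if P a then [:: b] else [::]) ++ s else [::].
have hs : slow F := slow_table1 (fun=> [::]) (fun a b => if P a then [:: b] else [::]).
apply: fp_ext (fp_foldl hs hf (fp_const m [:: Kone])) => e he.
have H0 w : foldl (fun acc a => F a acc) [::] w = [::] by elim: w.
by elim: (f e) => //= a w IH; rewrite /F; case: (P a); rewrite //= H0.
Qed.

Fixpoint lead (P : token -> bool) (w : word) : word :=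
  if w is a :: w' then if P a then a :: lead P w' else [::] else [::].
Fixpoint after (P : token -> bool) (w : word) : word :=
  if w is a :: w' then if P a then after P w' else w else [::].

Lemma fp_lead m P f : fp m f -> fp m (fun e => lead P (f e)).
Proof.
move=> hf; have H : fp m (fun e => flatx (fun a u v => if P a && all P u then [:: a] else [::]) [::] (f e)).
  apply: fp_flatx hf _ => a; apply: fp_if; try exact: fp_const.
  by apply: fpb_and; [exact: fpb_cst|apply: fpb_all; exact: fp_arg].
apply: fp_ext H => e _.
set G := fun a u v => _.
have hn u v : ~~ all P u -> flatx G u v = [::].
  by elim: v u => //= a v IH u hu; rewrite /G (negbTE hu) andbF IH //= (negbTE hu) andbF.
suff H2 v : forall u, all P u -> flatx G u v = lead P v by rewrite H2.
elim: v => //= a v IH u hu; rewrite {1}/G hu andbT.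
by case: ifP => ha; [rewrite IH //= ha|rewrite hn //= ha].
Qed.

Lemma fp_after m P f : fp m f -> fp m (fun e => after P (f e)).
Proof.
move=> hf; have H : fp m (fun e => flatx (fun a u v => if P a && all P u then [::] else [:: a]) [::] (f e)).
  apply: fp_flatx hf _ => a; apply: fp_if; try exact: fp_const.
  by apply: fpb_and; [exact: fpb_cst|apply: fpb_all; exact: fp_arg].
apply: fp_ext H => e _.
set G := fun a u v => _.
have hn u v : ~~ all P u -> flatx G u v = v.
  by elim: v u => //= a v IH u hu; rewrite /G (negbTE hu) andbF IH //= (negbTE hu) andbF.
suff H2 v : forall u, all P u -> flatx G u v = after P v by rewrite H2.
elim: v => //= a v IH u hu; rewrite {1}/G hu andbT.
by case: ifP => ha; [rewrite IH //= ha|rewrite hn //= ha].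
Qed.

Lemma fp_behead m f : fp m f -> fp m (fun e => behead (f e)).
Proof.
move=> hf; apply: fp_ext (fp_case hf (fp_nil m) (fun=> fp_arg (ltn0Sn m))) => e _.
by case: (f e).
Qed.

Definition rep (x w : word) : word := flatten [seq x | _ <- w].

Lemma fp_rep m f g : fp m f -> fp m g -> fp m (fun e => rep (f e) (g e)).
Proof.
move=> hf hg; have H : fp m (fun e => flatx (fun a u v => f e) [::] (g e)).
  apply: (fp_flatx (F := fun e _ _ _ => f e)) hg _ => a.
  exact: (fp_drop 2 hf).
apply: fp_ext H => e _; rewrite /rep; elim: (g e) [::] => //= a v IH u.
by rewrite -IH.
Qed.

Lemma fp_cmap m (F : token -> word) f : fp m f -> fp m (fun e => flatten [seq F a | a <- f e]).
Proof.
move=> hf; have H : fp m (fun e => flatx (fun a u v => F a) [::] (f e)).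
  by apply: fp_flatx hf _ => a; apply: fp_const.
apply: fp_ext H => e _; elim: (f e) [::] => //= a v IH u.
by rewrite -IH.
Qed.

Lemma fpb_ltn m f g : fp m f -> fp m g -> fpb m (fun e => size (f e) < size (g e)).
Proof.
move=> hf hg; have hs : slow (fun a st => behead st).
  split=> [a|]; last by exists 0 => a x; rewrite size_behead; lia.
  by apply: fp_behead; apply: fp_arg.
have := fpb_not (fpb_nil (fp_foldl hs hf hg)); apply: fp_ext => e _.
suff -> : size (f e) < size (g e) = (foldl (fun acc _ => behead acc) (g e) (f e) != [::]) by [].
by elim: (f e) (g e) => [|a w IH] [|b x] //=; rewrite -IH.
Qed.

Lemma polytime_fp (S : finType) (f : seq S -> word) g :
  polytime f -> fp1 g -> polytime (g \o f).
Proof.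
move=> hf hg; have : fp 1 (fun e => g (rev (arg e 0))).
  exact: fp_app1 hg (fp_rev (fp_arg _)).
case=> c [k hc].
pose T x := (x + 2) ^ k.
have [k' hk'] : poly_bounded (fun x => T x + (2 * x + 1 + (3 * T x + 1))).
  by rewrite /T; polyb.
(* The program [c] undoes the reversal of its argument; the move from register 1 to register 0
   reverses the result as required. *)
apply: (@polytime_comp S f g (CSeq c (CSeq (cclear 0) (cmove 1 0))) k') => // x.
have [[t1 ht1 e1] s1] := hc [:: rev x] erefl.
rewrite /= revK /tot /= size_rev addn0 in ht1 e1 s1.
have [t2 ht2 e2] := runs_clear 0 (sto [:: g x; rev x]).
have d10 : 1 <> 0 by [].
have [t3 ht3 e3] := runs_move (upd (sto [:: g x; rev x]) 0 [::]) d10.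
exists (t1 + (t2 + t3)), (upd (upd (upd (sto [:: g x; rev x]) 0 [::]) 1 [::]) 0
  (rev (upd (sto [:: g x; rev x]) 0 [::] 1) ++ upd (sto [:: g x; rev x]) 0 [::] 0)).
move: ht2 ht3; rewrite /upd /sto /= size_rev => ht2 ht3; have := hk' (size x); rewrite /T => hT.
split; [by lia| |by rewrite cats0|by lia].
have -> : (fun i => if i == 0 then rev x else [::]) = sto [:: rev x].
  by apply: funext => -[|i] //; rewrite /sto /= nth_nil.
exact: ExecSeq e1 (ExecSeq e2 e3).
Qed.

(** * Formulas with numbered variables and their encodings *)

Import Order.TTheory GRing.Theory Num.Theory.

(** Indices are plain numbers, because the reductions renumber variables and change the dimension;
    boundedness becomes a separate boolean test. *)
Inductive rterm :=
  | RVar of nat | RZero | ROne | RAdd of rterm & rterm | RMul of rterm & rterm.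

Inductive rqf := RAtom of cmp & rterm | RAnd of rqf & rqf | ROr of rqf & rqf.

Notation rpoly := (seq (int * seq nat)).

Inductive rsa :=
  | SaAtom of cmp & rpoly | SaNot of rsa | SaAnd of rsa & rsa | SaOr of rsa & rsa.

Definition encv (i : nat) : word := Kvar :: nseq i Ktick.

Fixpoint enct (t : rterm) : word :=
  match t with
  | RVar i => encv i
  | RZero => [:: Kzero]
  | ROne => [:: Kone]
  | RAdd a b => Kplus :: enct a ++ enct b
  | RMul a b => Ktimes :: enct a ++ enct b
  end.

Fixpoint encq (f : rqf) : word :=
  match f with
  | RAtom c t => enc_cmp c :: enct t
  | RAnd f g => Kand :: encq f ++ encq g
  | ROr f g => Kor :: encq f ++ encq g
  end.

Definition encvs (s : seq nat) : word := flatten [seq encv i | i <- s].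

Definition encp (g : rpoly) : word :=
  flatten [seq Kplus :: enc_int m.1 ++ encvs m.2 | m <- g].

Fixpoint encs (f : rsa) : word :=
  match f with
  | SaAtom c g => enc_cmp c :: encp g
  | SaNot f => Knot :: encs f
  | SaAnd f g => Kand :: encs f ++ encs g
  | SaOr f g => Kor :: encs f ++ encs g
  end.

Fixpoint tbd (n : nat) (t : rterm) : bool :=
  match t with
  | RVar i => i < n
  | RZero | ROne => true
  | RAdd a b | RMul a b => tbd n a && tbd n b
  end.

Fixpoint qbd (n : nat) (f : rqf) : bool :=
  match f with
  | RAtom _ t => tbd n t
  | RAnd f g | ROr f g => qbd n f && qbd n g
  end.

Definition pbd (n : nat) (g : rpoly) : bool := all (fun m => all (fun i => i < n) m.2) g.

Fixpoint sbd (n : nat) (f : rsa) : bool :=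
  match f with
  | SaAtom _ g => pbd n g
  | SaNot f => sbd n f
  | SaAnd f g | SaOr f g => sbd n f && sbd n g
  end.

Section Semantics.
Variable R : realType.
Implicit Types v : nat -> R.
Local Open Scope ring_scope.

Fixpoint teval v (t : rterm) : R :=
  match t with
  | RVar i => v i
  | RZero => 0
  | ROne => 1
  | RAdd a b => teval v a + teval v b
  | RMul a b => teval v a * teval v b
  end.

Fixpoint rsat v (f : rqf) : bool :=
  match f with
  | RAtom c t => cmp0 c (teval v t)
  | RAnd f g => rsat v f && rsat v g
  | ROr f g => rsat v f || rsat v g
  end.

Definition peval v (g : rpoly) : R := \sum_(m <- g) m.1%:~R * \prod_(i <- m.2) v i.

Fixpoint ssat v (f : rsa) : bool :=
  match f with
  | SaAtom c g => cmp0 c (peval v g)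
  | SaNot f => ~~ ssat v f
  | SaAnd f g => ssat v f && ssat v g
  | SaOr f g => ssat v f || ssat v g
  end.

Definition vf (d : nat) (x : 'rV[R]_d) : nat -> R :=
  fun i => if insub i is Some j then x 0 j else 0.

Lemma vfE d (x : 'rV[R]_d) (i : 'I_d) : vf x i = x 0 i.
Proof. by rewrite /vf valK. Qed.

Lemma vf_row d v i : (i < d)%N -> vf (\row_(j < d) v j) i = v i.
Proof. by move=> h; rewrite /vf insubT mxE. Qed.

Fixpoint raw_term n (t : term n) : rterm :=
  match t with
  | TVar i => RVar i
  | TZero => RZero
  | TOne => ROne
  | TAdd a b => RAdd (raw_term a) (raw_term b)
  | TMul a b => RMul (raw_term a) (raw_term b)
  end.

Fixpoint raw_qf n (f : qf_formula n) : rqf :=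
  match f with
  | QAtom c t => RAtom c (raw_term t)
  | QAnd f g => RAnd (raw_qf f) (raw_qf g)
  | QOr f g => ROr (raw_qf f) (raw_qf g)
  end.

Definition raw_poly d (g : polynomial_expr d) : rpoly :=
  [seq (m.1, [seq nat_of_ord i | i <- m.2]) | m <- g].

Fixpoint raw_sa n (f : sa_formula n) : rsa :=
  match f with
  | SAtom c g => SaAtom c (raw_poly g)
  | SNot f => SaNot (raw_sa f)
  | SAnd f g => SaAnd (raw_sa f) (raw_sa g)
  | SOr f g => SaOr (raw_sa f) (raw_sa g)
  end.

Lemma enc_raw_term n (t : term n) : enc_term t = enct (raw_term t).
Proof. by elim: t => //= a -> b ->. Qed.

Lemma enc_raw_qf n (f : qf_formula n) : enc_qf f = encq (raw_qf f).
Proof. by elim: f => //= [c t|f -> g ->|f -> g ->] //; rewrite enc_raw_term. Qed.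

Lemma enc_raw_poly d (g : polynomial_expr d) : enc_poly g = encp (raw_poly g).
Proof.
rewrite /enc_poly /encp /raw_poly -map_comp; congr flatten; apply: eq_map => m /=.
by rewrite /encvs -map_comp.
Qed.

Lemma enc_raw_sa n (f : sa_formula n) : enc_sa f = encs (raw_sa f).
Proof. by elim: f => //= [c g|f ->|f -> g ->|f -> g ->] //; rewrite enc_raw_poly. Qed.

Lemma tbd_raw n (t : term n) : tbd n (raw_term t).
Proof. by elim: t => //= a -> b ->. Qed.

Lemma qbd_raw n (f : qf_formula n) : qbd n (raw_qf f).
Proof. by elim: f => //= [c t|f -> g ->|f -> g ->] //; exact: tbd_raw. Qed.

Lemma pbd_raw d (g : polynomial_expr d) : pbd d (raw_poly g).
Proof.
by rewrite /pbd all_map; apply/allP => m _ /=; rewrite all_map; apply/allP => i _ /=.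
Qed.

Lemma sbd_raw n (f : sa_formula n) : sbd n (raw_sa f).
Proof. by elim: f => //= [c g|f -> g ->|f -> g ->] //; exact: pbd_raw. Qed.

Lemma raw_term_ex n t : tbd n t -> exists t' : term n, raw_term t' = t.
Proof.
elim: t => /= [i h|_|_|a IHa b IHb|a IHa b IHb].
- by exists (TVar (Ordinal h)).
- by exists TZero.
- by exists TOne.
- by case/andP=> /IHa[a' <-] /IHb[b' <-]; exists (TAdd a' b').
- by case/andP=> /IHa[a' <-] /IHb[b' <-]; exists (TMul a' b').
Qed.

Lemma raw_qf_ex n f : qbd n f -> exists f' : qf_formula n, raw_qf f' = f.
Proof.
elim: f => /= [c t /raw_term_ex[t' <-]|a IHa b IHb|a IHa b IHb].
- by exists (QAtom c t').
- by case/andP=> /IHa[a' <-] /IHb[b' <-]; exists (QAnd a' b').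
- by case/andP=> /IHa[a' <-] /IHb[b' <-]; exists (QOr a' b').
Qed.

Lemma raw_poly_ex n g : pbd n g -> exists g' : polynomial_expr n, raw_poly g' = g.
Proof.
elim: g => /= [_|[z s] g IH /andP[/= hs /IH[g' <-]]]; first by exists [::].
suff [s' <-] : exists s' : seq 'I_n, [seq nat_of_ord i | i <- s'] = s.
  by exists ((z, s') :: g').
elim: s hs => /= [_|i s IHs /andP[hi /IHs[s' <-]]]; first by exists [::].
by exists (Ordinal hi :: s').
Qed.

Lemma raw_sa_ex n f : sbd n f -> exists f' : sa_formula n, raw_sa f' = f.
Proof.
elim: f => /= [c t /raw_poly_ex[t' <-]|a IHa /IHa[a' <-]|a IHa b IHb|a IHa b IHb].
- by exists (SAtom c t').
- by exists (SNot a').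
- by case/andP=> /IHa[a' <-] /IHb[b' <-]; exists (SAnd a' b').
- by case/andP=> /IHa[a' <-] /IHb[b' <-]; exists (SOr a' b').
Qed.

Lemma qf_sat_raw n (x : 'rV[R]_n) v (f : qf_formula n) :
  (forall i : 'I_n, v i = x 0 i) -> qf_sat x f = rsat v (raw_qf f).
Proof.
move=> h; have ht t : term_eval x t = teval v (raw_term t).
  by elim: t => //= a -> b ->.
by elim: f => //= [c t|f -> g ->|f -> g ->] //; rewrite ht.
Qed.

Lemma sa_sat_raw n (x : 'rV[R]_n) v (f : sa_formula n) :
  (forall i : 'I_n, v i = x 0 i) -> sa_sat x f = ssat v (raw_sa f).
Proof.
move=> h; have hp g : poly_eval x g = peval v (raw_poly g).
  rewrite /poly_eval /peval /raw_poly big_map; apply: eq_bigr => m _ /=.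
  by rewrite big_map; congr (_ * _); apply: eq_bigr => i _; rewrite h.
by elim: f => //= [c t|f ->|f -> g ->|f -> g ->] //; rewrite hp.
Qed.

Lemma ssat_ext v v' d f : sbd d f -> (forall i, (i < d)%N -> v i = v' i) ->
  ssat v f = ssat v' f.
Proof.
move=> + h; elim: f => /= [c g hg|f IH /IH -> //|f IHf g IHg|f IHf g IHg].
- congr cmp0; rewrite /peval big_seq [RHS]big_seq; apply: eq_bigr => m hm.
  congr (_ * _); rewrite big_seq [RHS]big_seq; apply: eq_bigr => i hi; apply: h.
  by move/allP: hg => /(_ _ hm) /allP /(_ _ hi).
- by case/andP=> /IHf -> /IHg ->.
- by case/andP=> /IHf -> /IHg ->.
Qed.

Lemma accepts_sentence (w : word) : accepts (p := true_universal_sentences R) w <->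
  exists n f, [/\ qbd n f, w = nseq n Kall ++ encq f & forall v, rsat v f].
Proof.
split=> [[n [f [-> hf]]]|[n [f [/raw_qf_ex[f' <-] -> hf]]]].
  exists n, (raw_qf f); split; first exact: qbd_raw.
    by rewrite /enc_sentence enc_raw_qf.
  move=> v; rewrite -(qf_sat_raw (x := \row_j v j)); first exact: hf.
  by move=> i; rewrite mxE.
exists n, f'; split; first by rewrite /enc_sentence enc_raw_qf.
by move=> x; rewrite (qf_sat_raw (v := vf x)) // => i; rewrite vfE.
Qed.

Definition enc_instance (d : nat) (f : rsa) (p : int) (q : nat) : word :=
  nseq d Ktick ++ enc_int p ++ Kslash :: enc_nat q ++ encs f.

Lemma accepts_radius (w : word) : accepts (p := radius_problem R) w <->
  exists d f p q, [/\ sbd d f, (0 < q)%N, w = enc_instance d f p q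
    & radius_at_most [set x : 'rV[R]_d | ssat (vf x) f]%classic (ratr (p%:Q / q%:Q))].
Proof.
have E n (f : sa_formula n) : sa_set R f = [set x : 'rV[R]_n | ssat (vf x) (raw_sa f)]%classic.
  by apply: funext => x; rewrite /sa_set /= (sa_sat_raw (v := vf x)) // => i; rewrite vfE.
split=> [[d [f [p [q [hq -> hr]]]]]|[d [f [p [q [/raw_sa_ex[f' <-] hq -> hr]]]]]].
  exists d, (raw_sa f), p, q; split=> //; first exact: sbd_raw.
    by rewrite /enc_radius_instance enc_raw_sa.
  by rewrite -E.
exists d, f', p, q; split=> //; first by rewrite /enc_radius_instance enc_raw_sa.
by rewrite E.
Qed.

End Semantics.

(** * Unique readability of the encodings *)

Definition isdig (a : token) : bool := (a == Kzero) || (a == Kone).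
Definition istick (a : token) : bool := a == Ktick.
Definition isfor (a : token) : bool :=
  a \in [:: Kand; Kor; Knot; Klt; Kle; Keq; Kge; Kgt].

Lemma lead_cat P s r : all P s -> lead P (s ++ r) = s ++ lead P r.
Proof. by elim: s => //= a s IH /andP[-> /IH ->]. Qed.

Lemma after_cat P s r : all P s -> after P (s ++ r) = after P r.
Proof. by elim: s => //= a s IH /andP[-> /IH ->]. Qed.

Lemma lead_stop P r : hd_test (fun a => ~~ P a) true r -> lead P r = [::].
Proof. by case: r => //= a r /negbTE ->. Qed.

Lemma after_stop P r : hd_test (fun a => ~~ P a) true r -> after P r = r.
Proof. by case: r => //= a r /negbTE ->. Qed.

Lemma split_inj P s s' r r' : all P s -> all P s' ->
  hd_test (fun a => ~~ P a) true r -> hd_test (fun a => ~~ P a) true r' ->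
  s ++ r = s' ++ r' -> s = s' /\ r = r'.
Proof.
move=> hs hs' hr hr' E; split.
  by have := congr1 (lead P) E; rewrite !lead_cat // !lead_stop // !cats0.
by have := congr1 (after P) E; rewrite !after_cat // !after_stop.
Qed.

Definition bit (b : bool) : token := if b then Kone else Kzero.
Definition bval (s : word) : nat := foldl (fun x a => x.*2 + (a == Kone)) 0 s.

Lemma bval_rcons s a : bval (rcons s a) = (bval s).*2 + (a == Kone).
Proof. by rewrite /bval foldl_rcons. Qed.

Lemma enc_nat_double m (b : bool) : 0 < m ->
  enc_nat (m.*2 + b) = rcons (enc_nat m) (bit b).
Proof.
move=> m0; have hn : 1 < m.*2 + b by lia.
have h2 : (m.*2 + b)./2 = m by rewrite halfD doubleK odd_double; case: b {hn} => /=; lia.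
rewrite /enc_nat (trunc_log2S hn) h2 -rev_cons; congr rev.
have mkseqS (F : nat -> token) n : mkseq F n.+1 = F 0 :: mkseq (fun i => F i.+1) n.
  by rewrite /mkseq -[iota 0 n.+1]/(0 :: iota 1 n) (iotaDl 1 0) /= -map_comp.
rewrite mkseqS; congr cons.
  by rewrite expn0 divn1 oddD odd_double; case: b {hn h2}.
by apply: eq_map => i /=; rewrite expnS divnMA divn2 h2.
Qed.

Lemma enc_natK m : bval (enc_nat m) = m.
Proof.
have [n] := ubnP m; elim: n m => // n IH [|[|m]] // hm.
have -> : m.+2 = (m.+2)./2.*2 + odd m.+2 :> nat by rewrite addnC odd_double_half.
rewrite enc_nat_double ?bval_rcons ?IH //; last by lia.
by case: (odd m.+2).
Qed.

Lemma enc_nat_dig m : all isdig (enc_nat m).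
Proof.
rewrite /enc_nat all_rev; apply/allP => a /mapP[i _ ->]; by case: odd.
Qed.

Lemma enc_nat_cons m : exists a s, enc_nat m = a :: s /\ isdig a.
Proof.
have := enc_nat_dig m; have : size (enc_nat m) = (trunc_log 2 m).+1.
  by rewrite /enc_nat size_rev size_mkseq.
by case: (enc_nat m) => //= a s _ /andP[ha _]; exists a, s.
Qed.

Lemma bval_gt0 s : 0 < bval (Kone :: s).
Proof.
elim/last_ind: s => // s a IH; rewrite -rcons_cons bval_rcons; lia.
Qed.

(** The instance parser accepts as numerals only words with leading [Kone], or a lone [Kzero] where
    zero is allowed; this lemma supplies the number behind the former. *)
Lemma enc_nat_bval s : all isdig s -> enc_nat (bval (Kone :: s)) = Kone :: s.
Proof.
elim/last_ind: s => // s a IH; rewrite all_rcons => /andP[ha /IH h].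
rewrite -rcons_cons bval_rcons enc_nat_double ?bval_gt0 // h.
by congr rcons; case: a ha.
Qed.

Lemma enc_nat_head m : 0 < m -> exists s, enc_nat m = Kone :: s.
Proof.
have [n] := ubnP m; elim: n m => // n IH [|[|m]] // hm _; first by exists [::].
have -> : m.+2 = (m.+2)./2.*2 + odd m.+2 :> nat by rewrite addnC odd_double_half.
rewrite enc_nat_double //; have [||s ->] := IH (m.+2)./2; [by lia|by []|].
by exists (rcons s (bit (odd m.+2))).
Qed.

Lemma enc_int_inj z z' r r' :
  hd_test (fun a => ~~ isdig a) true r -> hd_test (fun a => ~~ isdig a) true r' ->
  enc_int z ++ r = enc_int z' ++ r' -> z = z' /\ r = r'.
Proof.
move=> hr hr'.
have nat_inj m m' : enc_nat m ++ r = enc_nat m' ++ r' -> m = m' /\ r = r'.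
  move=> /(split_inj (enc_nat_dig _) (enc_nat_dig _) hr hr')[E ->].
  by split=> //; rewrite -(enc_natK m) E enc_natK.
have nd m (r1 r2 : word) : Kminus :: r1 <> enc_nat m ++ r2.
  have [a [x [-> ]]] := enc_nat_cons m.
  by case: a.
rewrite /enc_int; case: ifP => hz; case: ifP => hz' /=.
- by case=> /nat_inj[h ->]; split=> //; lia.
- by move/nd.
- by move/esym/nd.
- by move=> /nat_inj[h ->]; split=> //; lia.
Qed.

Lemma encvs_inj s s' r r' :
  hd_test (fun a => ~~ (istick a || (a == Kvar))) true r ->
  hd_test (fun a => ~~ (istick a || (a == Kvar))) true r' ->
  encvs s ++ r = encvs s' ++ r' -> s = s' /\ r = r'.
Proof.
move=> hr hr'; elim: s s' => [|i s IH] [|i' s'] //=.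
- by move=> E; move: hr; rewrite /= E.
- by move=> E; move: hr'; rewrite /= -E.
have ht x y : hd_test (fun a => ~~ (istick a || (a == Kvar))) true y ->
    hd_test (fun a => ~~ istick a) true (encvs x ++ y).
  by case: x => //=; case: y => //= -[].
have hn j : all istick (nseq j Ktick) by rewrite all_nseq orbT.
case; rewrite -!catA => /(split_inj (hn _) (hn _) (ht _ _ hr) (ht _ _ hr'))[Ei].
move=> /IH[-> ->]; split=> //; congr cons.
by have := congr1 size Ei; rewrite !size_nseq.
Qed.

(** What may follow a polynomial. Polynomials have no closing symbol, so their unique readability
    rests on this condition. *)
Definition ends (r : word) : bool := hd_test isfor true r.

Lemma encp_stop g r : ends r ->
  hd_test (fun a => isfor a || (a == Kplus)) true (encp g ++ r).
Proof. by case: g => //=; case: r => //= a r ->. Qed.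

Lemma encp_inj g g' r r' : ends r -> ends r' ->
  encp g ++ r = encp g' ++ r' -> g = g' /\ r = r'.
Proof.
move=> hr hr'; elim: g g' => [|[z s] g IH] [|[z' s'] g'] //=.
- by move=> E; move: hr; rewrite /= E.
- by move=> E; move: hr'; rewrite /= -E.
have h1 y : hd_test (fun a => isfor a || (a == Kplus)) true y ->
    hd_test (fun a => ~~ (istick a || (a == Kvar))) true y.
  by case: y => //= -[].
have h2 x y : hd_test (fun a => isfor a || (a == Kplus)) true y ->
    hd_test (fun a => ~~ isdig a) true (encvs x ++ y).
  by case: x => //=; case: y => //= -[].
case; rewrite -!catA => /(enc_int_inj (h2 _ _ (encp_stop _ hr)) (h2 _ _ (encp_stop _ hr')))[->].
move=> /(encvs_inj (h1 _ (encp_stop _ hr)) (h1 _ (encp_stop _ hr')))[->].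
by move=> /IH[-> ->].
Qed.

Lemma enc_cmp_for c : isfor (enc_cmp c).
Proof. by case: c. Qed.

Lemma encs_ends f r : ends (encs f ++ r).
Proof. by case: f => //= c g; rewrite /ends /= enc_cmp_for. Qed.

Lemma enc_cmp_inj : injective enc_cmp.
Proof. by move=> [] []. Qed.

Lemma encs_inj f f' r r' : ends r -> ends r' ->
  encs f ++ r = encs f' ++ r' -> f = f' /\ r = r'.
Proof.
elim: f f' r r' => [c g|f IH|f IHf g IHg|f IHf g IHg] [c' g'|f'|f' g'|f' g'] r r' hr hr' /= E;
  try by [case: c E|case: c' E|discriminate E].
- by case: E => /enc_cmp_inj -> /(encp_inj hr hr')[-> ->].
- by case: E => /(IH _ _ _ hr hr')[-> ->].
- case: E; rewrite -!catA => /(IHf _ _ _ (encs_ends _ _) (encs_ends _ _))[->].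
  by move=> /(IHg _ _ _ hr hr')[-> ->].
- case: E; rewrite -!catA => /(IHf _ _ _ (encs_ends _ _) (encs_ends _ _))[->].
  by move=> /(IHg _ _ _ hr hr')[-> ->].
Qed.

(** Acceptance asks only for some decoding of the word, so the hardness reduction has to know that
    its output has no second one. *)
Lemma enc_instance_inj d f p q d' f' p' q' :
  enc_instance d f p q = enc_instance d' f' p' q' ->
  [/\ d = d', f = f', p = p' & q = q'].
Proof.
rewrite /enc_instance.
have hn j : all istick (nseq j Ktick) by rewrite all_nseq orbT.
have hi z r : hd_test (fun a => ~~ istick a) true (enc_int z ++ r).
  have [a [x [E ha]]] := enc_nat_cons `|z|.
  by rewrite /enc_int; case: ifP => // _; rewrite E /=; case: (a) ha.
move=> /(split_inj (hn _) (hn _) (hi _ _) (hi _ _))[Ed].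
move=> /(enc_int_inj (r := Kslash :: _) (r' := Kslash :: _) isT isT)[-> []].
have hs g : hd_test (fun a => ~~ isdig a) true (encs g).
  by have := encs_ends g [::]; rewrite cats0; case: (encs g) => //= -[].
move=> /(split_inj (enc_nat_dig _) (enc_nat_dig _) (hs _) (hs _))[Eq Ef].
split=> //.
- by have := congr1 size Ed; rewrite !size_nseq.
- by have [] := @encs_inj f f' [::] [::] isT isT; rewrite ?cats0.
- by rewrite -(enc_natK q) Eq enc_natK.
Qed.

Lemma enct_nontick t r : hd_test (fun a => ~~ istick a) true (enct t ++ r).
Proof. by case: t. Qed.

Lemma enct_inj t t' r r' : hd_test (fun a => ~~ istick a) true r ->
  hd_test (fun a => ~~ istick a) true r' ->
  enct t ++ r = enct t' ++ r' -> t = t' /\ r = r'.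
Proof.
have hn j : all istick (nseq j Ktick) by rewrite all_nseq orbT.
elim: t t' r r' => [i|||a IHa b IHb|a IHa b IHb] [i'|||a' b'|a' b'] r r' hr hr' //= [E] //.
- have [Ei ->] := split_inj (hn _) (hn _) hr hr' E; split=> //; congr RVar.
  by have := congr1 size Ei; rewrite !size_nseq.
- move: E; rewrite -!catA => /(IHa _ _ _ (enct_nontick _ _) (enct_nontick _ _))[->].
  by move=> /(IHb _ _ _ hr hr')[-> ->].
- move: E; rewrite -!catA => /(IHa _ _ _ (enct_nontick _ _) (enct_nontick _ _))[->].
  by move=> /(IHb _ _ _ hr hr')[-> ->].
Qed.

Lemma encq_nontick f r : hd_test (fun a => ~~ istick a) true (encq f ++ r).
Proof. by case: f => // -[]. Qed.

Lemma encq_inj f f' r r' : hd_test (fun a => ~~ istick a) true r ->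
  hd_test (fun a => ~~ istick a) true r' ->
  encq f ++ r = encq f' ++ r' -> f = f' /\ r = r'.
Proof.
elim: f f' r r' => [c t|a IHa b IHb|a IHa b IHb] [c' t'|a' b'|a' b'] r r' hr hr' /= E;
  try by [case: c E|case: c' E|discriminate E].
- by case: E => /enc_cmp_inj -> /(enct_inj hr hr')[-> ->].
- move: E => [] ; rewrite -!catA => /(IHa _ _ _ (encq_nontick _ _) (encq_nontick _ _))[->].
  by move=> /(IHb _ _ _ hr hr')[-> ->].
- move: E => [] ; rewrite -!catA => /(IHa _ _ _ (encq_nontick _ _) (encq_nontick _ _))[->].
  by move=> /(IHb _ _ _ hr hr')[-> ->].
Qed.

Lemma sentence_inj n f n' f' :
  nseq n Kall ++ encq f = nseq n' Kall ++ encq f' -> n = n' /\ f = f'.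
Proof.
have hn j : all (pred1 Kall) (nseq j Kall) by rewrite all_nseq orbT.
have hs g : hd_test (fun a => ~~ pred1 Kall a) true (encq g) by case: g => // -[].
move=> /(split_inj (hn _) (hn _) (hs _) (hs _))[E Ef]; split.
  by have := congr1 size E; rewrite !size_nseq.
by have [] := @encq_inj f f' [::] [::] isT isT; rewrite ?cats0.
Qed.

(** * Reduction of universal sentences to the radius problem *)

(** The parsers do not compare the lengths of variables with the number of quantifiers or with the
    dimension; this is tested separately on the word. *)
Fixpoint vars_lt (N : nat) (w : word) : bool :=
  if w is a :: v then
    ((a == Kvar) ==> (size (lead istick v) < N)) && vars_lt N v
  else true.

Lemma fpb_vars_lt m f g : fp m f -> fp m g ->
  fpb m (fun e => vars_lt (size (f e)) (g e)).
Proof.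
move=> hf hg.
have H : fp m (fun e => flatx (fun a u v =>
    if (a == Kvar) ==> (size (lead istick v) < size (f e)) then [::] else [:: Kone]) [::] (g e)).
  apply: (fp_flatx (F := fun e a u v =>
    if (a == Kvar) ==> (size (lead istick v) < size (f e)) then [::] else [:: Kone])) hg _ => a.
  apply: fp_if; try exact: fp_const.
  case: (a == Kvar); last exact: fpb_cst.
  by apply: fpb_ltn; [apply: fp_lead; exact: fp_arg|exact: (fp_drop 2 hf)].
apply: fp_ext (fpb_nil H) => e _; congr (if _ then _ else _).
set G := fun a u v => _.
suff H2 v u : vars_lt (size (f e)) v = (flatx G u v == [::]) by exact: H2.
elim: v u => //= a v IH u; rewrite (IH (a :: u)) /G.
by case: (_ ==> _).
Qed.

Definition nontick (r : word) : bool := hd_test (fun a => ~~ istick a) true r.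

Lemma vars_lt_ticks N i r : vars_lt N (nseq i Ktick ++ r) = vars_lt N r.
Proof. by elim: i. Qed.

Lemma lead_ticks i r : nontick r -> lead istick (nseq i Ktick ++ r) = nseq i Ktick.
Proof. by move=> h; rewrite lead_cat ?all_nseq ?orbT // lead_stop // cats0. Qed.

Lemma vars_lt_term N t r : nontick r -> vars_lt N (enct t ++ r) = tbd N t && vars_lt N r.
Proof.
elim: t r => //= [i|a IHa b IHb|a IHa b IHb] r hr.
- by rewrite lead_ticks // size_nseq vars_lt_ticks.
- by rewrite -catA IHa ?IHb ?andbA //; exact: enct_nontick.
- by rewrite -catA IHa ?IHb ?andbA //; exact: enct_nontick.
Qed.

Lemma vars_lt_qf N f r : nontick r -> vars_lt N (encq f ++ r) = qbd N f && vars_lt N r.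
Proof.
elim: f r => //= [c t|a IHa b IHb|a IHa b IHb] r hr.
- by rewrite vars_lt_term //; case: c.
- by rewrite -catA IHa ?IHb ?andbA //; exact: encq_nontick.
- by rewrite -catA IHa ?IHb ?andbA //; exact: encq_nontick.
Qed.

(* Predictive parsing of sentences.  Stack symbols: [Kall] prefix of
   quantifiers, [Kand] formula, [Kplus] term, [Kone] an item has just been
   completed, [Kvar] likewise but ticks may follow, [Kslash] error. *)
Definition snt (b a : token) : word :=
  match b, a with
  | Kand, (Kand | Kor) => [:: Kand; Kand]
  | Kand, (Klt | Kle | Keq | Kge | Kgt) => [:: Kplus]
  | Kplus, (Kplus | Ktimes) => [:: Kplus; Kplus]
  | Kplus, (Kzero | Kone) => [:: Kone]
  | Kplus, Kvar => [:: Kvar]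
  | _, _ => [:: Kslash]
  end.

Definition sstep (a : token) (st : word) : word :=
  match st with
  | [::] => [::]
  | b :: s => match s with
    | [::] => match b with
       | Kall => if a == Kall then [:: Kall] else snt Kand a
       | Kand | Kplus => snt b a
       | Kvar => if istick a then [:: Kvar] else [:: Kslash]
       | _ => [:: Kslash] end
    | c :: s' => match b with
       | Kand | Kplus => snt b a ++ [:: c]
       | Kone => snt c a
       | Kvar => if istick a then [:: Kvar; c] else snt c a
       | _ => [:: Kslash; c] end ++ s'
    end
  end.

Lemma slow_sstep : slow sstep.
Proof. exact: slow_table. Qed.

Definition srun (st w : word) : word := foldl (fun acc a => sstep a acc) st w.

Definition sfin (st : word) : bool := (st == [:: Kone]) || (st == [:: Kvar]).

Lemma fpb_sfin m f : fp m f -> fpb m (fun e => sfin (f e)).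
Proof.
move=> hf; pose F (b : token) (e : seq word) :=
  if (b == Kone) || (b == Kvar) then if arg e 0 == [::] then [:: Kone] else [::] else [::] : word.
have := @fp_case m f (fun=> [::]) F hf (fp_nil m) _.
move=> H; apply: fp_ext (H _) => [e _|b].
  case: (f e) => [|b s] //=; rewrite /F /sfin !eqseq_cons -andb_orl /=.
  by case: (_ || _).
rewrite /F; case: (_ || _); last exact: fp_nil.
by apply: fpb_nil; exact: fp_arg.
Qed.

(** The marker of a completed item stays until the next token arrives, since only that token shows
    whether a variable continues. From then on the pending item below decides. *)
Lemma sstep_next X c s a : (X == Kone) || (X == Kvar) -> (c == Kand) || (c == Kplus) ->
  ~~ istick a -> sstep a (X :: c :: s) = sstep a (c :: s).
Proof.
move=> hX hc ha.
have -> : sstep a [:: X, c & s] = snt c a ++ s.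
  by case: X hX => //= _; rewrite ?(negbTE ha).
by case: s => [|d s] /=; case: c hc => //= _; rewrite ?cats0 -?catA.
Qed.

Lemma sstep_nt c s a : (c == Kand) || (c == Kplus) -> sstep a (c :: s) = snt c a ++ s.
Proof. by case: s => [|d s] /=; case: c => //= _; rewrite ?cats0 -?catA. Qed.

Lemma srun_cons st a w : srun st (a :: w) = srun (sstep a st) w.
Proof. by []. Qed.

Lemma srun_cat st u v : srun st (u ++ v) = srun (srun st u) v.
Proof. by rewrite /srun foldl_cat. Qed.

Lemma srun_ticks s i : srun (Kvar :: s) (nseq i Ktick) = Kvar :: s.
Proof. by elim: i => //= i; rewrite /srun /=; case: s. Qed.

Lemma srun_next X c s r : (X == Kone) || (X == Kvar) -> (c == Kand) || (c == Kplus) ->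
  r != [::] -> nontick r -> srun (X :: c :: s) r = srun (c :: s) r.
Proof. by case: r => // a r hX hc _ ha; rewrite !srun_cons sstep_next. Qed.

Lemma enct_nil t r : enct t ++ r != [::]. Proof. by case: t. Qed.
Lemma encq_nil t r : encq t ++ r != [::]. Proof. by case: t. Qed.

Lemma srun_term t : exists2 X, (X == Kone) || (X == Kvar) &
  forall s, srun (Kplus :: s) (enct t) = X :: s.
Proof.
elim: t => [i|||a [X hX IHa] b [Y hY IHb]|a [X hX IHa] b [Y hY IHb]].
- by exists Kvar => // s; rewrite srun_cons sstep_nt //= srun_ticks.
- by exists Kone => // s; rewrite srun_cons sstep_nt.
- by exists Kone => // s; rewrite srun_cons sstep_nt.
- exists Y => // s; rewrite [enct _]/= srun_cons sstep_nt //=.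
  rewrite srun_cat IHa srun_next ?IHb //; have := enct_nil b [::]; have := enct_nontick b [::];
  by rewrite cats0.
- exists Y => // s; rewrite [enct _]/= srun_cons sstep_nt //=.
  rewrite srun_cat IHa srun_next ?IHb //; have := enct_nil b [::]; have := enct_nontick b [::];
  by rewrite cats0.
Qed.

Lemma srun_qf f : exists2 X, (X == Kone) || (X == Kvar) &
  forall s, srun (Kand :: s) (encq f) = X :: s.
Proof.
elim: f => [c t|a [X hX IHa] b [Y hY IHb]|a [X hX IHa] b [Y hY IHb]].
- have [X hX IH] := srun_term t; exists X => // s.
  rewrite [encq _]/= srun_cons sstep_nt // -IH.
  by case: c.
- exists Y => // s; rewrite [encq _]/= srun_cons sstep_nt //=.
  rewrite srun_cat IHa srun_next ?IHb //; have := encq_nil b [::]; have := encq_nontick b [::];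
  by rewrite cats0.
- exists Y => // s; rewrite [encq _]/= srun_cons sstep_nt //=.
  rewrite srun_cat IHa srun_next ?IHb //; have := encq_nil b [::]; have := encq_nontick b [::];
  by rewrite cats0.
Qed.

Lemma srun_sentence n f : sfin (srun [:: Kall] (nseq n Kall ++ encq f)).
Proof.
have -> : srun [:: Kall] (nseq n Kall ++ encq f) = srun [:: Kall] (encq f).
  by elim: n.
have -> : srun [:: Kall] (encq f) = srun [:: Kand] (encq f).
  by case: f => [[]||].
by have [X hX ->] := srun_qf f; case/orP: hX => /eqP ->.
Qed.

(** The language that a stack of pending items still expects. *)
Fixpoint derives (s w : word) : Prop :=
  match s with
  | [::] => w = [::]
  | Kand :: s => exists f w', w = encq f ++ w' /\ derives s w'
  | Kplus :: s => exists t w', w = enct t ++ w' /\ derives s w'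
  | _ => False
  end.

Lemma srun_error s w : srun (Kslash :: s) w = Kslash :: s.
Proof. by elim: w => //= a w; rewrite /srun /=; case: s. Qed.

(** One induction on the word treats the kinds of stack top together, because they pass into one
    another. Errors are excluded since the symbol [Kslash] on top is never removed. *)
Lemma srun_derives w :
  [/\ forall b s, (b == Kand) || (b == Kplus) -> sfin (srun (b :: s) w) ->
        derives (b :: s) w,
      forall s, sfin (srun (Kone :: s) w) -> derives s w
    & forall s, sfin (srun (Kvar :: s) w) ->
        exists i w', w = nseq i Ktick ++ w' /\ derives s w'].
Proof.
have err (s w' : word) : sfin (srun (Kslash :: s) w') -> False by rewrite srun_error.
have fin1 X s : sfin (X :: s) -> s = [::] by rewrite /sfin !eqseq_cons -andb_orl => /andP[_ /eqP].
elim: w => [|a w [IH1 IH2 IH3]].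
  split=> [b s|s|s]; rewrite [srun _ _]/=.
  - by move=> + /orP[] /eqP[E _]; rewrite E.
  - by move/fin1 ->.
  - by move/fin1 ->; exists 0, [::].
have H1 b s : (b == Kand) || (b == Kplus) -> sfin (srun (b :: s) (a :: w)) -> derives (b :: s) (a :: w).
  move=> hb; rewrite srun_cons sstep_nt //.
  case/orP: hb => /eqP -> /=.
    have atom c : enc_cmp c = a -> sfin (srun (Kplus :: s) w) ->
        exists f w', a :: w = encq f ++ w' /\ derives s w'.
      move=> <- /(IH1 Kplus _ isT)[t [w' [-> h]]].
      by exists (RAtom c t), w'.
    have two : sfin (srun [:: Kand, Kand & s] w) -> exists f g w', w = encq f ++ encq g ++ w' /\ derives s w'.
      by move/(IH1 Kand _ isT) => [f [w' [-> [g [w'' [-> h]]]]]]; exists f, g, w''.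
    case: (a) (atom) => //= at_; try by move/err.
    - by move/two => [f [g [w' [-> h]]]]; exists (RAnd f g), w'; rewrite /= catA.
    - by move/two => [f [g [w' [-> h]]]]; exists (ROr f g), w'; rewrite /= catA.
    - exact: (at_ Clt).
    - exact: (at_ Cle).
    - exact: (at_ Ceq).
    - exact: (at_ Cge).
    - exact: (at_ Cgt).
  have two : sfin (srun [:: Kplus, Kplus & s] w) -> exists f g w', w = enct f ++ enct g ++ w' /\ derives s w'.
    by move/(IH1 Kplus _ isT) => [f [w' [-> [g [w'' [-> h]]]]]]; exists f, g, w''.
  case: (a) => //=; try by move/err.
  - by move/IH3 => [i [w' [-> h]]]; exists (RVar i), w'.
  - by move/IH2 => h; exists RZero, w.
  - by move/IH2 => h; exists ROne, w.
  - by move/two => [f [g [w' [-> h]]]]; exists (RAdd f g), w'; rewrite /= catA.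
  - by move/two => [f [g [w' [-> h]]]]; exists (RMul f g), w'; rewrite /= catA.
have nextP X c s : (X == Kone) || (X == Kvar) -> ~~ istick a || (X == Kone) ->
    sfin (srun [:: X, c & s] (a :: w)) -> derives (c :: s) (a :: w).
  move=> hX ha; rewrite srun_cons.
  have -> : sstep a [:: X, c & s] = snt c a ++ s.
    by case: X hX ha => //= _; rewrite ?orbF // => /negbTE ->.
  have [hc|hc] := boolP ((c == Kand) || (c == Kplus)).
    by move=> h; apply: H1 => //; rewrite srun_cons sstep_nt.
  suff -> : snt c a = [:: Kslash] by move/err.
  by case: c hc.
split=> // [[|c s]|[|c s]].
- by rewrite srun_cons => /err.
- by apply: nextP; rewrite ?orbT.
- rewrite srun_cons /=; case: ifP => [/eqP ->|_ /err //].
  by move=> /IH3[i [w' [-> h]]]; exists i.+1, w'.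
- have [/eqP ->|ha] := boolP (istick a).
    by rewrite srun_cons => /IH3[i [w' [-> h]]]; exists i.+1, w'.
  by move/nextP => h; exists 0, (a :: w); split=> //; apply: h; rewrite ?ha.
Qed.

Lemma sentence_sound w : sfin (srun [:: Kall] w) ->
  exists n f, w = nseq n Kall ++ encq f.
Proof.
elim: w => [|a w IH] //; rewrite srun_cons /=.
case: eqP => [-> /IH[n [f ->]]|ha]; first by exists n.+1, f.
move=> h; have [H _ _] := srun_derives (a :: w).
have {}h : sfin (srun [:: Kand] (a :: w)) by rewrite srun_cons sstep_nt // cats0.
by have [f [w' [-> ->]]] := H Kand [::] isT h; exists 0, f; rewrite cats0.
Qed.

Definition ticks (w : word) : word := rep [:: Ktick] w.

Lemma ticksE w : ticks w = nseq (size w) Ktick.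
Proof. by rewrite /ticks /rep; elim: w => //= a w ->. Qed.

(** The stack is a lone completed marker only when the term is over, and the test for ticks waits
    until its last variable is over too. So exactly one position emits, and its prefix [u] is the
    term; the token read there then causes an error for the rest of the word. *)
Definition item_emit (a : token) (st u v : word) : word :=
  if sfin st && ~~ istick a then ticks u else [::].

(* The length, in unary, of the term at the beginning of the word. *)
Definition item_len (w : word) : word := transd sstep item_emit [:: Kplus] [::] w.

Lemma fp_item_len m f : fp m f -> fp m (fun e => item_len (f e)).
Proof.
move=> hf; apply: (fp_transd (emit := fun _ => item_emit)) hf _; first exact: slow_sstep.
move=> a; apply: fp_if; last exact: fp_nil.
  by apply: fpb_and; [apply: fpb_sfin; exact: fp_arg|exact: fpb_cst].
by apply: fp_rep; [exact: fp_const|exact: fp_arg].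
Qed.

Lemma transd_cons step emit st u a v : transd step emit st u (a :: v)
  = emit a st u v ++ transd step emit (step a st) (a :: u) v.
Proof. by []. Qed.

Lemma item_next X c s u r : (X == Kone) || (X == Kvar) -> (c == Kand) || (c == Kplus) ->
  r != [::] -> nontick r ->
  transd sstep item_emit (X :: c :: s) u r = transd sstep item_emit (c :: s) u r.
Proof.
case: r => // a r hX hc _ ha; rewrite !transd_cons sstep_next //; congr (_ ++ _).
rewrite /item_emit; suff -> : sfin [:: X, c & s] = false; first suff -> : sfin (c :: s) = false by [].
  by case: c hc.
by rewrite /sfin !eqseq_cons !andbF.
Qed.

Lemma item_term t : exists2 X, (X == Kone) || (X == Kvar) &
  forall s u r, transd sstep item_emit (Kplus :: s) u (enct t ++ r)
    = transd sstep item_emit (X :: s) (rev (enct t) ++ u) r.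
Proof.
have h0 s u a r : transd sstep item_emit (Kplus :: s) u (a :: r)
    = transd sstep item_emit (snt Kplus a ++ s) (a :: u) r.
  by rewrite transd_cons sstep_nt.
elim: t => [i|||a [X hX IHa] b [Y hY IHb]|a [X hX IHa] b [Y hY IHb]].
- exists Kvar => // s u r; rewrite [enct _ ++ r]/= h0 [snt _ _ ++ s]/=.
  rewrite [enct _]/= /encv rev_cons cat_rcons.
  elim: i (Kvar :: u) => // i IH {}u; rewrite [_ ++ r]/= rev_cons cat_rcons -IH.
  by case: s {IH}.
- by exists Kone => // s u r; rewrite [enct _ ++ r]/= h0.
- by exists Kone => // s u r; rewrite [enct _ ++ r]/= h0.
- exists Y => // s u r; rewrite [enct _ ++ r]/= h0 -catA [snt _ _ ++ s]/= IHa item_next ?IHb //;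
    [|exact: enct_nil|exact: enct_nontick].
  by rewrite [enct _]/= rev_cons cat_rcons rev_cat catA.
- exists Y => // s u r; rewrite [enct _ ++ r]/= h0 -catA [snt _ _ ++ s]/= IHa item_next ?IHb //;
    [|exact: enct_nil|exact: enct_nontick].
  by rewrite [enct _]/= rev_cons cat_rcons rev_cat catA.
Qed.

(** The emission takes place at the token behind the term, hence the nonempty [r]. A first argument
    is always followed by a second one. *)
Lemma item_lenE t r : r != [::] -> nontick r -> item_len (enct t ++ r) = nseq (size (enct t)) Ktick.
Proof.
move=> hr ha; rewrite /item_len; have [X hX ->] := item_term t.
case: r hr ha => // a r _ ha; rewrite cats0.
have err s u w : transd sstep item_emit (Kslash :: s) u w = [::].
  by elim: w u => //= b w IH u; case: s IH => [|c s] IH; rewrite IH.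
have -> : transd sstep item_emit [:: X] (rev (enct t)) (a :: r)
    = ticks (rev (enct t)) ++ transd sstep item_emit [:: Kslash] (a :: rev (enct t)) r.
  have e1 : sstep a [:: X] = [:: Kslash] by case/orP: hX => /eqP -> //=; rewrite (negbTE (ha : ~~ istick a)).
  rewrite transd_cons e1 {1}/item_emit (ha : ~~ istick a).
  by have -> : sfin [:: X] by case/orP: hX => /eqP ->.
by rewrite err cats0 ticksE size_rev.
Qed.

Definition xvar (u : word) : word := Kvar :: ticks u.
Definition neg1 : word := [:: Kplus; Kminus; Kone].

Definition eq_head (u : word) : word := [:: Kand; Keq; Kplus; Kone] ++ xvar u.

(* The variable of a token position holds the value of the subterm that starts
   there; quantifier positions thereby serve as the original variables. *)
Definition eq_emit (a : token) (u v : word) : word :=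
  match a with
  | Kvar => eq_head u ++ neg1 ++ Kvar :: lead istick v
  | Kzero => eq_head u
  | Kone => eq_head u ++ neg1
  | Kplus => eq_head u ++ neg1 ++ xvar (a :: u) ++ neg1 ++ xvar (a :: u) ++ item_len v
  | Ktimes => eq_head u ++ neg1 ++ xvar (a :: u) ++ xvar (a :: u) ++ item_len v
  | _ => [::]
  end.

Definition atom_emit (a : token) (u v : word) : word :=
  match a with
  | Kand | Kor => [:: a]
  | Klt | Kle | Keq | Kge | Kgt => [:: a; Kplus; Kone] ++ xvar (a :: u)
  | _ => [::]
  end.

(** There is one variable per token, so the dimension is the length of [w]; the radius is written
    [-1 / 1]. Each equation opens a conjunction in prefix form, and the negated matrix closes the
    last one. *)
Definition hardness_body (w : word) : word :=
  ticks w ++ [:: Kminus; Kone; Kslash; Kone] ++ flatx eq_emit [::] w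
  ++ Knot :: flatx atom_emit [::] w.

Definition hardness_map (w : word) : word :=
  if sfin (srun [:: Kall] w) && vars_lt (size (lead (pred1 Kall) w)) w
  then hardness_body w else [::].

Lemma fp_ticks m f : fp m f -> fp m (fun e => ticks (f e)).
Proof. by move=> hf; apply: fp_rep; [exact: fp_const|]. Qed.

Lemma fp_xvar m f : fp m f -> fp m (fun e => xvar (f e)).
Proof. by move=> hf; apply: fp_cons; apply: fp_ticks. Qed.

Ltac fpt := repeat first
  [ exact: fp_nil | by apply: (@fp_arg _ 0) | exact: fp_arg | exact: fp_const | apply: fp_xvar | apply: fp_ticks
  | apply: fp_lead | apply: fp_item_len | apply: fp_cons | apply: fp_cat ].

Lemma fp_hardness_map : fp1 hardness_map.
Proof.
have w0 : fp 1 (fun e => arg e 0) by apply: fp_arg.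
apply: fp_if; last exact: fp_nil.
  apply: fpb_and; last by apply: fpb_vars_lt => //; apply: fp_lead.
  apply: fpb_sfin; apply: fp_foldl w0 _; [exact: slow_sstep|exact: fp_const].
rewrite /hardness_body; apply: fp_cat; first by fpt.
apply: fp_cat; first by fpt.
apply: fp_cat; first by apply: fp_flatx w0 _ => -[]; rewrite /eq_emit /eq_head /neg1; fpt.
apply: fp_cons; by apply: fp_flatx w0 _ => -[]; rewrite /atom_emit; fpt.
Qed.

(** Tseitin's equations for the term whose code starts at position [j]: the first argument starts at
    [j.+1], the second at [k], behind the code of the first. The coefficient [Negz 0] is [-1]. *)
Fixpoint eqT (j : nat) (t : rterm) : seq rpoly :=
  match t with
  | RVar i => [:: [:: (Posz 1, [:: j]); (Negz 0, [:: i])]]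
  | RZero => [:: [:: (Posz 1, [:: j])]]
  | ROne => [:: [:: (Posz 1, [:: j]); (Negz 0, [::])]]
  | RAdd a b => let k := j.+1 + size (enct a) in
      [:: (Posz 1, [:: j]); (Negz 0, [:: j.+1]); (Negz 0, [:: k])] :: eqT j.+1 a ++ eqT k b
  | RMul a b => let k := j.+1 + size (enct a) in
      [:: (Posz 1, [:: j]); (Negz 0, [:: j.+1; k])] :: eqT j.+1 a ++ eqT k b
  end.

Lemma eqT_add j a b : eqT j (RAdd a b) =
  [:: (Posz 1, [:: j]); (Negz 0, [:: j.+1]); (Negz 0, [:: j.+1 + size (enct a)])]
  :: eqT j.+1 a ++ eqT (j.+1 + size (enct a)) b.
Proof. by []. Qed.

Lemma eqT_mul j a b : eqT j (RMul a b) =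
  [:: (Posz 1, [:: j]); (Negz 0, [:: j.+1; j.+1 + size (enct a)])]
  :: eqT j.+1 a ++ eqT (j.+1 + size (enct a)) b.
Proof. by []. Qed.

Fixpoint eqF (j : nat) (f : rqf) : seq rpoly :=
  match f with
  | RAtom _ t => eqT j.+1 t
  | RAnd f g | ROr f g => eqF j.+1 f ++ eqF (j.+1 + size (encq f)) g
  end.

Fixpoint atomF (j : nat) (f : rqf) : rsa :=
  match f with
  | RAtom c _ => SaAtom c [:: (Posz 1, [:: j.+1])]
  | RAnd f g => SaAnd (atomF j.+1 f) (atomF (j.+1 + size (encq f)) g)
  | ROr f g => SaOr (atomF j.+1 f) (atomF (j.+1 + size (encq f)) g)
  end.

Definition conj_eqs (s : seq rpoly) (f : rsa) : rsa :=
  foldr (fun g f => SaAnd (SaAtom Ceq g) f) f s.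

Lemma enc_conj_eqs s f :
  encs (conj_eqs s f) = flatten [seq Kand :: Keq :: encp g | g <- s] ++ encs f.
Proof. by elim: s => //= g s ->; rewrite catA. Qed.

Lemma enc_pos1 : enc_int (Posz 1) = [:: Kone]. Proof. by []. Qed.
Lemma enc_neg1 : enc_int (Negz 0) = [:: Kminus; Kone]. Proof. by []. Qed.

Lemma flatx_cons F u a v : flatx F u (a :: v) = F a u v ++ flatx F (a :: u) v.
Proof. by []. Qed.

Lemma flatx_ticks F u i r : (forall u v, F Ktick u v = [::]) ->
  flatx F u (nseq i Ktick ++ r) = flatx F (rev (nseq i Ktick) ++ u) r.
Proof.
move=> h; elim: i u => //= i IH u; rewrite h /= IH rev_cons cat_rcons //.
Qed.

Definition enc_eqs (s : seq rpoly) : word := flatten [seq Kand :: Keq :: encp g | g <- s].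

Lemma enc_eqs_cons g s : enc_eqs (g :: s) = (Kand :: Keq :: encp g) ++ enc_eqs s.
Proof. by []. Qed.

Lemma enc_eqs_cat s s' : enc_eqs (s ++ s') = enc_eqs s ++ enc_eqs s'.
Proof. by rewrite /enc_eqs map_cat flatten_cat. Qed.

Lemma eq_emit_term t u r : nontick r ->
  flatx eq_emit u (enct t ++ r)
  = enc_eqs (eqT (size u) t) ++ flatx eq_emit (rev (enct t) ++ u) r.
Proof.
elim: t u r => [i|||a IHa b IHb|a IHa b IHb] u r hr; rewrite [enct _ ++ r]/= flatx_cons.
- rewrite /eq_emit lead_ticks // -/eq_emit flatx_ticks // [enct _]/= rev_cons cat_rcons.
  congr (_ ++ _).
  by rewrite /eq_head /xvar ticksE /enc_eqs /= /encp /= /encvs /= ?enc_pos1 ?enc_neg1 /= !cats0 -?catA.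
- by rewrite /= /eq_head /xvar ticksE /enc_eqs /= /encp /= /encvs /= ?enc_pos1 /= !cats0.
- by rewrite /= /eq_head /xvar ticksE /enc_eqs /= /encp /= /encvs /= ?enc_pos1 ?enc_neg1 /= !cats0 -?catA.
- rewrite -catA IHa ?IHb //; last exact: enct_nontick.
  rewrite eqT_add enc_eqs_cons enc_eqs_cat -[RHS]catA; congr (_ ++ _).
    rewrite /eq_emit (item_lenE a (enct_nil b r) (enct_nontick b r)) /eq_head /xvar !ticksE.
    rewrite /= /encp /= /encvs /= ?enc_pos1 ?enc_neg1 /= !cats0 -?catA /=.
    by rewrite nseqD -?catA.
  rewrite -[RHS]catA; congr (_ ++ (_ ++ _)).
    by rewrite size_cat size_rev addnC.
  by rewrite [enct _]/= rev_cons cat_rcons rev_cat catA.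
- rewrite -catA IHa ?IHb //; last exact: enct_nontick.
  rewrite eqT_mul enc_eqs_cons enc_eqs_cat -[RHS]catA; congr (_ ++ _).
    rewrite /eq_emit (item_lenE a (enct_nil b r) (enct_nontick b r)) /eq_head /xvar !ticksE.
    rewrite /= /encp /= /encvs /= ?enc_pos1 ?enc_neg1 /= !cats0 -?catA /=.
    by rewrite nseqD -?catA.
  rewrite -[RHS]catA; congr (_ ++ (_ ++ _)).
    by rewrite size_cat size_rev addnC.
  by rewrite [enct _]/= rev_cons cat_rcons rev_cat catA.
Qed.

Lemma eq_emit_qf f u r : nontick r ->
  flatx eq_emit u (encq f ++ r)
  = enc_eqs (eqF (size u) f) ++ flatx eq_emit (rev (encq f) ++ u) r.
Proof.
elim: f u r => [c t|a IHa b IHb|a IHa b IHb] u r hr; rewrite [encq _ ++ r]/= flatx_cons.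
- by rewrite eq_emit_term // [encq _]/= rev_cons cat_rcons; case: c.
- rewrite -catA IHa ?IHb //; last exact: encq_nontick.
  rewrite [eqF _ _]/= enc_eqs_cat -[RHS]catA [eq_emit _ _ _]/= cat0s.
  congr (_ ++ (_ ++ _)); first by rewrite size_cat size_rev addnC.
  by rewrite [encq _]/= rev_cons cat_rcons rev_cat catA.
- rewrite -catA IHa ?IHb //; last exact: encq_nontick.
  rewrite [eqF _ _]/= enc_eqs_cat -[RHS]catA [eq_emit _ _ _]/= cat0s.
  congr (_ ++ (_ ++ _)); first by rewrite size_cat size_rev addnC.
  by rewrite [encq _]/= rev_cons cat_rcons rev_cat catA.
Qed.

Lemma atom_emit_term t u r :
  flatx atom_emit u (enct t ++ r) = flatx atom_emit (rev (enct t) ++ u) r.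
Proof.
elim: t u r => [i|||a IHa b IHb|a IHa b IHb] u r //; rewrite [enct _ ++ r]/= flatx_cons.
- by rewrite flatx_ticks //= rev_cons cat_rcons.
- by rewrite -catA IHa IHb /= rev_cons cat_rcons rev_cat catA.
- by rewrite -catA IHa IHb /= rev_cons cat_rcons rev_cat catA.
Qed.

Lemma cons_catA (k : token) (x y z : word) : (k :: x ++ y) ++ z = k :: x ++ y ++ z.
Proof. by rewrite cat_cons catA. Qed.

Lemma atom_emit_qf f u r :
  flatx atom_emit u (encq f ++ r)
  = encs (atomF (size u) f) ++ flatx atom_emit (rev (encq f) ++ u) r.
Proof.
elim: f u r => [c t|a IHa b IHb|a IHa b IHb] u r; rewrite [encq _ ++ r]/= flatx_cons.
- rewrite atom_emit_term [encq _]/= rev_cons cat_rcons; congr (_ ++ _).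
  have -> : atom_emit (enc_cmp c) u (enct t ++ r)
      = [:: enc_cmp c; Kplus; Kone] ++ xvar (enc_cmp c :: u) by case: c.
  by rewrite /xvar ticksE /= /encp /= /encvs /= !cats0.
- rewrite -catA IHa IHb [encs _]/= cons_catA.
  congr (_ :: (_ ++ (_ ++ _))); first by rewrite size_cat size_rev addnC.
  by rewrite [encq _]/= rev_cons cat_rcons rev_cat catA.
- rewrite -catA IHa IHb [encs _]/= cons_catA.
  congr (_ :: (_ ++ (_ ++ _))); first by rewrite size_cat size_rev addnC.
  by rewrite [encq _]/= rev_cons cat_rcons rev_cat catA.
Qed.

Definition tseitin (n : nat) (f : rqf) : rsa := conj_eqs (eqF n f) (SaNot (atomF n f)).

Lemma flatx_alls F u n r : (forall u v, F Kall u v = [::]) ->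
  flatx F u (nseq n Kall ++ r) = flatx F (nseq n Kall ++ u) r.
Proof.
move=> h; elim: n u => //= n IH u; rewrite h /= IH.
by congr flatx; elim: n {IH} => //= n ->.
Qed.

Lemma hardness_body_enc n f :
  hardness_body (nseq n Kall ++ encq f)
  = enc_instance (n + size (encq f)) (tseitin n f) (Negz 0) 1.
Proof.
rewrite /hardness_body /enc_instance ticksE size_cat size_nseq; congr (_ ++ _).
rewrite enc_neg1 /= /tseitin enc_conj_eqs -/(enc_eqs _) !flatx_alls // !cats0.
rewrite -[encq f]cats0 eq_emit_qf // atom_emit_qf /= !cats0 size_nseq.
by rewrite -?catA.
Qed.

Lemma eqT_bd n N j t : tbd n t -> n <= N -> j + size (enct t) <= N -> all (pbd N) (eqT j t).
Proof.
elim: t j => [i|||a IHa b IHb|a IHa b IHb] j h hN hj; rewrite ?eqT_add ?eqT_mul.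
- by move: h hj; rewrite /= size_nseq /pbd /= => h hj; lia.
- by move: h hj; rewrite /= /pbd /= => h hj; lia.
- by move: h hj; rewrite /= /pbd /= => h hj; lia.
- move: h hj => /= /andP[ha hb]; rewrite size_cat => hj.
  have sa : 0 < size (enct a) by case: (a).
  have sb : 0 < size (enct b) by case: (b).
  have H1 : all (pbd N) (eqT j.+1 a) by apply: IHa => //; lia.
  have H2 : all (pbd N) (eqT (j.+1 + size (enct a)) b) by apply: IHb => //; lia.
  by rewrite all_cat H1 H2 /=; lia.
- move: h hj => /= /andP[ha hb]; rewrite size_cat => hj.
  have sa : 0 < size (enct a) by case: (a).
  have sb : 0 < size (enct b) by case: (b).
  have H1 : all (pbd N) (eqT j.+1 a) by apply: IHa => //; lia.
  have H2 : all (pbd N) (eqT (j.+1 + size (enct a)) b) by apply: IHb => //; lia.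
  by rewrite all_cat H1 H2 /=; lia.
Qed.

Lemma eqF_bd n N j f : qbd n f -> n <= N -> j + size (encq f) <= N ->
  all (pbd N) (eqF j f) && sbd N (atomF j f).
Proof.
elim: f j => [c t|a IHa b IHb|a IHa b IHb] j h hN hj /=.
- have st : 0 < size (enct t) by case: (t).
  rewrite (eqT_bd (n := n)) //; last by move: hj; rewrite /=; lia.
  by rewrite /pbd /= !andbT; move: hj; rewrite /=; lia.
- move: h hj => /= /andP[/IHa ha /IHb hb]; rewrite size_cat => hj.
  rewrite all_cat; have /andP[-> ->] : all (pbd N) (eqF j.+1 a) && sbd N (atomF j.+1 a).
    by apply: ha => //; lia.
  by rewrite hb //; lia.
- move: h hj => /= /andP[/IHa ha /IHb hb]; rewrite size_cat => hj.
  rewrite all_cat; have /andP[-> ->] : all (pbd N) (eqF j.+1 a) && sbd N (atomF j.+1 a).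
    by apply: ha => //; lia.
  by rewrite hb //; lia.
Qed.

Lemma sbd_conj N s f : sbd N (conj_eqs s f) = all (pbd N) s && sbd N f.
Proof. by elim: s => //= g s ->; rewrite andbA. Qed.

(** * Correctness of the hardness reduction *)

Section Hardness.
Variable R : realType.
Local Open Scope ring_scope.
Implicit Types v : nat -> R.

Lemma ssat_conj v s f : ssat v (conj_eqs s f) = all (fun g => peval v g == 0) s && ssat v f.
Proof. by elim: s => //= g s ->; rewrite andbA. Qed.

Lemma peval_cons v m g :
  peval v (m :: g) = m.1%:~R * \prod_(i <- m.2) v i + peval v g.
Proof. by rewrite /peval big_cons. Qed.

Lemma peval_nil v : peval v [::] = 0.
Proof. by rewrite /peval big_nil. Qed.

Lemma eqT_sound v j t : all (fun g => peval v g == 0) (eqT j t) -> v j = teval v t.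
Proof.
elim: t j => [i|||a IHa b IHb|a IHa b IHb] j; rewrite ?eqT_add ?eqT_mul /= ?all_cat.
- rewrite andbT !peval_cons peval_nil /= !big_seq1 => /eqP h; lra.
- rewrite andbT !peval_cons peval_nil /= !big_seq1 => /eqP h; lra.
- rewrite andbT !peval_cons peval_nil /= !big_seq1 big_nil => /eqP h; lra.
- case/and3P=> /eqP + /IHa <- /IHb <-; rewrite !peval_cons peval_nil /= !big_seq1; lra.
- case/and3P=> /eqP + /IHa <- /IHb <-; rewrite !peval_cons peval_nil /= !big_cons !big_nil.
  by rewrite !mulr1; lra.
Qed.

Lemma eqF_sound v j f : all (fun g => peval v g == 0) (eqF j f) ->
  ssat v (atomF j f) = rsat v f.
Proof.
elim: f j => [c t|a IHa b IHb|a IHa b IHb] j /=; rewrite ?all_cat.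
- move=> /eqT_sound <-; rewrite peval_cons peval_nil /= big_seq1.
  by congr cmp0; lra.
- by case/andP=> /IHa -> /IHb ->.
- by case/andP=> /IHa -> /IHb ->.
Qed.

(** One value per token of the code. A subterm has its value at its first token; ticks, like the
    formula tokens in [valF], receive the filler 0. *)
Fixpoint valT v (t : rterm) : seq R :=
  teval v t :: match t with
    | RVar i => nseq i 0
    | RZero | ROne => [::]
    | RAdd a b | RMul a b => valT v a ++ valT v b
    end.

Fixpoint valF v (f : rqf) : seq R :=
  0 :: match f with
    | RAtom _ t => valT v t
    | RAnd f g | ROr f g => valF v f ++ valF v g
    end.

Lemma size_valT v t : size (valT v t) = size (enct t).
Proof. by elim: t => //= [i|a IHa b IHb|a IHa b IHb]; rewrite ?size_nseq ?size_cat ?IHa ?IHb. Qed.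

Lemma size_valF v f : size (valF v f) = size (encq f).
Proof. by elim: f => //= [c t|a IHa b IHb|a IHa b IHb]; rewrite ?size_valT ?size_cat ?IHa ?IHb. Qed.

Definition holds_at v (j : nat) (s : seq R) : Prop :=
  forall i, (i < size s)%N -> v (j + i)%N = s`_i.

Lemma holds_at_cons v j x s : holds_at v j (x :: s) -> v j = x /\ holds_at v j.+1 s.
Proof.
move=> h; split; first by have := h 0 isT; rewrite addn0.
by move=> i hi; rewrite addSnnS; apply: (h i.+1).
Qed.

Lemma holds_at_cat v j s s' : holds_at v j (s ++ s') ->
  holds_at v j s /\ holds_at v (j + size s)%N s'.
Proof.
move=> h; split=> i hi.
  by rewrite h ?nth_cat ?hi // size_cat ltn_addr.
by rewrite -addnA h ?size_cat ?ltn_add2l // nth_cat ltnNge leq_addr /= addKn.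
Qed.

Lemma eqT_complete v v0 n j t : tbd n t -> (forall i, (i < n)%N -> v i = v0 i) ->
  holds_at v j (valT v0 t) -> all (fun g => peval v g == 0) (eqT j t).
Proof.
move=> + hv; have hd t' k : holds_at v k (valT v0 t') -> v k = teval v0 t'.
  by case: t' => *; apply: (proj1 (holds_at_cons _)); eassumption.
elim: t j => [i|||a IHa b IHb|a IHa b IHb] j; rewrite ?eqT_add ?eqT_mul => hb.
- move=> /holds_at_cons[hj _]; rewrite [all _ _]/= !peval_cons peval_nil /= !big_seq1 hj.
  by rewrite andbT /= hv //; apply/eqP; lra.
- move=> /holds_at_cons[hj _]; rewrite [all _ _]/= !peval_cons peval_nil /= !big_seq1 hj.
  by rewrite andbT /=; apply/eqP; lra.
- move=> /holds_at_cons[hj _]; rewrite [all _ _]/= !peval_cons peval_nil /= !big_seq1 big_nil hj.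
  by rewrite andbT /=; apply/eqP; lra.
- move=> /holds_at_cons[hj /holds_at_cat[ha hb']]; rewrite size_valT in hb'.
  move: hb => /= /andP[ba bb]; rewrite all_cat IHa // IHb // !andbT.
  rewrite !peval_cons peval_nil /= !big_seq1 hj /= (hd _ _ ha) (hd _ _ hb').
  by apply/eqP; lra.
- move=> /holds_at_cons[hj /holds_at_cat[ha hb']]; rewrite size_valT in hb'.
  move: hb => /= /andP[ba bb]; rewrite all_cat IHa // IHb // !andbT.
  rewrite !peval_cons peval_nil /= !big_cons !big_nil hj /= (hd _ _ ha) (hd _ _ hb').
  by apply/eqP; rewrite !mulr1; lra.
Qed.

Lemma eqF_complete v v0 n j f : qbd n f -> (forall i, (i < n)%N -> v i = v0 i) ->
  holds_at v j (valF v0 f) -> all (fun g => peval v g == 0) (eqF j f).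
Proof.
move=> + hv; elim: f j => [c t|a IHa b IHb|a IHa b IHb] j hb /holds_at_cons[_].
- exact: (@eqT_complete v v0 n _ t hb hv).
- move=> /holds_at_cat[ha hb']; rewrite size_valF in hb'.
  by move: hb => /= /andP[ba bb]; rewrite all_cat IHa // IHb.
- move=> /holds_at_cat[ha hb']; rewrite size_valF in hb'.
  by move: hb => /= /andP[ba bb]; rewrite all_cat IHa // IHb.
Qed.

Lemma rsat_ext v v' n f : qbd n f -> (forall i, (i < n)%N -> v i = v' i) ->
  rsat v f = rsat v' f.
Proof.
move=> + h; have ht t : tbd n t -> teval v t = teval v' t.
  by elim: t => //= a IHa b IHb /andP[/IHa -> /IHb ->].
by elim: f => //= [c t /ht -> //|a IHa b IHb /andP[/IHa -> /IHb ->]|a IHa b IHb /andP[/IHa -> /IHb ->]].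
Qed.

(** The equations fix the values of all subterms, so a point satisfying them and the negated matrix
    amounts to a counterexample to the sentence. *)
Lemma tseitin_sat n f : qbd n f ->
  (forall v, rsat v f) <-> forall v, ~~ ssat v (tseitin n f).
Proof.
move=> hb; split=> h v.
  rewrite ssat_conj; apply/negP => /andP[/eqF_sound E] /=.
  by rewrite E h.
apply/negPn/negP => hv.
(* Quantifier positions keep the values of the counterexample; every later position gets the value
   prescribed for its token. *)
pose v1 i := if (i < n)%N then v i else (valF v f)`_(i - n).
have h1 i : (i < n)%N -> v1 i = v i by rewrite /v1 => ->.
have h2 : holds_at v1 n (valF v f).
  by move=> i hi; rewrite /v1 ltnNge leq_addr /= addKn.
have hc := eqF_complete hb h1 h2.
have := h v1; rewrite ssat_conj hc /= (eqF_sound hc) negbK (rsat_ext hb h1).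
by rewrite (negbTE hv).
Qed.

Lemma radius_neg d (S : set 'rV[R]_d) :
  radius_at_most S (ratr ((Negz 0)%:Q / 1%:Q)) <-> forall x, ~ S x.
Proof.
have -> : ratr ((Negz 0)%:Q / 1%:Q) = -1 :> R.
  have -> : (Negz 0)%:Q / 1%:Q = -1 :> rat by [].
  by rewrite rmorphN1.
split=> [[x hx] y Sy|h]; last by exists 0 => y /h.
have := hx y Sy; rewrite leNgt => /negP; apply.
by rewrite (lt_le_trans _ (sqrtr_ge0 _)) // oppr_lt0 ltr01.
Qed.

Lemma hardness_map_correct w :
  accepts (p := true_universal_sentences R) w <-> accepts (p := radius_problem R) (hardness_map w).
Proof.
have all_lead n f : lead (pred1 Kall) (nseq n Kall ++ encq f) = nseq n Kall.
  by rewrite lead_cat ?all_nseq ?orbT // lead_stop ?cats0 //; case: f => // -[].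
have valid n f : vars_lt (size (lead (pred1 Kall) (nseq n Kall ++ encq f))) (nseq n Kall ++ encq f)
    = qbd n f.
  rewrite all_lead size_nseq.
  have -> : vars_lt n (nseq n Kall ++ encq f) = vars_lt n (encq f) by elim: {2}n.
  by rewrite -[encq f]cats0 vars_lt_qf //= andbT.
have sat n f : qbd n f -> (forall v : nat -> R, rsat v f) <->
    (forall x, ~ ([set x : 'rV[R]_(n + size (encq f)) | ssat (vf x) (tseitin n f)]%classic x)).
  move=> hb; rewrite (tseitin_sat hb); split=> h.
    by move=> x /=; apply/negP; exact: h.
  move=> v; have bd : sbd (n + size (encq f)) (tseitin n f).
    by rewrite sbd_conj; apply: eqF_bd hb _ _; lia.
  rewrite -(ssat_ext bd (v := vf (\row_(j < n + size (encq f)) v j))).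
    by apply/negP; exact: h.
  by move=> i hi; rewrite vf_row.
rewrite accepts_sentence accepts_radius /hardness_map; split.
  case=> n [f [hb -> hf]]; rewrite srun_sentence valid hb hardness_body_enc.
  exists (n + size (encq f))%N, (tseitin n f), (Negz 0), 1%N; split=> //.
    by rewrite sbd_conj; apply: eqF_bd hb _ _; lia.
  by apply/radius_neg; apply/sat.
case: ifP => [/andP[/sentence_sound[n [f ->]]]|_]; last first.
  (* The empty word is no instance, as every instance contains [Kslash]. *)
  case=> d [g [p [q [_ _ /esym]]]]; rewrite /enc_instance => /(congr1 size).
  by rewrite !size_cat /= !addnS.
rewrite valid hardness_body_enc => hb [d [g [p [q [_ _ /enc_instance_inj[<- <- <- <-]]]]]].
move=> /radius_neg/(sat _ _ hb) h; exists n, f; split=> //.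
Qed.

End Hardness.

(** * Radius and variance of finite weighted families *)

Section Moments.
Local Open Scope ring_scope.
Variables (R : realType) (T : eqType).
Implicit Types (F : T -> R) (s : seq (R * T)).

Definition moment F s : R := \sum_(p <- s) p.1 * F p.2.

Lemma moment_cat F s s' : moment F (s ++ s') = moment F s + moment F s'.
Proof. by rewrite /moment big_cat. Qed.

Lemma moment_scale F s c : moment F [seq (c * p.1, p.2) | p <- s] = c * moment F s.
Proof.
rewrite /moment big_map mulr_sumr; apply: eq_bigr => p _ /=.
by rewrite mulrA.
Qed.

(** Caratheodory's step: with more points than functionals the value vectors are linearly dependent,
    and the weights are shifted along a dependency until one of them vanishes. *)
Lemma moment_reduce N (F : 'I_N -> T -> R) s : (N < size s)%N ->
  (forall p, p \in s -> 0 <= p.1) ->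
  exists s', [/\ (size s' < size s)%N,
    forall p, p \in s' -> 0 <= p.1 /\ exists2 p', p' \in s & p'.2 = p.2
    & forall j, moment (F j) s' = moment (F j) s].
Proof.
move=> hN h0; have [p0 _] : exists p0, p0 \in s.
  by case: (s) hN => // p s' _; exists p; rewrite mem_head.
set n := size s in hN *.
pose w (i : 'I_n) := (nth p0 s i).1; pose x (i : 'I_n) := (nth p0 s i).2.
have momE G : moment G s = \sum_i w i * G (x i).
  by rewrite /moment (big_nth p0) big_mkord.
have wx (i : 'I_n) : nth p0 s i \in s by rewrite mem_nth.
have w0 i : 0 <= w i by exact: h0 (wx i).
pose A : 'M[R]_(n, N) := \matrix_(i, j) F j (x i).
have [c [i0 ci0 cA]] : exists c : 'I_n -> R, exists2 i0, 0 < c i0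
    & forall j, \sum_i c i * F j (x i) = 0.
  (* The rank of an [n] by [N] matrix is at most [N < n]. *)
  have /rowV0Pn[u /sub_kermxP uA u0] : kermx A != 0.
    rewrite kermx_eq0 /row_free; apply/eqP => h.
    by have := rank_leq_col A; rewrite h leqNgt hN.
  have hu j : \sum_i u 0 i * F j (x i) = 0.
    have := congr1 (fun B : 'rV_N => B 0 j) uA; rewrite !mxE => h.
    by apply: etrans h; apply: eq_bigr => i _; rewrite !mxE.
  have [i ui] : exists i, u 0 i != 0.
    by apply/existsP; move: u0; apply: contraNT => /existsPn h; apply/eqP/rowP => i;
      rewrite mxE; apply/eqP; have := h i; rewrite negbK.
  (* A nonzero vector has a positive entry, if necessary after a change of sign. *)
  have [ui0|ui0] := ltP 0 (u 0 i); first by exists (u 0); exists i.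
  exists (fun i => - u 0 i); first exists i; first by rewrite oppr_gt0 lt_neqAle ui ui0.
  move=> j; have := congr1 (@GRing.opp R) (hu j); rewrite oppr0 -sumrN => h.
  by apply: etrans h; apply: eq_bigr => k _; rewrite mulNr.
(* The least ratio over the positive entries of [c] is the largest shift that keeps all weights
   nonnegative. *)
have [i1 ci1 hmin] : exists2 i1, 0 < c i1
    & forall i, 0 < c i -> w i1 / c i1 <= w i / c i.
  by case: (arg_minP (fun i => w i / c i) (P := fun i => 0 < c i) ci0) => i h1 h2; exists i.
pose th := w i1 / c i1; pose w' i := w i - th * c i.
have th0 : 0 <= th by rewrite divr_ge0 ?w0 ?ltW.
have w'0 i : 0 <= w' i.
  rewrite /w' subr_ge0; have [ci|ci] := ltP 0 (c i).
    by rewrite -ler_pdivlMr // hmin.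
  by apply: le_trans (w0 i); rewrite mulr_ge0_le0.
have w'1 : w' i1 = 0 by rewrite /w' /th divfK ?subrr // gt_eqF.
exists [seq (w' i, x i) | i <- enum (predC1 i1)]; split.
- rewrite size_map -cardE cardC1 card_ord.
  by move: hN; case: (n).
- by move=> p /mapP[i _ ->]; split=> //=; exists (nth p0 s i).
move=> j; rewrite {1}/moment big_map big_enum_cond /= momE.
have -> : \sum_i w i * F j (x i) = \sum_i w' i * F j (x i).
  have -> : \sum_i w' i * F j (x i) = \sum_i w i * F j (x i) - th * \sum_i c i * F j (x i).
    by rewrite mulr_sumr -sumrB; apply: eq_bigr => i _; rewrite /w'; ring.
  by rewrite cA mulr0 subr0.
rewrite [RHS](bigD1 i1) //= w'1 mul0r add0r.
by apply: eq_bigl => i; rewrite !inE andbT.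
Qed.

Lemma moment_reduce_all N (F : 'I_N -> T -> R) s :
  (forall p, p \in s -> 0 <= p.1) ->
  exists s', [/\ (size s' <= N)%N,
    forall p, p \in s' -> 0 <= p.1 /\ exists2 p', p' \in s & p'.2 = p.2
    & forall j, moment (F j) s' = moment (F j) s].
Proof.
have [n] := ubnP (size s); elim: n s => // n IH s hs h0.
have [hN|hN] := leqP (size s) N.
  by exists s; split=> // p hp; split; [exact: h0|exists p].
have [s1 [h1 h2 h3]] := moment_reduce F hN h0.
have [|p /h2[] //|s2 [g1 g2 g3]] := IH s1; first by lia.
exists s2; split=> // [p /g2[g0 [p1 hp1 <-]]|j]; last by rewrite g3.
by split=> //; have [_ [p2 hp2 <-]] := h2 _ hp1; exists p2.
Qed.

End Moments.

Section Radius.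
Local Open Scope ring_scope.
Variables (R : realType) (d : nat).
Implicit Types (x y : 'rV[R]_d) (s : seq (R * 'rV[R]_d)).

Definition nrm2 x : R := \sum_k x 0 k ^+ 2.
Definition mass s : R := moment (fun=> 1) s.
Definition mean s (k : 'I_d) : R := moment (fun x => x 0 k) s.
(** This is the variance only if the mass is 1. *)
Definition var s : R := moment nrm2 s - \sum_k mean s k ^+ 2.
Definition mix (t : R) s s' := [seq ((1 - t) * p.1, p.2) | p <- s] ++ [seq (t * p.1, p.2) | p <- s'].

Lemma moment_mix F t s s' : moment F (mix t s s') = (1 - t) * moment F s + t * moment F s'.
Proof. by rewrite moment_cat !moment_scale. Qed.

(** Variance is concave under mixing, and the gain is an exact multiple of the squared distance of
    the means. Thus a small deficit in variance confines the mean. *)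
Lemma var_mix t s s' : var (mix t s s')
  = (1 - t) * var s + t * var s' + t * (1 - t) * \sum_k (mean s k - mean s' k) ^+ 2.
Proof.
rewrite /var moment_mix.
have -> : \sum_k mean (mix t s s') k ^+ 2 = (1 - t) * \sum_k mean s k ^+ 2
   + t * \sum_k mean s' k ^+ 2 - t * (1 - t) * \sum_k (mean s k - mean s' k) ^+ 2.
  rewrite !mulr_sumr -big_split -sumrB; apply: eq_bigr => k _ /=.
  by rewrite /mean moment_mix; ring.
by ring.
Qed.

Lemma var1 (y : 'rV[R]_d) : var [:: (1, y)] = 0.
Proof.
rewrite /var /moment big_seq1 mul1r /= /nrm2; apply/eqP; rewrite subr_eq0; apply/eqP.
by apply: eq_bigr => k _; rewrite /mean /moment big_seq1 mul1r.
Qed.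

Lemma mean1 (y : 'rV[R]_d) k : mean [:: (1, y)] k = y 0 k.
Proof. by rewrite /mean /moment big_seq1 mul1r. Qed.

Variable S : set 'rV[R]_d.

Definition admissible s : Prop :=
  (forall p, p \in s -> 0 <= p.1 /\ S p.2) /\ mass s = 1.

Lemma admissible1 y : S y -> admissible [:: (1, y)].
Proof.
move=> Sy; split; first by move=> p; rewrite inE => /eqP -> /=; split; rewrite ?ler01.
by rewrite /mass /moment big_seq1 mulr1.
Qed.

Lemma admissible_mix t s s' : 0 <= t <= 1 -> admissible s -> admissible s' ->
  admissible (mix t s s').
Proof.
case/andP=> t0 t1 [h1 m1] [h2 m2]; split; last first.
  by rewrite /mass moment_mix -/(mass s) -/(mass s') m1 m2; lra.
move=> p; rewrite mem_cat => /orP[] /mapP[q hq ->] /=.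
  by have [? ?] := h1 _ hq; split=> //; rewrite mulr_ge0 // subr_ge0.
by have [? ?] := h2 _ hq; split=> //; rewrite mulr_ge0.
Qed.

Lemma le_of_small (D V C : R) :
  (forall h, 0 < h -> h < 1 -> D - V <= h * C) -> D <= V.
Proof.
move=> H; rewrite leNgt; apply/negP => hDV.
have dv : 0 < D - V by lra.
(* With this [m] the choice [h = (D - V) / m] is below 1 and makes [h * C] smaller than [D - V]. *)
pose m := 2 * (`|C| + (D - V) + 1).
have m0 : 0 < m by rewrite /m; have := normr_ge0 C; lra.
have hm : 0 < (D - V) / m by rewrite divr_gt0.
have := H ((D - V) / m) hm; rewrite ltr_pdivrMr // mul1r => /(_ _).
have -> : D - V < m by rewrite /m; have := normr_ge0 C; lra.
move=> /(_ isT); rewrite mulrAC ler_pdivlMr // => h.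
have h1 : (D - V) * C <= (D - V) * `|C| by rewrite ler_wpM2l ?ler_norm //; lra.
have h2 : 0 <= (D - V) * `|C| by rewrite mulr_ge0 //; lra.
by rewrite /m in h; nra.
Qed.

(* A point at distance at most [sqrt (2 (V - var s))] from the mean of every
   admissible [s] exists coordinatewise because these intervals meet pairwise:
   mixing two families in equal parts adds a quarter of the squared distance of
   their means to the variance.  Mixing [s] with a small mass at [y] then bounds
   the distance to [y]. *)
Lemma center_exists (V0 : R) y0 : S y0 ->
  (forall s, admissible s -> var s <= V0) ->
  exists x, forall y, S y -> nrm2 (x - y) <= V0.
Proof.
move=> Sy0 hV0.
pose E : set R := [set v | exists2 s, admissible s & v = var s]%classic.
have hsE : has_sup E.
  split; first by exists (var [:: (1, y0)]); exists [:: (1, y0)] => //; exact: admissible1.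
  by exists V0 => v [s hs ->]; exact: hV0.
pose V := sup E.
have VV0 : V <= V0 by apply: ge_sup => [|v [s hs ->]]; [exact: (proj1 hsE)|exact: hV0].
have leV s : admissible s -> var s <= V.
  by move=> hs; apply: ub_le_sup; [exact: (proj2 hsE)|exists s].
have V_ge0 : 0 <= V by have := leV _ (admissible1 Sy0); rewrite var1.
pose e s := V - var s.
have e0 s : admissible s -> 0 <= e s by move=> hs; rewrite subr_ge0 leV.
have dist s s' k : admissible s -> admissible s' ->
    (mean s k - mean s' k) ^+ 2 <= 2 * (e s + e s').
  move=> hs hs'.
  have h2 : 0 <= (2^-1 : R) <= 1 by apply/andP; split; lra.
  have := leV _ (admissible_mix h2 hs hs'); rewrite var_mix => h.
  have hk : (mean s k - mean s' k) ^+ 2 <= \sum_k (mean s k - mean s' k) ^+ 2.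
    by rewrite (bigD1 k) //= lerDl sumr_ge0 // => i _; rewrite sqr_ge0.
  by rewrite /e; lra.
have gap s s' k : admissible s -> admissible s' ->
    mean s k - Num.sqrt (2 * e s) <= mean s' k + Num.sqrt (2 * e s').
  move=> hs hs'.
  have a0 := sqrtr_ge0 (2 * e s); have b0 := sqrtr_ge0 (2 * e s').
  have ha : Num.sqrt (2 * e s) ^+ 2 = 2 * e s by rewrite sqr_sqrtr // mulr_ge0 ?e0.
  have hb : Num.sqrt (2 * e s') ^+ 2 = 2 * e s' by rewrite sqr_sqrtr // mulr_ge0 ?e0.
  have hd := dist s s' k hs hs'.
  (* If the intervals were disjoint, the distance of the means would exceed the sum of the two
     roots, whose square is at least the sum of their squares, contrary to [dist]. *)
  rewrite leNgt; apply/negP => hlt.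
  have : (Num.sqrt (2 * e s) + Num.sqrt (2 * e s')) ^+ 2 < (mean s k - mean s' k) ^+ 2.
    by rewrite ltr_pXn2r ?nnegrE //; lra.
  rewrite sqrrD ha hb; have := mulr_ge0 a0 b0; lra.
pose L k : set R := [set v | exists2 s, admissible s & v = mean s k - Num.sqrt (2 * e s)]%classic.
have ha0 := admissible1 Sy0.
have ubL k : has_ubound (L k).
  by exists (mean [:: (1, y0)] k + Num.sqrt (2 * e [:: (1, y0)])) => v [s hs ->]; exact: gap.
have neL k : (L k !=set0)%classic.
  by exists (mean [:: (1, y0)] k - Num.sqrt (2 * e [:: (1, y0)])); exists [:: (1, y0)].
(* By [gap] no left end exceeds any right end, so the supremum of the left ends lies in all
   intervals. *)
pose x : 'rV[R]_d := \row_k sup (L k).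
have close s k : admissible s -> (x 0 k - mean s k) ^+ 2 <= 2 * e s.
  move=> hs; rewrite mxE.
  have h1 : mean s k - Num.sqrt (2 * e s) <= sup (L k).
    by apply: ub_le_sup => //; exists s.
  have h2 : sup (L k) <= mean s k + Num.sqrt (2 * e s).
    by apply: ge_sup => // v [s' hs' ->]; exact: gap.
  have a0 := sqrtr_ge0 (2 * e s).
  have ha : Num.sqrt (2 * e s) ^+ 2 = 2 * e s by rewrite sqr_sqrtr // mulr_ge0 ?e0.
  rewrite -ha -[X in X <= _]real_normK ?num_real // ler_pXn2r ?nnegrE //.
  by rewrite ler_norml; apply/andP; split; lra.
exists x => y Sy; apply: le_trans VV0.
(* The constant comes from the inequality reached at the end, [(1 - h) * D <= (2 * d + 1) * h + (1 +
   h) * V] with [D = nrm2 (x - y)]. *)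
apply: (@le_of_small _ _ (nrm2 (x - y) + V + (2 * d%:R + 1))) => h h0 h1.
(* The deficit has to be of order [h ^ 2], because the final estimate is divided by [h], the mass
   placed at [y]. *)
have [s hs es] : exists2 s, admissible s & e s < h ^+ 2.
  have hh : 0 < h ^+ 2 by rewrite exprn_gt0.
  have [v [s hs ->] hv] := sup_adherent hh hsE.
  by exists s => //; rewrite /e; move: hv; rewrite -/V; lra.
have ht : 0 <= h <= 1 by apply/andP; split; lra.
have := leV _ (admissible_mix ht hs (admissible1 Sy)); rewrite var_mix var1 mulr0 addr0.
set m := \sum_k _ => hm.
(* Young's inequality for [x - y] split at the mean of [s]: the part up to the mean is tiny and may
   get a large factor, so that the other part keeps a factor near 1. In each coordinate the slack is
   the square in [h3]. *)
have hD : h * nrm2 (x - y) <= (1 + h) * (d%:R * (2 * e s)) + h * (1 + h) * m.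
  have -> : d%:R * (2 * e s) = \sum_(k < d) 2 * e s by rewrite sumr_const card_ord mulr_natl.
  rewrite /m /nrm2 !mulr_sumr -big_split; apply: ler_sum => k _ /=.
  have hc := close s k hs; rewrite mean1 !mxE.
  rewrite mxE in hc; set a := sup (L k) in hc *; set b := mean s k in hc *; set c := y 0 k.
  have h3 : 0 <= ((a - b) - h * (b - c)) ^+ 2 by rewrite sqr_ge0.
  have h4 : (1 + h) * (a - b) ^+ 2 <= (1 + h) * (2 * e s) by rewrite ler_wpM2l //; lra.
  apply: le_trans (_ : (1 + h) * (a - b) ^+ 2 + h * (1 + h) * (b - c) ^+ 2 <= _); last by lra.
  by rewrite -subr_ge0; apply: le_trans h3 _; rewrite le_eqVlt; apply/orP; left; apply/eqP; ring.
have es0 := e0 _ hs.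
have hvs : var s = V - e s by rewrite /e; ring.
rewrite hvs in hm.
have d0 : 0 <= d%:R :> R by rewrite ler0n.
set D := nrm2 _ in hD *.
have k1 : (1 - h) * (h * D) <= (1 - h) * ((1 + h) * (d%:R * (2 * e s)) + h * (1 + h) * m).
  by rewrite ler_wpM2l //; lra.
have k2 : (1 + h) * (h * (1 - h) * m) <= (1 + h) * (V - (1 - h) * (V - e s)).
  by rewrite ler_wpM2l //; lra.
have k3 : (1 - h) * (1 + h) * (d%:R * (2 * e s)) <= 2 * d%:R * h ^+ 2.
  apply: le_trans (_ : d%:R * (2 * e s) <= _).
    rewrite -[leRHS]mul1r ler_wpM2r //; first by rewrite !mulr_ge0.
    by have := sqr_ge0 h; rewrite expr2; lra.
  by rewrite mulrCA mulrA ler_wpM2l ?mulr_ge0 //; lra.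
have k4 : (1 + h) * ((1 - h) * e s) <= h ^+ 2.
  rewrite mulrA; apply: le_trans (_ : 1 * e s <= _); last by lra.
  by rewrite ler_wpM2r //; have := sqr_ge0 h; rewrite expr2; lra.
have k5 : h * ((1 - h) * D) <= h * ((2 * d%:R + 1) * h + (1 + h) * V).
  by apply: le_trans (_ : (1 - h) * (h * D) <= _); [rewrite le_eqVlt; apply/orP; left; apply/eqP; ring|];
     rewrite expr2 in k3 k4; lra.
by move: k5; rewrite ler_pM2l //; lra.
Qed.

End Radius.

(** * Duality between enclosing balls and variances *)

Section Duality.
Local Open Scope ring_scope.
Variables (R : realType) (d : nat).

(** For weights of sum 1 the right side is twice the variance minus [c]. Hence [c = 2 * r ^+ 2]
    turns nonpositivity into a variance of at most [r ^+ 2]. *)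
Lemma pair_sum n (a : 'I_n -> R) (y : 'I_n -> 'rV[R]_d) (c : R) :
  \sum_i \sum_j a i * a j * (nrm2 (y i - y j) - c)
  = 2 * (\sum_i a i) * (\sum_i a i * nrm2 (y i))
    - 2 * (\sum_k (\sum_i a i * y i 0 k) ^+ 2) - c * (\sum_i a i) ^+ 2.
Proof.
have P (f g : 'I_n -> R) : \sum_i \sum_j f i * g j = (\sum_i f i) * (\sum_j g j).
  by rewrite big_distrlr.
have E i j : a i * a j * (nrm2 (y i - y j) - c)
   = (a i * nrm2 (y i)) * a j + a i * (a j * nrm2 (y j))
     - 2 * (\sum_k (a i * y i 0 k) * (a j * y j 0 k)) - c * (a i * a j).
  have -> : nrm2 (y i - y j) = nrm2 (y i) + nrm2 (y j) - 2 * \sum_k y i 0 k * y j 0 k.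
    rewrite /nrm2 mulr_sumr -big_split -sumrB; apply: eq_bigr => k _ /=.
    by rewrite !mxE; ring.
  have -> : \sum_k (a i * y i 0 k) * (a j * y j 0 k) = a i * a j * \sum_k y i 0 k * y j 0 k.
    by rewrite mulr_sumr; apply: eq_bigr => k _; ring.
  by ring.
have -> : \sum_i \sum_j a i * a j * (nrm2 (y i - y j) - c)
   = \sum_i \sum_j (a i * nrm2 (y i)) * a j + \sum_i \sum_j a i * (a j * nrm2 (y j))
     - 2 * (\sum_i \sum_j \sum_k (a i * y i 0 k) * (a j * y j 0 k))
     - c * (\sum_i \sum_j a i * a j).
  rewrite !mulr_sumr -big_split -!sumrB; apply: eq_bigr => i _ /=.
  rewrite !mulr_sumr -big_split -!sumrB; apply: eq_bigr => j _ /=.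
  by rewrite E !mulr_sumr.
have -> : \sum_i \sum_j \sum_k (a i * y i 0 k) * (a j * y j 0 k)
   = \sum_k (\sum_i a i * y i 0 k) ^+ 2.
  under eq_bigr => i _ do rewrite exchange_big.
  rewrite exchange_big; apply: eq_bigr => k _.
  by rewrite P expr2.
by rewrite !P; ring.
Qed.

Lemma enorm_le (x : 'rV[R]_d) r : 0 <= r -> (enorm x <= r) = (nrm2 x <= r ^+ 2).
Proof.
move=> r0; have n0 : 0 <= nrm2 x by rewrite /nrm2 sumr_ge0 // => i _; rewrite sqr_ge0.
rewrite /enorm -/(nrm2 x) -[X in _ = (X <= _)](sqr_sqrtr n0).
by rewrite ler_pXn2r ?nnegrE // sqrtr_ge0.
Qed.

(** Squares serve as arbitrary nonnegative weights, and homogeneity of the form makes a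
    normalization of their sum unnecessary. The claim [0 <= r] stands behind the condition on the
    points, because the empty set has radius at most every [r]. *)
Lemma radius_dual (S : set 'rV[R]_d) (r : R) :
  radius_at_most S r <->
  forall (y : nat -> 'rV[R]_d) (mu : nat -> R), (forall i, (i < d.+2)%N -> S (y i)) ->
    0 <= r /\ \sum_(i < d.+2) \sum_(j < d.+2)
      mu i ^+ 2 * mu j ^+ 2 * (nrm2 (y i - y j) - 2 * r ^+ 2) <= 0.
Proof.
split=> [[x hx] y mu hy|H].
  have r0 : 0 <= r by apply: le_trans (sqrtr_ge0 _) (hx _ (hy 0 isT)).
  (* With the centre moved to the origin, each squared norm is at most [r ^+ 2], and the term of the
     mean only lowers the form. *)
  split=> //; pose u (i : 'I_d.+2) := y i - x; pose a (i : 'I_d.+2) := mu i ^+ 2.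
  have -> : \sum_(i < d.+2) \sum_(j < d.+2)
      mu i ^+ 2 * mu j ^+ 2 * (nrm2 (y i - y j) - 2 * r ^+ 2)
    = \sum_i \sum_j a i * a j * (nrm2 (u i - u j) - 2 * r ^+ 2).
    apply: eq_bigr => i _; apply: eq_bigr => j _.
    by have -> : u i - u j = y i - y j by rewrite /u opprB addrA subrK.
  rewrite pair_sum.
  have W0 : 0 <= \sum_i a i by rewrite sumr_ge0 // => i _; rewrite sqr_ge0.
  have Q0 : 0 <= \sum_k (\sum_i a i * u i 0 k) ^+ 2.
    by rewrite sumr_ge0 // => i _; rewrite sqr_ge0.
  have hu : \sum_i a i * nrm2 (u i) <= (\sum_i a i) * r ^+ 2.
    rewrite mulr_suml; apply: ler_sum => i _; rewrite ler_wpM2l ?sqr_ge0 //.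
    have -> : nrm2 (u i) = nrm2 (x - y i).
      by apply: eq_bigr => k _; rewrite /u !mxE; ring.
    by rewrite -enorm_le //; apply: hx; apply: hy.
  have := ler_wpM2l W0 hu; rewrite mulrA -expr2; lra.
have [[y0 Sy0]|nS] := pselect (exists y0, S y0); last first.
  by exists 0 => y Sy; case: nS; exists y.
have [r0 _] := H (fun=> y0) (fun=> 0) (fun _ _ => Sy0).
suff [x hx] : exists x, forall y, S y -> nrm2 (x - y) <= r ^+ 2.
  by exists x => y Sy; rewrite enorm_le //; exact: hx.
apply: (@center_exists R d S _ y0 Sy0) => s [hs ms].
(* The [d + 2] functionals: the coordinates, the mass at index [d], the squared norm at index
   [d + 1]. *)
pose F (j : 'I_d.+2) (x : 'rV[R]_d) : R :=
  if insub (j : nat) is Some k then x 0 k else if (j == d :> nat) then 1 else nrm2 x.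
have [|s' [h1 h2 h3]] := moment_reduce_all F (s := s); first by move=> p /hs[].
have hmean k : mean s' k = mean s k.
  have := h3 (inord k); rewrite /F inordK ?valK //.
  by have := ltn_ord k; lia.
have hmass : mass s' = 1.
  have := h3 (inord d); rewrite /F inordK // insubF ?eqxx ?ltnn //.
  by rewrite -/(mass s') -/(mass s) ms.
have hq : moment (@nrm2 R d) s' = moment (@nrm2 R d) s.
  have := h3 ord_max; rewrite /F /= insubF; last by lia.
  by rewrite gtn_eqF.
have -> : var s = var s'.
  by rewrite /var hq; congr (_ - _); apply: eq_bigr => k _; rewrite hmean.
(* The defaults fill the family up to [d.+2] points by copies of [y0] of weight 0. *)
pose y i := (nth (0, y0) s' i).2; pose w i := (nth (0, y0) s' i).1.
have w0 i : 0 <= w i.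
  rewrite /w; have [hi|hi] := ltnP i (size s'); last by rewrite nth_default.
  by have [] := h2 _ (mem_nth (0, y0) hi).
have yS i : S (y i).
  rewrite /y; have [hi|hi] := ltnP i (size s'); last by rewrite nth_default.
  by have [_ [p hp <-]] := h2 _ (mem_nth (0, y0) hi); have [] := hs _ hp.
have mE G : moment G s' = \sum_(i < d.+2) w i * G (y i).
  rewrite /moment (big_nth (0, y0)) big_mkord.
  rewrite (big_ord_widen_cond _ predT (fun i => w i * G (y i)) h1) /= big_mkcond.
  apply: eq_bigr => i _; case: ltnP => // hi.
  by rewrite /w nth_default // mul0r.
have [_] := H y (fun i => Num.sqrt (w i)) (fun i _ => yS i).
have -> : \sum_(i < d.+2) \sum_(j < d.+2) Num.sqrt (w i) ^+ 2 * Num.sqrt (w j) ^+ 2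
    * (nrm2 (y i - y j) - 2 * r ^+ 2)
  = \sum_(i < d.+2) \sum_(j < d.+2) w i * w j * (nrm2 (y i - y j) - 2 * r ^+ 2).
  by apply: eq_bigr => i _; apply: eq_bigr => j _; rewrite !sqr_sqrtr.
rewrite (pair_sum (fun i => w i) (fun i => y i)).
have -> : \sum_(i < d.+2) w i = 1.
  by rewrite -hmass /mass mE; apply: eq_bigr => i _; rewrite mulr1.
rewrite -mE.
have -> : \sum_k (\sum_(i < d.+2) w i * y i 0 k) ^+ 2 = \sum_k mean s' k ^+ 2.
  by apply: eq_bigr => k _; rewrite /mean mE.
by rewrite /var; lra.
Qed.

End Duality.

(** * Reduction of the radius problem to universal sentences *)

Lemma vars_lt_nonvar N s r : all (predC1 Kvar) s -> vars_lt N (s ++ r) = vars_lt N r.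
Proof. by elim: s => //= a s IH /andP[/negbTE -> /IH ->]. Qed.

Lemma enc_int_nonvar z : all (predC1 Kvar) (enc_int z).
Proof.
have h m : all (predC1 Kvar) (enc_nat m).
  by apply/allP => a /(allP (enc_nat_dig m)); case: a.
by rewrite /enc_int; case: ifP => _ //=.
Qed.

Lemma vars_lt_poly N g r : ends r -> vars_lt N (encp g ++ r) = pbd N g && vars_lt N r.
Proof.
move=> hr; elim: g => //= -[z vs] g IH /=.
rewrite -!catA vars_lt_nonvar ?enc_int_nonvar // -andbA -IH.
have h0 : nontick (encp g ++ r) by case: (g) => //=; case: (r) hr => //= -[].
elim: vs => //= i vs IHv; rewrite -catA lead_ticks.
  by rewrite size_nseq vars_lt_ticks IHv andbA.
by case: (vs).
Qed.

Lemma vars_lt_sa N f r : ends r -> vars_lt N (encs f ++ r) = sbd N f && vars_lt N r.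
Proof.
elim: f r => //= [c g|f IHf g IHg|f IHf g IHg] r hr.
- by rewrite vars_lt_poly //; case: c.
- by rewrite -catA IHf ?encs_ends // IHg // andbA.
- by rewrite -catA IHf ?encs_ends // IHg // andbA.
Qed.

(* Predictive parsing of radius instances.  Stack symbols of the header:
   [Ktick] start, [Kminus] after the sign of the radius, [Kzero] and [Kslash]
   after its digits (the former if they are [0]), [Kall] and [Kone] before and
   after the first digit of the denominator.  Stack symbols of the formula:
   [Kand] formula, [Kle] after a comparison, [Kplus] before a coefficient,
   [Klt] after its sign, [Kgt] and [Kge] after its digits (the former if they
   are [0]), [Kvar] in a variable, [Knot] error. *)
Definition rform (a : token) : word :=
  match a with
  | Kand | Kor => [:: Kand; Kand]
  | Knot => [:: Kand]
  | Klt | Kle | Keq | Kge | Kgt => [:: Kle]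
  | _ => [:: Knot]
  end.

Definition rtab (b a : token) : token :=
  match b, a with
  | Ktick, Ktick => Ktick
  | Ktick, Kminus => Kminus
  | Ktick, Kzero => Kzero
  | (Ktick | Kminus), Kone => Kslash
  | Kslash, (Kzero | Kone) => Kslash
  | (Kzero | Kslash), Kslash => Kall
  | Kall, Kone => Kone
  | Kone, (Kzero | Kone) => Kone
  | Kplus, Kminus => Klt
  | Kplus, Kzero => Kgt
  | (Kplus | Klt), Kone => Kge
  | Kge, (Kzero | Kone) => Kge
  | (Kge | Kgt | Kvar), Kvar => Kvar
  | Kvar, Ktick => Kvar
  | (Kle | Kge | Kgt | Kvar), Kplus => Kplus
  | _, _ => Knot
  end.

Definition rclose (b : token) : bool := b \in [:: Kle; Kge; Kgt; Kvar].

(** Nothing separates the denominator from the formula. In state [Kone] a formula token is therefore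
    treated as if a formula were pending. *)
Definition rtop (a b : token) : word :=
  if (b == Kand) || (b == Kone) && isfor a then rform a else [:: rtab b a].

Definition rstep (a : token) (st : word) : word :=
  match st with
  | [::] => [::]
  | b :: s => match s with
    | [::] => rtop a b
    | c :: s' => (if rclose b && isfor a then
                    if c == Kand then rform a else [:: Knot]
                  else rtop a b ++ [:: c]) ++ s'
    end
  end.

Lemma slow_rstep : slow rstep.
Proof. exact: slow_table. Qed.

Definition rrun (st w : word) : word := foldl (fun acc a => rstep a acc) st w.

Arguments rrun : simpl never.

Definition rfin (st : word) : bool := if st is [:: b] then rclose b else false.

Lemma fpb_rfin m f : fp m f -> fpb m (fun e => rfin (f e)).
Proof.
move=> hf; pose F (b : token) (e : seq word) :=
  if rclose b then if arg e 0 == [::] then [:: Kone] else [::] else [::] : word.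
have := @fp_case m f (fun=> [::]) F hf (fp_nil m) _.
move=> H; apply: fp_ext (H _) => [e _|b].
  by case: (f e) => [|b [|c s]] //=; rewrite /F /=; case: rclose.
rewrite /F; case: rclose; last exact: fp_nil.
by apply: fpb_nil; exact: fp_arg.
Qed.

Lemma rrun_cons st a w : rrun st (a :: w) = rrun (rstep a st) w.
Proof. by []. Qed.

Lemma rrun_cat st u v : rrun st (u ++ v) = rrun (rrun st u) v.
Proof. by rewrite /rrun foldl_cat. Qed.

Lemma rstep_next b s a : rclose b -> isfor a -> rstep a (b :: Kand :: s) = rform a ++ s.
Proof. by rewrite /= => -> ->. Qed.

Lemma rstep_form s a : rstep a (Kand :: s) = rform a ++ s.
Proof. by case: s => [|c s] /=; rewrite ?cats0 // -catA. Qed.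

Lemma rstep_tab b s a : b != Kand -> ~~ ((b == Kone) && isfor a) ->
  ~~ (rclose b && isfor a) -> rstep a (b :: s) = rtab b a :: s.
Proof.
move=> /negbTE hb /negbTE hb1 /negbTE h; case: s => [|c s] /=; rewrite ?h /rtop hb hb1 //.
Qed.

Lemma rrun_error s w : rrun (Knot :: s) w = Knot :: s.
Proof. by elim: w => //= a w IH; rewrite rrun_cons rstep_tab. Qed.

Lemma rfin_error s w : rfin (rrun (Knot :: s) w) -> False.
Proof. by rewrite rrun_error; case: s. Qed.

Lemma rrun_const b s x : b != Kand ->
  (forall a, a \in x -> [/\ rtab b a = b, ~~ ((b == Kone) && isfor a) & ~~ (rclose b && isfor a)]) ->
  rrun (b :: s) x = b :: s.
Proof.
move=> hb; elim: x => //= a x IH h; rewrite rrun_cons.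
have [h1 h2 h3] := h a (mem_head _ _); rewrite rstep_tab // h1 IH // => c hc.
by apply: h; rewrite inE hc orbT.
Qed.

Lemma rrun_digits b s x : b \in [:: Kslash; Kone; Kge] -> all isdig x ->
  rrun (b :: s) x = b :: s.
Proof.
move=> hb hx; apply: rrun_const => [|a /(allP hx)]; first by case: b hb.
by case: b hb => // _; case: a.
Qed.

Lemma rrun_vars vs b s : b \in [:: Kge; Kgt; Kvar] ->
  exists2 b', b' \in [:: Kge; Kgt; Kvar] & rrun (b :: s) (encvs vs) = b' :: s.
Proof.
elim: vs b => [|i vs IH] b hb; first by exists b.
have [b' hb' E] := IH Kvar isT; exists b' => //.
rewrite /encvs /= rrun_cons rrun_cat rstep_tab; [|by case: b hb..].
have -> : rtab b Kvar = Kvar by case: b hb.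
by rewrite rrun_const // => a /nseqP[-> _].
Qed.

Lemma rrun_coef z s : exists2 b, b \in [:: Kge; Kgt; Kvar] &
  rrun (Kplus :: s) (enc_int z) = b :: s.
Proof.
rewrite /enc_int; have [z0|z0|->] := ltgtP z 0.
- have [x E] : exists x, enc_nat `|z| = Kone :: x by apply: enc_nat_head; lia.
  have := enc_nat_dig `|z|; rewrite E => hx.
  by exists Kge => //; rewrite !rrun_cons !rstep_tab //= rrun_digits.
- have [x E] : exists x, enc_nat `|z| = Kone :: x by apply: enc_nat_head; lia.
  have := enc_nat_dig `|z|; rewrite E => hx.
  by exists Kge => //; rewrite !rrun_cons !rstep_tab //= rrun_digits.
- by exists Kgt => //; rewrite (_ : enc_nat _ = [:: Kzero]) // rrun_cons rstep_tab.
Qed.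

Lemma rrun_poly g b s : rclose b -> exists2 b', rclose b' & rrun (b :: s) (encp g) = b' :: s.
Proof.
elim: g b => [|[z vs] g IH] b hb; first by exists b.
rewrite /encp /= rrun_cons rstep_tab; [|by case: b hb..].
have -> : rtab b Kplus = Kplus by case: b hb.
rewrite !rrun_cat; have [b1 hb1 ->] := rrun_coef z s.
have [b2 hb2 ->] := rrun_vars vs s hb1.
by apply: IH; case: b2 hb2.
Qed.

Lemma encs_cons f : exists a x, encs f = a :: x /\ isfor a.
Proof. by case: f => [c g|f|f g|f g] /=; eexists; eexists; split=> //; case: c. Qed.

Lemma rrun_next b s f : rclose b -> rrun (b :: Kand :: s) (encs f) = rrun (Kand :: s) (encs f).
Proof.
move=> hb; have [a [x [-> ha]]] := encs_cons f.
by rewrite !rrun_cons rstep_next // rstep_form.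
Qed.

Lemma rrun_sa f s : exists2 b, rclose b & rrun (Kand :: s) (encs f) = b :: s.
Proof.
elim: f s => [c g|f IH|f IHf g IHg|f IHf g IHg] s; rewrite [encs _]/= rrun_cons rstep_form.
- have -> : rform (enc_cmp c) = [:: Kle] by case: c.
  exact: rrun_poly.
- exact: IH.
- by rewrite rrun_cat; have [b hb ->] := IHf (Kand :: s); rewrite rrun_next.
- by rewrite rrun_cat; have [b hb ->] := IHf (Kand :: s); rewrite rrun_next.
Qed.

Lemma rrun_instance d f p q : 0 < q -> rfin (rrun [:: Ktick] (enc_instance d f p q)).
Proof.
move=> hq; rewrite /enc_instance rrun_cat.
have -> : rrun [:: Ktick] (nseq d Ktick) = [:: Ktick] by elim: d.
rewrite rrun_cat.
have -> : rrun (rrun [:: Ktick] (enc_int p)) (Kslash :: enc_nat q ++ encs f)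
    = rrun [:: Kall] (enc_nat q ++ encs f).
  rewrite /enc_int; have [z0|z0|->] := ltgtP p 0.
  - have [x E] : exists x, enc_nat `|p| = Kone :: x by apply: enc_nat_head; lia.
    have := enc_nat_dig `|p|; rewrite E => hx.
    by rewrite !rrun_cons !(@rstep_tab _ [::]) //= (@rrun_digits _ [::]).
  - have [x E] : exists x, enc_nat `|p| = Kone :: x by apply: enc_nat_head; lia.
    have := enc_nat_dig `|p|; rewrite E => hx.
    by rewrite !rrun_cons !(@rstep_tab _ [::]) //= (@rrun_digits _ [::]).
  - by rewrite (_ : enc_nat _ = [:: Kzero]).
have [x E] := enc_nat_head hq; have := enc_nat_dig q; rewrite E => hx.
rewrite [_ ++ _]/= rrun_cons (@rstep_tab _ [::]) // rrun_cat (@rrun_digits _ [::]) //.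
have -> : rrun [:: Kone] (encs f) = rrun [:: Kand] (encs f).
  have [a [y [-> ha]]] := encs_cons f; rewrite !rrun_cons rstep_form cats0 /=.
  by rewrite /rtop ha.
by have [b hb ->] := rrun_sa f [::].
Qed.

Fixpoint derivess (s w : word) : Prop :=
  match s with
  | [::] => w = [::]
  | Kand :: s => exists f w', w = encs f ++ w' /\ derivess s w'
  | _ => False
  end.

(** For each stack top: what completes the current atom, followed by what the stack below
    expects. *)
Definition rshape (b : token) (s w : word) : Prop :=
  match b with
  | Kand => derivess (Kand :: s) w
  | Kle => exists g w', w = encp g ++ w' /\ derivess s w'
  | Kplus => exists z vs g w', w = enc_int z ++ encvs vs ++ encp g ++ w' /\ derivess s w'
  | Klt => exists x vs g w', [/\ w = Kone :: x ++ encvs vs ++ encp g ++ w', all isdig x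
             & derivess s w']
  | Kge => exists x vs g w', [/\ w = x ++ encvs vs ++ encp g ++ w', all isdig x
             & derivess s w']
  | Kgt => exists vs g w', w = encvs vs ++ encp g ++ w' /\ derivess s w'
  | Kvar => exists i vs g w', w = nseq i Ktick ++ encvs vs ++ encp g ++ w' /\ derivess s w'
  | _ => True
  end.

Lemma rshape_nil b s w : rclose b -> derivess s w -> rshape b s w.
Proof.
case: b => //= _ h.
- by exists 0, [::], [::], w.
- by exists [::], w.
- by exists [::], [::], [::], w.
- by exists [::], [::], w.
Qed.

Lemma enc_int_pos x : all isdig x -> enc_int (bval (Kone :: x)) = Kone :: x.
Proof. by move=> hx; rewrite /enc_int /= enc_nat_bval. Qed.

Lemma enc_int_neg x : all isdig x -> enc_int (- (bval (Kone :: x))%:Z) = [:: Kminus, Kone & x].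
Proof.
move=> hx; have := bval_gt0 x; rewrite /enc_int => h.
rewrite ifT; last by lia.
by rewrite abszN /= enc_nat_bval.
Qed.

Lemma rshape_sound w b s :
  b \in [:: Kand; Kle; Kplus; Klt; Kge; Kgt; Kvar] -> rfin (rrun (b :: s) w) -> rshape b s w.
Proof.
elim: w b s => [|a w IH] b s.
  by rewrite /rrun; case: s => // _ h; apply: rshape_nil.
have HF s' : rfin (rrun (Kand :: s') (a :: w)) -> derivess (Kand :: s') (a :: w).
  rewrite rrun_cons rstep_form.
  have atom c : enc_cmp c = a -> rfin (rrun (Kle :: s') w) ->
      exists f w', a :: w = encs f ++ w' /\ derivess s' w'.
    by move=> <- /IH[] // g [w' [-> h]]; exists (SaAtom c g), w'.
  have two : rfin (rrun [:: Kand, Kand & s'] w) ->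
      exists f g w', w = encs f ++ encs g ++ w' /\ derivess s' w'.
    by move=> /IH[] // f [w' [-> [g [w'' [-> h]]]]]; exists f, g, w''.
  case: (a) (atom) => //= at_; try by move/rfin_error.
  - by move/two => [f [g [w' [-> h]]]]; exists (SaAnd f g), w'; rewrite /= catA.
  - by move/two => [f [g [w' [-> h]]]]; exists (SaOr f g), w'; rewrite /= catA.
  - by move/IH=> [] // f [w' [-> h]]; exists (SaNot f), w'.
  - exact: (at_ Clt).
  - exact: (at_ Cle).
  - exact: (at_ Ceq).
  - exact: (at_ Cge).
  - exact: (at_ Cgt).
move=> hb.
(* A formula token behind a complete atom ends that atom and is read by the pending formula below
   it. *)
have [hcl|hcl] := boolP (rclose b && isfor a).
  case/andP: hcl => cb fa; case: s => [|c s].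
    have b1 : (b == Kand) || (b == Kone) && isfor a = false by case: (b) cb.
    rewrite rrun_cons /= /rtop b1; suff -> : rtab b a = Knot by move/rfin_error.
    by case: (b) cb => //; case: (a) fa.
  have [->|hc] := eqVneq c Kand; last first.
    by rewrite rrun_cons /= cb fa (negbTE hc) => /rfin_error.
  rewrite rrun_cons rstep_next // -rstep_form -rrun_cons => /HF.
  exact: rshape_nil.
have [->|bA] := eqVneq b Kand; first exact: HF.
rewrite rrun_cons rstep_tab //; last by case: (b) hb.
have vcons (i : nat) vs (x : word) : Kvar :: nseq i Ktick ++ encvs vs ++ x = encvs (i :: vs) ++ x.
  by rewrite /encvs /= catA.
have pcons z vs g (x : word) : Kplus :: enc_int z ++ encvs vs ++ encp g ++ x = encp ((z, vs) :: g) ++ x.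
  by rewrite /encp /= -!catA.
have plus : rfin (rrun (Kplus :: s) w) -> exists g w', Kplus :: w = encp g ++ w' /\ derivess s w'.
  by move=> /IH[] // z [vs [g [w' [-> h]]]]; exists ((z, vs) :: g), w'; rewrite pcons.
have var : rfin (rrun (Kvar :: s) w) ->
    exists vs g w', Kvar :: w = encvs vs ++ encp g ++ w' /\ derivess s w'.
  by move=> /IH[] // i [vs [g [w' [-> h]]]]; exists (i :: vs), g, w'; rewrite vcons.
have digs : rfin (rrun (Kge :: s) w) -> exists x vs g w',
    [/\ w = x ++ encvs vs ++ encp g ++ w', all isdig x & derivess s w'].
  by move=> /IH; apply.
case: b hb {hcl} bA => // _ _; case: a {HF} => //=; try by move/rfin_error.
- by move/var => [vs [g [w' [-> h]]]]; exists 0, vs, g, w'.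
- by move/IH => [] // i [vs [g [w' [-> h]]]]; exists i.+1, vs, g, w'.
- by move/plus => [g [w' [-> h]]]; exists 0, [::], g, w'.
- move=> /IH[] // vs [g [w' [-> h]]]; exists 0, vs, g, w'; split=> //.
- move/digs => [x [vs [g [w' [-> hx h]]]]]; exists (bval (Kone :: x)), vs, g, w'.
  by rewrite enc_int_pos.
- move=> /IH[] // x [vs [g [w' [-> hx h]]]]; exists (- (bval (Kone :: x))%:Z)%R, vs, g, w'.
  by rewrite enc_int_neg.
- by move/digs => [x [vs [g [w' [-> hx h]]]]]; exists x, vs, g, w'.
- by move/var => [vs [g [w' [-> h]]]]; exists [::], vs, g, w'.
- by move/digs => [x [vs [g [w' [-> hx h]]]]]; exists (Kzero :: x), vs, g, w'.
- by move/digs => [x [vs [g [w' [-> hx h]]]]]; exists (Kone :: x), vs, g, w'.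
- by move/plus => [g [w' [-> h]]]; exists [::], [::], g, w'.
- by move/plus => [g [w' [-> h]]]; exists [::], g, w'.
Qed.

Lemma instance_sound w : rfin (rrun [:: Ktick] w) ->
  exists d f p q, w = enc_instance d f p q /\ 0 < q.
Proof.
(* The header is treated from its end backwards: rest of the denominator, whole denominator, rest of
   the numerator. *)
have HE x : rfin (rrun [:: Kone] x) -> exists y f, x = y ++ encs f /\ all isdig y.
  elim: x => [|a x IH] //; rewrite rrun_cons.
  have [ha|ha] := boolP (isfor a).
    have -> : rstep a [:: Kone] = rstep a [:: Kand] by rewrite /= /rtop ha.
    rewrite -rrun_cons => /rshape_sound[] // f [w' [-> ->]].
    by exists [::], f; rewrite cats0.
  rewrite rstep_tab //; case: a ha => //= _; try by move/rfin_error.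
  - by move/IH => [y [f [-> h]]]; exists (Kzero :: y), f.
  - by move/IH => [y [f [-> h]]]; exists (Kone :: y), f.
have HQ x : rfin (rrun [:: Kall] x) -> exists q f, x = enc_nat q ++ encs f /\ 0 < q.
  case: x => [|a x] //; rewrite rrun_cons rstep_tab //; case: a => //=; try by move/rfin_error.
  move/HE => [y [f [-> h]]]; exists (bval (Kone :: y)), f.
  by rewrite enc_nat_bval // bval_gt0.
have HD x : rfin (rrun [:: Kslash] x) -> exists y q f,
    [/\ x = y ++ Kslash :: enc_nat q ++ encs f, all isdig y & 0 < q].
  elim: x => [|a x IH] //; rewrite rrun_cons rstep_tab //; case: a => //=; try by move/rfin_error.
  - by move/IH => [y [q [f [-> h hq]]]]; exists (Kzero :: y), q, f.
  - by move/IH => [y [q [f [-> h hq]]]]; exists (Kone :: y), q, f.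
  - by move/HQ => [q [f [-> hq]]]; exists [::], q, f.
elim: w => [|a w IH] //; rewrite rrun_cons rstep_tab //; case: a => //=; try by move/rfin_error.
- by move/IH => [d [f [p [q [-> hq]]]]]; exists d.+1, f, p, q.
- case: w {IH} => [|a w] //; rewrite rrun_cons rstep_tab //; case: a => //=; try by move/rfin_error.
  by move/HQ => [q [f [-> hq]]]; exists 0, f, 0%R, q.
- move/HD => [y [q [f [-> h hq]]]]; exists 0, f, (bval (Kone :: y)), q.
  by rewrite /enc_instance /= enc_int_pos.
- case: w {IH} => [|a w] //; rewrite rrun_cons rstep_tab //; case: a => //=; try by move/rfin_error.
  move/HD => [y [q [f [-> h hq]]]]; exists 0, f, (- (bval (Kone :: y))%:Z)%R, q.
  by rewrite /enc_instance /= enc_int_neg.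
Qed.

(** * Negation normal form on words *)

Definition ispol (a : token) : bool := ~~ isfor a.
Definition ismon (a : token) : bool := ispol a && (a != Kplus).

Definition neg_cmp (c : cmp) : cmp :=
  match c with Clt => Cge | Cle => Cgt | Ceq => Ceq | Cge => Clt | Cgt => Cle end.

(** Matrices of sentences have no negation and no disequality, so a negated equation splits into two
    strict inequalities. *)
Fixpoint nnf (b : bool) (f : rsa) : rsa :=
  match f with
  | SaAtom c g =>
      if b then SaAtom c g
      else if c is Ceq then SaOr (SaAtom Clt g) (SaAtom Cgt g)
      else SaAtom (neg_cmp c) g
  | SaNot f => nnf (~~ b) f
  | SaAnd f g => if b then SaAnd (nnf b f) (nnf b g) else SaOr (nnf b f) (nnf b g)
  | SaOr f g => if b then SaOr (nnf b f) (nnf b g) else SaAnd (nnf b f) (nnf b g)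
  end.

(* The stack holds the polarities, [Kone] or [Kzero], of the pending formulas. *)
Definition nstep (a : token) (st : word) : word :=
  if st is b :: s then
    (match a with
     | Kand | Kor => [:: b; b]
     | Knot => [:: if b == Kone then Kzero else Kone]
     | Klt | Kle | Keq | Kge | Kgt => [::]
     | _ => [:: b]
     end) ++ s
  else [::].

Definition nemit (a : token) (st u v : word) : word :=
  if hd_test (pred1 Kone) false st then (if a == Knot then [::] else [:: a])
  else match a with
    | Kand => [:: Kor]
    | Kor => [:: Kand]
    | Knot => [::]
    | Klt => [:: Kge]
    | Kle => [:: Kgt]
    (* The polynomial that follows in the input is copied anyway and belongs to [Kgt]; lookahead
       provides the copy for [Klt]. *)
    | Keq => [:: Kor; Klt] ++ lead ispol v ++ [:: Kgt]
    | Kge => [:: Klt]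
    | Kgt => [:: Kle]
    | _ => [:: a]
    end.

(** The initial polarity [Kzero] negates the formula, because membership of the points in the set is
    a premise of the sentence. *)
Definition nnf_word (w : word) : word := transd nstep nemit [:: Kzero] [::] w.

Lemma fp_nnf_word m f : fp m f -> fp m (fun e => nnf_word (f e)).
Proof.
move=> hf; apply: (fp_transd (emit := fun _ => nemit)) hf _; first exact: slow_table1.
move=> a; apply: fp_if.
- by apply: fpb_hd; apply: fp_arg.
- exact: fp_const.
by case: a; try exact: fp_const; apply: fp_cat; [exact: fp_const|apply: fp_cat;
  [apply: fp_lead; exact: fp_arg|exact: fp_const]].
Qed.

Lemma encp_pol g : all ispol (encp g).
Proof.
rewrite /encp; elim: g => //= -[z vs] g IH /=; rewrite !all_cat IH andbT.
apply/andP; split.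
  have h m : all ispol (enc_nat m) by apply/allP => a /(allP (enc_nat_dig m)); case: a.
  by rewrite /enc_int; case: ifP => _ //=.
by elim: vs => //= i vs; rewrite all_cat => ->; rewrite all_nseq orbT.
Qed.

Lemma lead_pol g r : ends r -> lead ispol (encp g ++ r) = encp g.
Proof.
move=> hr; rewrite lead_cat ?encp_pol // lead_stop ?cats0 //.
by case: r hr => //= a r; rewrite /ends /ispol /= negbK.
Qed.

Lemma nnf_pol st u x r : all ispol x ->
  transd nstep nemit st u (x ++ r) = x ++ transd nstep nemit st (rev x ++ u) r.
Proof.
elim: x u => // a x IH u /= /andP[ha hx].
rewrite rev_cons cat_rcons -IH //.
have -> : nemit a st u (x ++ r) = [:: a].
  by rewrite /nemit; case: (hd_test _ _ _); case: (a) ha.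
by have -> : nstep a st = st by case: (st) => // b s; case: (a) ha.
Qed.

Lemma nnf_wordP b st u f r : ends r ->
  transd nstep nemit (bit b :: st) u (encs f ++ r)
  = encs (nnf b f) ++ transd nstep nemit st (rev (encs f) ++ u) r.
Proof.
elim: f b st u r => [c g|f IH|f IHf g IHg|f IHf g IHg] b st u r hr;
  rewrite [encs _ ++ r]/= transd_cons.
- have -> : nstep (enc_cmp c) (bit b :: st) = st by case: c.
  rewrite nnf_pol ?encp_pol // [encs (SaAtom c g)]/= rev_cons cat_rcons catA; congr (_ ++ _).
  case: b; first by rewrite /nemit /=; case: c.
  by case: c; rewrite /nemit //= lead_pol // -catA.
- have -> : nstep Knot (bit b :: st) = bit (~~ b) :: st by case: b.
  rewrite IH // [encs (SaNot f)]/= rev_cons cat_rcons.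
  by case: b.
- have -> : nstep Kand (bit b :: st) = [:: bit b, bit b & st] by [].
  rewrite -catA IHf ?encs_ends // IHg // [encs (SaAnd f g)]/= rev_cons cat_rcons rev_cat -catA.
  by case: b; rewrite /= -catA.
- have -> : nstep Kor (bit b :: st) = [:: bit b, bit b & st] by [].
  rewrite -catA IHf ?encs_ends // IHg // [encs (SaOr f g)]/= rev_cons cat_rcons rev_cat -catA.
  by case: b; rewrite /= -catA.
Qed.

Lemma nnf_wordE f : nnf_word (encs f) = encs (nnf false f).
Proof. by rewrite /nnf_word -[encs f]cats0 (nnf_wordP false) //= cats0. Qed.

Fixpoint positive (f : rsa) : bool :=
  match f with
  | SaAtom _ _ => true
  | SaNot _ => false
  | SaAnd f g | SaOr f g => positive f && positive g
  end.

Lemma nnf_positive b f : positive (nnf b f).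
Proof.
by elim: f b => [c g|f IH|f IHf g IHg|f IHf g IHg] [] //=; rewrite ?IHf ?IHg //; case: c.
Qed.

Lemma nnf_sbd N b f : sbd N (nnf b f) = sbd N f.
Proof.
elim: f b => [c g|f IH|f IHf g IHg|f IHf g IHg] [] //=; rewrite ?IHf ?IHg //.
by case: c => //=; rewrite andbb.
Qed.

(** * Translation of expanded polynomials into terms *)

Fixpoint flatv (F : token -> word -> word) (w : word) : word :=
  if w is a :: v then F a v ++ flatv F v else [::].

Lemma flatx_flatv F u w : flatx (fun a _ v => F a v) u w = flatv F w.
Proof. by elim: w u => //= a w IH u; rewrite IH. Qed.

Definition cnt (x y : token) (w : word) : word :=
  flatten [seq if a == x then [:: y] else [::] | a <- w].

Lemma cnt_cat x y w w' : cnt x y (w ++ w') = cnt x y w ++ cnt x y w'.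
Proof. by rewrite /cnt map_cat flatten_cat. Qed.

Lemma cnt_none x y w : all (predC1 x) w -> cnt x y w = [::].
Proof. by rewrite /cnt; elim: w => //= a w IH /andP[/negbTE -> /IH ->]. Qed.

(* Horner's scheme in prefix notation: one copy of [2 * _ + _] per digit. *)
Definition horner : word := [:: Kplus; Ktimes; Kplus; Kone; Kone].
Definition num (x : word) : word := rep horner x ++ [:: Kzero].

(** Left-nested sums and products have all their operators in front, so lookahead suffices: a
    comparison emits one [Kplus] per monomial, a monomial one [Ktimes] per variable. A sign becomes
    a product with variable 0, and [o] shifts the indices. *)
Definition tr_emit (o : word) (a : token) (v : word) : word :=
  match a with
  | Klt | Kle | Keq | Kge | Kgt => a :: cnt Kplus Kplus (lead ispol v) ++ [:: Kzero]
  | Kplus => cnt Kvar Ktimes (lead ismon v)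
             ++ if hd_test (pred1 Kminus) false v then [::] else num (lead isdig v)
  | Kminus => [:: Ktimes; Kvar] ++ num (lead isdig v)
  | Kvar => Kvar :: o
  | _ => [:: a]
  end.

Definition tr_word (o w : word) : word := flatv (tr_emit o) w.

Lemma fp_num m f : fp m f -> fp m (fun e => num (f e)).
Proof. by move=> h; apply: fp_cat; [apply: fp_rep h; exact: fp_const|exact: fp_const]. Qed.

Lemma fp_cnt m x y f : fp m f -> fp m (fun e => cnt x y (f e)).
Proof. exact: fp_cmap. Qed.

Lemma fp_tr_word m f g : fp m f -> fp m g -> fp m (fun e => tr_word (f e) (g e)).
Proof.
move=> hf hg; have H : fp m (fun e => flatx (fun a _ v => tr_emit (f e) a v) [::] (g e)).
  apply: (fp_flatx (F := fun e a _ v => tr_emit (f e) a v)) hg _ => a.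
  have hv : fp m.+2 (fun e => arg e 1) by apply: fp_arg.
  have hm c : fp m.+2 (fun e => c :: cnt Kplus Kplus (lead ispol (arg e 1)) ++ [:: Kzero]).
    apply: fp_cons; apply: fp_cat; last exact: fp_const.
    by apply: fp_cnt; apply: fp_lead.
  have hn : fp m.+2 (fun e => num (lead isdig (arg e 1))) by apply: fp_num; apply: fp_lead.
  case: a; rewrite /tr_emit; try exact: fp_const; try exact: hm.
  - by apply: fp_cons; exact: (fp_drop 2 hf).
  - apply: fp_cat; first by apply: fp_cnt; apply: fp_lead.
    by apply: fp_if; [apply: fpb_hd|exact: fp_nil|].
  - by do 2!apply: fp_cons; apply: hn.
by apply: fp_ext H => e _; rewrite flatx_flatv.
Qed.

Definition two : rterm := RAdd ROne ROne.
Definition bitT (a : token) : rterm := if a == Kone then ROne else RZero.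
Definition numT (x : word) : rterm :=
  foldl (fun t a => RAdd (RMul two t) (bitT a)) RZero x.
Definition coefT (z : int) : rterm :=
  if (z < 0)%R then RMul (RVar 0) (numT (enc_nat `|z|)) else numT (enc_nat `|z|).
Definition monT (o : nat) (m : int * seq nat) : rterm :=
  foldl (fun t i => RMul t (RVar (o + i))) (coefT m.1) m.2.
Definition polT (o : nat) (g : rpoly) : rterm :=
  foldl (fun t m => RAdd t (monT o m)) RZero g.

Fixpoint trF (o : nat) (f : rsa) : rqf :=
  match f with
  | SaAtom c g => RAtom c (polT o g)
  | SaNot f => trF o f
  | SaAnd f g => RAnd (trF o f) (trF o g)
  | SaOr f g => ROr (trF o f) (trF o g)
  end.

Lemma rep_rcons x w a : rep x (rcons w a) = x ++ rep x w.
Proof.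
rewrite /rep; elim: w => //= b w ->.
by [].
Qed.

(** The digits are themselves codes of the terms 0 and 1, so it suffices to put the Horner operators
    in front of them. *)
Lemma enct_num x : all isdig x -> enct (numT x) = num x ++ x.
Proof.
elim/last_ind: x => // x a IH; rewrite all_rcons => /andP[ha /IH E].
have Ea : enct (bitT a) = [:: a] by case: a ha.
rewrite /numT foldl_rcons -/(numT x) /num rep_rcons -cats1 [enct _]/= Ea E /num.
by rewrite -!catA.
Qed.

Lemma enct_mon o m : enct (monT o m)
  = nseq (size m.2) Ktimes ++ enct (coefT m.1) ++ flatten [seq encv (o + i) | i <- m.2].
Proof.
case: m => z vs; rewrite /monT /=; elim/last_ind: vs => [|vs i IH]; first by rewrite cats0.
rewrite foldl_rcons /= IH size_rcons map_rcons flatten_rcons -!catA.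
by [].
Qed.

Lemma enct_pol o g : enct (polT o g)
  = nseq (size g) Kplus ++ Kzero :: flatten [seq enct (monT o m) | m <- g].
Proof.
rewrite /polT; elim/last_ind: g => [|g m IH] //.
by rewrite foldl_rcons /= IH size_rcons map_rcons flatten_rcons -!catA.
Qed.

Section TrWord.
Variable k : nat.
Let o := nseq k Ktick.
Local Notation T := (flatv (tr_emit o)).

Lemma tr_digits x r : all isdig x -> T (x ++ r) = x ++ T r.
Proof. by elim: x => //= a x IH /andP[ha /IH ->]; case: a ha. Qed.

Lemma tr_vars vs r : T (encvs vs ++ r) = flatten [seq encv (k + i) | i <- vs] ++ T r.
Proof.
elim: vs => //= i vs IH; rewrite -!catA -IH; congr cons.
rewrite nseqD -catA; congr (_ ++ _); elim: i => //= i ->.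
by [].
Qed.

Lemma lead_digs z vs r : hd_test (fun a => isfor a || (a == Kplus)) true r ->
  lead isdig (enc_nat z ++ encvs vs ++ r) = enc_nat z.
Proof.
move=> hr; rewrite lead_cat ?enc_nat_dig // lead_stop ?cats0 //.
by case: vs => //=; case: r hr => //= -[].
Qed.

Lemma tr_mon z vs r : hd_test (fun a => isfor a || (a == Kplus)) true r ->
  T (Kplus :: enc_int z ++ encvs vs ++ r) = enct (monT k (z, vs)) ++ T r.
Proof.
move=> hr; have hm : lead ismon (enc_int z ++ encvs vs ++ r) = enc_int z ++ encvs vs.
  rewrite catA lead_cat ?lead_stop ?cats0 //; first by case: r hr => //= -[].
  rewrite all_cat; apply/andP; split.
    have h m : all ismon (enc_nat m) by apply/allP => a /(allP (enc_nat_dig m)); case: a.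
    by rewrite /enc_int; case: ifP => _ //=.
  by elim: vs => //= i vs; rewrite all_cat => ->; rewrite all_nseq orbT.
have hc : cnt Kvar Ktimes (enc_int z ++ encvs vs) = nseq (size vs) Ktimes.
  rewrite cnt_cat (cnt_none _ (enc_int_nonvar z)) /=.
  elim: vs {hm} => // i vs IH.
  rewrite -[encvs (i :: vs)]/(encv i ++ encvs vs) cnt_cat IH.
  have -> // : cnt Kvar Ktimes (encv i) = [:: Ktimes].
  by rewrite /cnt /=; congr cons; elim: i.
rewrite [LHS]/= hm hc enct_mon -!catA; congr (_ ++ _).
rewrite /coefT /enc_int; case: (z < 0)%R => /=.
  by rewrite lead_digs // enct_num ?enc_nat_dig // tr_digits ?enc_nat_dig // tr_vars -!catA.
have -> : hd_test (pred1 Kminus) false (enc_nat `|z| ++ encvs vs ++ r) = false.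
  by have [a [x [-> ]]] := enc_nat_cons `|z|; case: a.
by rewrite lead_digs // enct_num ?enc_nat_dig // tr_digits ?enc_nat_dig // tr_vars -!catA.
Qed.

Lemma tr_poly g r : ends r ->
  T (encp g ++ r) = flatten [seq enct (monT k m) | m <- g] ++ T r.
Proof.
move=> hr; elim: g => // -[z vs] g IH.
have -> : encp ((z, vs) :: g) ++ r = Kplus :: enc_int z ++ encvs vs ++ encp g ++ r.
  by rewrite /encp /= -!catA.
by rewrite tr_mon ?encp_stop // IH catA.
Qed.

Lemma tr_wordP f r : positive f -> ends r -> T (encs f ++ r) = encq (trF k f) ++ T r.
Proof.
elim: f r => //= [c g|f IHf g IHg|f IHf g IHg] r.
- move=> _ hr; have -> : tr_emit o (enc_cmp c) (encp g ++ r)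
      = enc_cmp c :: cnt Kplus Kplus (encp g) ++ [:: Kzero].
    by case: c; rewrite /= lead_pol.
  rewrite tr_poly // enct_pol /= -!catA /=; congr (_ :: _ ++ _).
  rewrite /encp; elim: g => //= -[z vs] g IH /=.
  rewrite -cat1s !cnt_cat IH (cnt_none _ (w := enc_int z)) ?(cnt_none _ (w := encvs vs)) //.
    by elim: vs => //= i vs; rewrite all_cat => ->; rewrite all_nseq orbT.
  have h m : all (predC1 Kplus) (enc_nat m) by apply/allP => a /(allP (enc_nat_dig m)); case: a.
  by rewrite /enc_int; case: ifP => _ //=.
- by case/andP=> hf hg hr; rewrite -catA IHf ?encs_ends // IHg // -catA.
- by case/andP=> hf hg hr; rewrite -catA IHf ?encs_ends // IHg // -catA.
Qed.

End TrWord.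

Lemma tr_wordE k f : positive f -> tr_word (nseq k Ktick) (encs f) = encq (trF k f).
Proof. by move=> hf; rewrite /tr_word -[encs f]cats0 tr_wordP //= cats0. Qed.

Lemma numT_bd N x : tbd N (numT x).
Proof.
elim/last_ind: x => // x a IH; rewrite /numT foldl_rcons /= -/(numT x) IH.
by rewrite /bitT; case: eqP.
Qed.

Lemma polT_bd N o d g : 0 < N -> o + d <= N -> pbd d g -> tbd N (polT o g).
Proof.
move=> hN hd; rewrite /polT /pbd -[all _ g]andTb -[true]/(tbd N RZero).
elim: g RZero => [|[z vs] g IH] t /=; first by rewrite andbT.
case/and3P=> ht hv hg; apply: IH; rewrite /= ht hg /monT /= andbT.
have : tbd N (coefT z) by rewrite /coefT; case: ifP => _ /=; rewrite ?hN numT_bd.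
elim: vs (coefT z) hv => //= i vs IHv t' /andP[hi hv] ht'; apply: IHv => //=.
by rewrite ht' /=; lia.
Qed.

Lemma trF_bd N o d f : 0 < N -> o + d <= N -> sbd d f -> qbd N (trF o f).
Proof.
move=> hN hd; elim: f => //= [c g|f IHf g IHg /andP[/IHf -> /IHg ->]|f IHf g IHg /andP[/IHf -> /IHg ->]] //.
exact: polT_bd.
Qed.

Section NnfSemantics.
Variable R : realType.
Local Open Scope ring_scope.
Implicit Types v : nat -> R.

Lemma ssat_nnf v b f : ssat v (nnf b f) = (ssat v f == b).
Proof.
elim: f b => [c g|f IH|f IHf g IHg|f IHf g IHg] b /=.
- case: b => /=; first by rewrite eqb_id.
  by rewrite eqbF_neg; case: c => /=; case: (ltgtP (peval v g) 0).
- by rewrite IH; case: b; case: (ssat v f).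
- by case: b; rewrite /= IHf IHg; case: (ssat v f); case: (ssat v g).
- by case: b; rewrite /= IHf IHg; case: (ssat v f); case: (ssat v g).
Qed.

Lemma teval_num v x : all isdig x -> teval v (numT x) = (bval x)%:R.
Proof.
elim/last_ind: x => // x a IH; rewrite all_rcons => /andP[ha /IH E].
rewrite /numT foldl_rcons /= -/(numT x) E bval_rcons natrD -addnn natrD /bitT.
by case: a ha => //= _; ring.
Qed.

Lemma teval_coef v z : v 0%N = -1 -> teval v (coefT z) = z%:~R.
Proof.
move=> v0; rewrite /coefT; case: ifP => hz /=.
  rewrite v0 teval_num ?enc_nat_dig // enc_natK mulN1r.
  by rewrite -[in RHS](opprK z) -(ltz0_abs hz) mulrNz.
rewrite teval_num ?enc_nat_dig // enc_natK.
by rewrite -[in RHS](gez0_abs (_ : 0 <= z)) // leNgt hz.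
Qed.

Lemma teval_pol v o g : v 0%N = -1 -> teval v (polT o g) = peval (fun i => v (o + i)%N) g.
Proof.
move=> v0; rewrite /polT -[RHS]add0r -[X in X + _]/(teval v RZero).
elim: g RZero => [|[z vs] g IH] t /=; first by rewrite peval_nil addr0.
rewrite IH peval_cons /= addrA; congr (_ + _ + _).
rewrite /monT /= -(teval_coef z v0).
elim: vs (coefT z) => [|i vs IHv] t' /=; first by rewrite big_nil mulr1.
by rewrite IHv big_cons /= mulrA.
Qed.

Lemma rsat_tr v o f : positive f -> v 0%N = -1 ->
  rsat v (trF o f) = ssat (fun i => v (o + i)%N) f.
Proof.
move=> + v0; elim: f => //= [c g _|f IHf g IHg /andP[/IHf -> /IHg ->]|f IHf g IHg /andP[/IHf -> /IHg ->]] //.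
by rewrite teval_pol.
Qed.

End NnfSemantics.

(* Variable [0] stands for [-1], variable [1] for the radius; the [i]-th point
   and its weight occupy the block of [d + 1] variables from [2 + i (d + 1)]. *)
Definition idx (d i k : nat) : nat := 2 + i * d.+1 + k.

Definition sumT (s : seq rterm) : rterm := foldr RAdd RZero s.
Definition sqT (t : rterm) : rterm := RMul t t.
(** The constant [- 2 * r ^+ 2] of the quadratic form. *)
Definition r2T : rterm := RMul (RVar 0) (RMul two (sqT (RVar 1))).

Definition distT (d i j : nat) : rterm :=
  sumT [seq sqT (RAdd (RVar (idx d i k)) (RMul (RVar 0) (RVar (idx d j k)))) | k <- iota 0 d].
Definition pairT (d i j : nat) : rterm :=
  RMul (RMul (sqT (RVar (idx d i d))) (sqT (RVar (idx d j d)))) (RAdd (distT d i j) r2T).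
Definition mainT (d : nat) : rterm :=
  sumT [seq sumT [seq pairT d i j | j <- iota 0 d.+2] | i <- iota 0 d.+2].
Definition rhoT (p : int) (q : nat) : rterm :=
  RAdd (RMul (numT (enc_nat q)) (RVar 1)) (RMul (RVar 0) (coefT p)).

(** The implication from [t = 0] to [f], without negation. *)
Definition neqF (t : rterm) (f : rqf) : rqf := ROr (RAtom Clt t) (ROr (RAtom Cgt t) f).

Definition membershipF (d : nat) (f : rsa) (p : int) (q : nat) : rqf :=
  neqF (RAdd (RVar 0) ROne) (neqF (rhoT p q)
    (foldr (fun i g => ROr (trF (idx d i 0) (nnf false f)) g)
       (RAnd (RAtom Cge (RVar 1)) (RAtom Cle (mainT d))) (iota 0 d.+2))).

(** The start of a block in unary, where the length of [u] is the index of the point. For length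
    [d + 2] it is the number of quantifiers. *)
Definition offs (dT u : word) : word := [:: Ktick; Ktick] ++ rep (Ktick :: dT) u.
Definition yw (dT u x : word) : word := Kvar :: offs dT u ++ x.
Definition diffw (dT ui uj uk : word) : word :=
  Kplus :: yw dT ui uk ++ [:: Ktimes; Kvar] ++ yw dT uj uk.
Definition sumk (dT ui uj : word) : word :=
  flatx (fun _ uk _ => [:: Kplus; Ktimes] ++ diffw dT ui uj uk ++ diffw dT ui uj uk) [::] dT
  ++ [:: Kzero].
Definition pairw (dT ui uj : word) : word :=
  [:: Ktimes; Ktimes; Ktimes] ++ yw dT ui dT ++ yw dT ui dT ++ Ktimes :: yw dT uj dT
  ++ yw dT uj dT ++ Kplus :: sumk dT ui uj ++ enct r2T.
Definition sumj (dT ui : word) : word :=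
  flatx (fun _ uj _ => Kplus :: pairw dT ui uj) [::] [:: Ktick, Ktick & dT] ++ [:: Kzero].
Definition sumi (dT : word) : word :=
  flatx (fun _ ui _ => Kplus :: sumj dT ui) [::] [:: Ktick, Ktick & dT] ++ [:: Kzero].
Definition coefw (pS : word) : word :=
  if hd_test (pred1 Kminus) false pS then [:: Ktimes; Kvar] ++ num (behead pS) ++ behead pS
  else num pS ++ pS.
Definition rhow (pS qS : word) : word :=
  [:: Kplus; Ktimes] ++ (num qS ++ qS) ++ [:: Kvar; Ktick; Ktimes; Kvar] ++ coefw pS.
Definition neqw (x y : word) : word := [:: Kor; Klt] ++ x ++ [:: Kor; Kgt] ++ x ++ y.

Definition membership_body (dT pS qS fS : word) : word :=
  rep [:: Kall] (offs dT [:: Ktick, Ktick & dT])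
  ++ neqw [:: Kplus; Kvar; Kone] (neqw (rhow pS qS)
       (flatx (fun _ u _ => Kor :: tr_word (offs dT u) (nnf_word fS)) [::] [:: Ktick, Ktick & dT]
        ++ [:: Kand; Kge; Kvar; Ktick; Kle] ++ sumi dT)).

Definition isint (a : token) : bool := isdig a || (a == Kminus).

Definition membership_map (w : word) : word :=
  if rfin (rrun [:: Ktick] w) && vars_lt (size (lead istick w)) w then
    membership_body (lead istick w) (lead isint (after istick w))
      (lead isdig (behead (after isint (after istick w))))
      (after isdig (behead (after isint (after istick w))))
  else [::].

Lemma fp_offs m f g : fp m f -> fp m g -> fp m (fun e => offs (f e) (g e)).
Proof. by move=> hf hg; do 2!apply: fp_cons; apply: fp_rep hg; apply: fp_cons. Qed.

Lemma fp_yw m f g h : fp m f -> fp m g -> fp m h -> fp m (fun e => yw (f e) (g e) (h e)).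
Proof. by move=> hf hg hh; apply: fp_cons; apply: fp_cat hh; apply: fp_offs. Qed.

Lemma fp_diffw m f g h l : fp m f -> fp m g -> fp m h -> fp m l ->
  fp m (fun e => diffw (f e) (g e) (h e) (l e)).
Proof.
move=> hf hg hh hl; apply: fp_cons; apply: fp_cat; first exact: fp_yw.
by do 2!apply: fp_cons; apply: fp_yw.
Qed.

Lemma fp_sumk m f g h : fp m f -> fp m g -> fp m h -> fp m (fun e => sumk (f e) (g e) (h e)).
Proof.
move=> hf hg hh; apply: fp_cat; last exact: fp_const.
apply: (fp_flatx (F := fun e _ uk _ => [:: Kplus; Ktimes] ++ diffw (f e) (g e) (h e) uk
  ++ diffw (f e) (g e) (h e) uk)) => // _.
do 2!apply: fp_cons.
have H : fp m.+2 (fun e => diffw (f (drop 2 e)) (g (drop 2 e)) (h (drop 2 e)) (arg e 0)).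
  by apply: fp_diffw; [exact: (fp_drop 2 hf)|exact: (fp_drop 2 hg)|exact: (fp_drop 2 hh)|exact: fp_arg].
exact: fp_cat.
Qed.

Lemma fp_pairw m f g h : fp m f -> fp m g -> fp m h -> fp m (fun e => pairw (f e) (g e) (h e)).
Proof.
move=> hf hg hh; do 3!apply: fp_cons.
do 2!(apply: fp_cat; first exact: fp_yw); apply: fp_cons.
do 2!(apply: fp_cat; first exact: fp_yw); apply: fp_cons.
by apply: fp_cat; [exact: fp_sumk|exact: fp_const].
Qed.

Lemma fp_sumj m f g : fp m f -> fp m g -> fp m (fun e => sumj (f e) (g e)).
Proof.
move=> hf hg; apply: fp_cat; last exact: fp_const.
apply: (fp_flatx (F := fun e _ uj _ => Kplus :: pairw (f e) (g e) uj)); first by do 2!apply: fp_cons.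
move=> _; apply: fp_cons.
by apply: fp_pairw; [exact: (fp_drop 2 hf)|exact: (fp_drop 2 hg)|exact: fp_arg].
Qed.

Lemma fp_sumi m f : fp m f -> fp m (fun e => sumi (f e)).
Proof.
move=> hf; apply: fp_cat; last exact: fp_const.
apply: (fp_flatx (F := fun e _ ui _ => Kplus :: sumj (f e) ui)); first by do 2!apply: fp_cons.
by move=> _; apply: fp_cons; apply: fp_sumj; [exact: (fp_drop 2 hf)|exact: fp_arg].
Qed.

Lemma fp_rhow m f g : fp m f -> fp m g -> fp m (fun e => rhow (f e) (g e)).
Proof.
move=> hf hg; do 2!apply: fp_cons; apply: fp_cat.
  by apply: fp_cat => //; apply: fp_num.
do 4!apply: fp_cons; apply: fp_if; first exact: fpb_hd.
  by do 2!apply: fp_cons; apply: fp_cat; [apply: fp_num|]; apply: fp_behead.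
by apply: fp_cat => //; apply: fp_num.
Qed.

Lemma fp_neqw m f g : fp m f -> fp m g -> fp m (fun e => neqw (f e) (g e)).
Proof.
move=> hf hg; do 2!apply: fp_cons; apply: fp_cat => //; do 2!apply: fp_cons.
exact: fp_cat.
Qed.

Lemma fp_membership_map : fp1 membership_map.
Proof.
have w0 : fp 1 (fun e => arg e 0) by apply: fp_arg.
apply: fp_if; last exact: fp_nil.
  apply: fpb_and; last by apply: fpb_vars_lt => //; apply: fp_lead.
  by apply: fpb_rfin; apply: fp_foldl w0 _; [exact: slow_rstep|exact: fp_const].
have hd : fp 1 (fun e => lead istick (arg e 0)) by apply: fp_lead.
have h1 : fp 1 (fun e => after istick (arg e 0)) by apply: fp_after.
have hp : fp 1 (fun e => lead isint (after istick (arg e 0))) by apply: fp_lead.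
have h2 : fp 1 (fun e => behead (after isint (after istick (arg e 0)))).
  by apply: fp_behead; apply: fp_after.
have hq := fp_lead isdig h2; have hf := fp_after isdig h2.
have hc : fp 1 (fun e => [:: Ktick, Ktick & lead istick (arg e 0)]) by do 2!apply: fp_cons.
apply: fp_cat; first by apply: fp_rep; [exact: fp_const|apply: fp_offs].
apply: fp_neqw; first exact: fp_const.
apply: fp_neqw; first exact: fp_rhow.
apply: fp_cat; last by do 5!apply: fp_cons; apply: fp_sumi.
apply: (fp_flatx (F := fun e _ u _ => Kor :: tr_word (offs (lead istick (arg e 0)) u)
  (nnf_word (after isdig (behead (after isint (after istick (arg e 0)))))))) hc _ => _.
apply: fp_cons; apply: fp_tr_word; last by apply: fp_nnf_word; exact: (fp_drop 2 hf).
by apply: fp_offs; [exact: (fp_drop 2 hd)|exact: fp_arg].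
Qed.

Lemma offsE d u : offs (nseq d Ktick) u = nseq (2 + size u * d.+1) Ktick.
Proof.
suff H : rep (Ktick :: nseq d Ktick) u = nseq (size u * d.+1) Ktick by rewrite /offs H.
elim: u => // a u IH; rewrite [size _]/= mulSn nseqD -IH //.
Qed.

Lemma ywE d i x : yw (nseq d Ktick) (nseq i Ktick) (nseq x Ktick) = encv (idx d i x).
Proof. by rewrite /yw offsE size_nseq /encv /idx [in RHS]nseqD. Qed.

(** In a word of ticks the reversed prefix at a position is its index in unary, so [flatx] acts as a
    loop over the indices. *)
Lemma flatx_iota (F : word -> word) n :
  flatx (fun _ u _ => F u) [::] (nseq n Ktick) = flatten [seq F (nseq i Ktick) | i <- iota 0 n].
Proof.
rewrite -[[::]]/(nseq 0 Ktick); elim: n 0 => //= n IH j.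
by rewrite -[Ktick :: nseq j Ktick]/(nseq j.+1 Ktick) IH.
Qed.

Lemma enct_sum s : enct (sumT s) = flatten [seq Kplus :: enct t | t <- s] ++ [:: Kzero].
Proof. by elim: s => //= t s ->; rewrite catA. Qed.

Lemma sumkE d i j : sumk (nseq d Ktick) (nseq i Ktick) (nseq j Ktick) = enct (distT d i j).
Proof.
rewrite /sumk flatx_iota /distT enct_sum -map_comp; congr (flatten _ ++ _).
by apply: eq_map => k; rewrite /diffw !ywE /= -?catA.
Qed.

Lemma pairwE d i j : pairw (nseq d Ktick) (nseq i Ktick) (nseq j Ktick) = enct (pairT d i j).
Proof. by rewrite /pairw !ywE sumkE /pairT /= -!catA /= -?catA. Qed.

Lemma sumjE d i : sumj (nseq d Ktick) (nseq i Ktick)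
  = enct (sumT [seq pairT d i j | j <- iota 0 d.+2]).
Proof.
rewrite /sumj -[[:: _, _ & _]]/(nseq d.+2 Ktick) flatx_iota enct_sum -map_comp.
by congr (flatten _ ++ _); apply: eq_map => j; rewrite pairwE.
Qed.

Lemma sumiE d : sumi (nseq d Ktick) = enct (mainT d).
Proof.
rewrite /sumi -[[:: _, _ & _]]/(nseq d.+2 Ktick) flatx_iota /mainT enct_sum -map_comp.
by congr (flatten _ ++ _); apply: eq_map => i; rewrite sumjE.
Qed.

Lemma coefwE p : coefw (enc_int p) = enct (coefT p).
Proof.
rewrite /coefw /coefT /enc_int; case: (p < 0)%R => /=.
  by rewrite enct_num ?enc_nat_dig.
have -> : hd_test (pred1 Kminus) false (enc_nat `|p|) = false.
  by have [a [x [-> ]]] := enc_nat_cons `|p|; case: a.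
by rewrite enct_num ?enc_nat_dig.
Qed.

Lemma rhowE p q : rhow (enc_int p) (enc_nat q) = enct (rhoT p q).
Proof. by rewrite /rhow coefwE /rhoT /= enct_num ?enc_nat_dig // -!catA. Qed.

Lemma neqwE t f : neqw (enct t) (encq f) = encq (neqF t f).
Proof. by rewrite /neqw /neqF /= -?catA. Qed.

Lemma membership_bodyE d f p q :
  membership_body (nseq d Ktick) (enc_int p) (enc_nat q) (encs f)
  = nseq (2 + d.+2 * d.+1) Kall ++ encq (membershipF d f p q).
Proof.
rewrite /membership_body offsE rhowE nnf_wordE sumiE; congr (_ ++ _).
  by rewrite [size _]/= size_nseq /rep; move: (_ + _); elim=> //= n ->.
rewrite /membershipF -!neqwE; congr (neqw _ (neqw _ _)).
rewrite -[[:: _, _ & _]]/(nseq d.+2 Ktick) flatx_iota.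
elim: (iota 0 d.+2) => //= i s <-; rewrite -catA; congr (_ :: _ ++ _).
by rewrite offsE size_nseq tr_wordE ?nnf_positive // /idx addn0.
Qed.

Lemma membership_bd d f p q : sbd d f -> qbd (2 + d.+2 * d.+1) (membershipF d f p q).
Proof.
move=> hf; set N := _ + _.
have hN : 0 < N by [].
have hi i k : i < d.+2 -> k < d.+1 -> idx d i k < N.
  by move=> h1 h2; rewrite /idx /N; nia.
have sumbd s : tbd N (sumT s) = all (tbd N) s by elim: s => //= t s ->.
have hc : tbd N (coefT p) by rewrite /coefT; case: ifP => _ /=; rewrite ?numT_bd.
have hpair i j : i < d.+2 -> j < d.+2 -> tbd N (pairT d i j).
  move=> h1 h2; have hd : tbd N (distT d i j).
    rewrite /distT sumbd all_map; apply/allP => k.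
    by rewrite mem_iota add0n => /andP[_ hk] /=; rewrite !hi //; lia.
  by rewrite /= !hi // hd.
have hm : tbd N (mainT d).
  rewrite /mainT sumbd all_map; apply/allP => i; rewrite mem_iota add0n => /andP[_ h1].
  have : all (tbd N) [seq pairT d i j | j <- iota 0 d.+2].
    by rewrite all_map; apply/allP => j; rewrite mem_iota add0n => /andP[_ h2]; exact: hpair.
  by rewrite -sumbd.
have hg s : all (fun i => i < d.+2) s -> qbd N
    (foldr (fun i g => ROr (trF (idx d i 0) (nnf false f)) g)
       (RAnd (RAtom Cge (RVar 1)) (RAtom Cle (mainT d))) s).
  elim: s => [_|i s IH /= /andP[hi1 /IH ->]].
    by change (is_true ((1 < N) && tbd N (mainT d))); rewrite hm.
  rewrite andbT; apply: (@trF_bd _ _ d) => //; last by rewrite nnf_sbd.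
  by rewrite /idx /N; nia.
have := hg (iota 0 d.+2); rewrite /membershipF; move: (foldr _ _ _) => g {}hg.
rewrite /= !numT_bd hc hg //; apply/allP => i.
by rewrite mem_iota add0n => /andP[].
Qed.

Section MembershipSemantics.
Variable R : realType.
Local Open Scope ring_scope.
Implicit Types v : nat -> R.

Lemma teval_sum v s : teval v (sumT s) = \sum_(t <- s) teval v t.
Proof. by elim: s => [|t s IH] /=; rewrite ?big_nil // big_cons IH. Qed.

Lemma sum_iota n (F : nat -> R) : \sum_(i <- iota 0 n) F i = \sum_(i < n) F i.
Proof. by rewrite -(big_mkord predT) /index_iota subn0. Qed.

Definition point d v i : 'rV[R]_d := \row_(k < d) v (idx d i k).

Lemma teval_main d v : v 0%N = -1 -> teval v (mainT d)
  = \sum_(i < d.+2) \sum_(j < d.+2) v (idx d i d) ^+ 2 * v (idx d j d) ^+ 2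
      * (nrm2 (point d v i - point d v j) - 2 * v 1%N ^+ 2).
Proof.
move=> v0; rewrite /mainT teval_sum big_map sum_iota; apply: eq_bigr => i _.
rewrite teval_sum big_map sum_iota; apply: eq_bigr => j _.
rewrite /= /distT teval_sum big_map sum_iota v0.
have -> : \sum_(k < d) teval v (sqT (RAdd (RVar (idx d i k)) (RMul (RVar 0) (RVar (idx d j k)))))
    = nrm2 (point d v i - point d v j).
  by apply: eq_bigr => k _; rewrite /= !mxE v0; ring.
by ring.
Qed.

Lemma rsat_neq v t f : rsat v (neqF t f) = (teval v t != 0) || rsat v f.
Proof. by rewrite /=; case: ltgtP. Qed.

Lemma rsat_disj v (G : nat -> rqf) f s :
  rsat v (foldr (fun i g => ROr (G i) g) f s) = has (fun i => rsat v (G i)) s || rsat v f.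
Proof. by elim: s => //= i s ->; rewrite orbA. Qed.

Lemma membership_sat d f p q : sbd d f -> (0 < q)%N ->
  (forall v : nat -> R, rsat v (membershipF d f p q)) <->
  radius_at_most [set x : 'rV[R]_d | ssat (vf x) f]%classic (ratr (p%:Q / q%:Q)).
Proof.
move=> hf hq; rewrite radius_dual; set r : R := ratr _.
have hr : q%:R * r = p%:~R.
  rewrite /r fmorph_div /= !ratr_int mulrC divfK //.
  by rewrite pnatr_eq0 -lt0n.
have q0 : (q%:R : R) != 0 by rewrite pnatr_eq0 -lt0n.
have satE v : v 0%N = -1 -> v 1%N = r -> rsat v (membershipF d f p q)
    = has (fun i => ~~ ssat (vf (point d v i)) f) (iota 0 d.+2)
      || ((0 <= r) && (\sum_(i < d.+2) \sum_(j < d.+2) v (idx d i d) ^+ 2 * v (idx d j d) ^+ 2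
      * (nrm2 (point d v i - point d v j) - 2 * r ^+ 2) <= 0)).
  move=> v0 v1; rewrite /membershipF !rsat_neq rsat_disj.
  have -> : teval v (RAdd (RVar 0) ROne) = 0 by rewrite /= v0; ring.
  have -> : teval v (rhoT p q) = 0.
    by rewrite /rhoT /= teval_num ?enc_nat_dig // enc_natK teval_coef // v0 v1 hr; ring.
  have -> : rsat v (RAnd (RAtom Cge (RVar 1)) (RAtom Cle (mainT d)))
    = (0 <= v 1%N) && (teval v (mainT d) <= 0) by [].
  rewrite eqxx (_ : ~~ true = false) // !orFb teval_main // v1; congr (_ || _); apply: eq_has => i.
  rewrite rsat_tr ?nnf_positive // ssat_nnf eqbF_neg; congr (~~ _).
  by apply: ssat_ext hf _ => k hk; rewrite (@vf_row R d (fun k => v (idx d i k)) k hk) /idx addn0.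
split=> [H y mu hy|H v].
  (* The inverse of [idx]: behind the two special variables, division by [d.+1] yields the point and
     the place in its block, whose last place holds the weight. *)
  pose v n : R := if n == 0%N then -1 else if n == 1%N then r else
    if ((n - 2) %% d.+1 < d)%N then vf (y ((n - 2) %/ d.+1)%N) ((n - 2) %% d.+1) else mu ((n - 2) %/ d.+1)%N.
  have vE i k : (k < d.+1)%N -> v (idx d i k) = if (k < d)%N then vf (y i) k else mu i.
    move=> hk; rewrite /v /idx addnC addnA.
    have -> : (k + 2 + i * d.+1 == 0)%N = false by lia.
    have -> : (k + 2 + i * d.+1 == 1)%N = false by lia.
    have -> : (k + 2 + i * d.+1 - 2 = i * d.+1 + k)%N by lia.
    by rewrite modnMDl divnMDl // modn_small // divn_small // addn0.
  have pE i : point d v i = y i.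
    by apply/rowP => k; rewrite mxE vE ?ltnS ?(ltnW (ltn_ord k)) // ltn_ord vfE.
  have mE i : v (idx d i d) = mu i by rewrite vE // ltnn.
  have := H v; rewrite satE //.
  have -> : has (fun i => ~~ ssat (vf (point d v i)) f) (iota 0 d.+2) = false.
    apply/hasPn => i; rewrite mem_iota /= => hi; rewrite pE negbK.
    exact: hy.
  case/andP=> r0 hs; split=> //; apply: le_trans hs.
  rewrite le_eqVlt; apply/orP; left; apply/eqP.
  by apply: eq_bigr => i _; apply: eq_bigr => j _; rewrite !pE !mE.
(* A valuation violating one of the two premises on the special variables satisfies the formula
   trivially. *)
have [v0|v0] := eqVneq (v 0%N) (-1); last first.
  rewrite /membershipF rsat_neq; apply/orP; left.
  by rewrite /= addr_eq0.
have [v1|v1] := eqVneq (v 1%N) r; last first.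
  rewrite /membershipF !rsat_neq; apply/orP; right; apply/orP; left.
  rewrite /rhoT /= teval_num ?enc_nat_dig // enc_natK teval_coef // v0 mulN1r subr_eq0 -hr.
  by apply: contra_neq v1 => /(mulfI q0).
rewrite satE //; have [//|hn] := boolP (has _ _); apply/andP.
apply: (H (fun i => point d v i) (fun i => v (idx d i d))) => i hi.
by move/hasPn: hn => /(_ i); rewrite mem_iota negbK; apply.
Qed.

Lemma membership_map_correct w :
  accepts (p := radius_problem R) w <->
  accepts (p := true_universal_sentences R) (membership_map w).
Proof.
have hi z (r : word) : hd_test (fun a => ~~ istick a) true (enc_int z ++ r).
  have [a [x [E ha]]] := enc_nat_cons `|z|.
  by rewrite /enc_int; case: ifP => // _; rewrite E /=; case: (a) ha.
have hs g : hd_test (fun a => ~~ isdig a) true (encs g).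
  by have [a [x [-> ]]] := encs_cons g; case: a.
have hii z : all isint (enc_int z).
  have h m : all isint (enc_nat m) by apply/allP => a /(allP (enc_nat_dig m)); case: a.
  by rewrite /enc_int; case: ifP => _ //=.
have hn d : all istick (nseq d Ktick) by rewrite all_nseq orbT.
have bodyE d f p q : membership_body (lead istick (enc_instance d f p q))
      (lead isint (after istick (enc_instance d f p q)))
      (lead isdig (behead (after isint (after istick (enc_instance d f p q)))))
      (after isdig (behead (after isint (after istick (enc_instance d f p q)))))
    = nseq (2 + d.+2 * d.+1) Kall ++ encq (membershipF d f p q).
  rewrite /enc_instance lead_cat // after_cat // lead_stop // after_stop // cats0.
  rewrite lead_cat // after_cat //= cats0.
  by rewrite lead_cat ?enc_nat_dig // after_cat ?enc_nat_dig // lead_stop // after_stop // cats0 membership_bodyE.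
have valid d f p q : vars_lt (size (lead istick (enc_instance d f p q))) (enc_instance d f p q)
    = sbd d f.
  rewrite /enc_instance lead_cat // lead_stop // cats0 size_nseq vars_lt_ticks.
  rewrite vars_lt_nonvar ?enc_int_nonvar //= vars_lt_nonvar.
    by rewrite -[encs f]cats0 vars_lt_sa //= andbT.
  by apply/allP => a /(allP (enc_nat_dig q)); case: a.
rewrite accepts_radius accepts_sentence /membership_map; split.
  case=> d [f [p [q [hf hq -> hr]]]]; rewrite rrun_instance // valid hf bodyE.
  exists (2 + d.+2 * d.+1)%N, (membershipF d f p q); split=> //.
    exact: membership_bd.
  exact/membership_sat.
case: ifP => [/andP[/instance_sound[d [f [p [q [-> hq]]]]]]|_]; last first.
  (* The empty word is no sentence, as no formula has an empty code. *)
  case=> n [f [_ E]]; have := encq_nil f [::].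
  by have := congr1 size E; rewrite size_cat cats0; case: (encq f) => // a x; rewrite /= addnS.
rewrite valid bodyE => hf [n [g [_ /sentence_inj[_ <-] /(membership_sat _ hf hq) hr]]].
by exists d, f, p, q.
Qed.

End MembershipSemantics.

Theorem theorem17 (R : realType) :
  complete_for (forallR R) (radius_problem R).
Proof.
split.
  (* [polytime_fp] appends a word function to an existing machine, here the machine of the
     identity. *)
  exists (membership_map \o id); split; first exact: polytime_fp polytime_id fp_membership_map.
  exact: membership_map_correct.
move=> Q [f [hf fP]]; exists (hardness_map \o f); split.
  exact: polytime_fp hf fp_hardness_map.
by move=> w; rewrite fP; exact: hardness_map_correct.
Qed.
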